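(* Let $A$ be a Noetherian UFD, $M$ a componentwise free $A[\mathbf x]$-module with $\operatorname{rdim}_A(M)=r$ and $\underline f=(f_0,\dots,f_r)$ a filter-regular sequence for $M$. Then the complex $\mathbf K^\nu_\bullet(\underline f,M)$ is generically exact for $\nu\in\mathbb N^q$ large enough, and $$\det_A\big(\mathbf K^\nu_\bullet(\underline f,M)\big)=\chi_A\big((M/(\underline f)M)_\nu\big)\pmod{A^\times}$$ for $\nu\in\mathbb N^q$ large enough.
   Context: Rings are commutative with $1$. Fix $q\ge1$, $n_1,\dots,n_q\ge1$, variables $\mathbf x=(x_{p,i})_{1\le p\le q,0\le i\le n_p}$; $A[\mathbf x]$ is $\mathbb N^q$-graded with coefficients in multidegree $0$ and $x_{p,i}$ of multidegree $\mathbf e_p$ (canonical basis vector). Multigraded modules are graded by $\mathbb N^q$, ordered componentwise; ''for $\nu$ large enough'' means for all $\nu\ge\nu_0$, some $\nu_0\in\mathbb N^q$. A multigraded module is eventually zero if its components vanish for large multidegree. A componentwise free $A[\mathbf x]$-module is a finitely generated multigraded $A[\mathbf x]$-module whose components are free $A$-modules of finite rank. A multihomogeneous $f\in A[\mathbf x]$ is filter-regular for $M$ if $(0:_Mf)=\{m\in M: fm=0\}$ is eventually zero; $(f_0,\dots,f_r)$ is a filter-regular sequence for $M$ if all $f_i$ are multihomogeneous and $f_i$ is filter-regular for $M/(f_0,\dots,f_{i-1})M$ for $i=0,\dots,r$. $\operatorname{rdim}_A(M)$: with $K$ the fraction field of $A$, the total degree ($-1$ for the zero polynomial) of the unique polynomial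 $H_M$ with $H_M(d)=\dim_K(M_d\otimes_AK)$ for $d$ large enough. Koszul complex: with $d^{(i)}$ the multidegree of $f_i$ and $R=A[\mathbf x]$, $\mathbf K_p(\underline f,M)=\bigwedge^p(R^{r+1})\otimes_RM$ for $0\le p\le r+1$, with differential $e_{i_1}\wedge\dots\wedge e_{i_p}\otimes m\mapsto\sum_{s=1}^p(-1)^{s+1}f_{i_s}e_{i_1}\wedge\dots\wedge\widehat{e_{i_s}}\wedge\dots\wedge e_{i_p}\otimes m$, graded by $\deg(e_{i_1}\wedge\dots\wedge e_{i_p}\otimes m)=d^{(i_1)}+\dots+d^{(i_p)}+\deg m$. $\mathbf K^\nu_\bullet(\underline f,M)$ is the component of multidegree $\nu$, a complex of free $A$-modules of finite rank. Cayley determinant: a finite complex $C_\bullet:0\to C_s\xrightarrow{d_s}\cdots\xrightarrow{d_1}C_0\to0$ of $A$-modules is generically exact if $C_\bullet\otimes_AK$ is exact. If the $C_i$ are finite free, choose bases $b_i$ of $C_i$ partitioned as $b_i=b_i'\cup b_i''$ with $b_0''=b_s'=\emptyset$ so that the block $\phi_i$ of the matrix of $d_i$ from the span of $b_i''$ to the span of $b_{i-1}'$ is square with nonzero determinant; then $\det_A(C_\bullet)=\prod_{i=1}^s\det(\phi_i)^{(-1)^{i+1}}\in K^\times/A^\times$, independent of the choices. Content: for a finitely generated torsion $A$-module $N$ (i.e. $\operatorname{Ann}_A(N)\neq0$), $\chi_A(N)=\prod_\pi\pi^{\ell(N_{(\pi)})}$, with $\pi$ running over representatives of the irreducible elements of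 $A$ and $\ell$ the length over $A_{(\pi)}$. (Part of the claim is that $(M/(\underline f)M)_\nu$ is torsion for $\nu$ large enough.) *)

(* Defs.v *)
From HB Require Import structures.
From mathcomp Require Import all_boot all_algebra.
From mathcomp Require Import mpoly.
From mathcomp Require Import boolp.
From mathcomp Require Import ring.

Set Implicit Arguments.
Unset Strict Implicit.
Unset Printing Implicit Defensive.

Import GRing.Theory.
Local Open Scope ring_scope.
Local Open Scope quotient_scope.

Local Notation "x %:F" := (tofrac x).

Section SubQuotient.
Variables (A : comNzRingType) (V : lmodType A).

(* Submodules are values of the library type [submodClosed V]; membership is
   boolean, which is no restriction since [asbool] is available. *)
Definition subm (U : submodClosed V) : Type := {x : V | x \in U}.

HB.instance Definition _ (U : submodClosed V) :=
  SubChoice.copy (subm U) {x : V | x \in U}.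
HB.instance Definition _ (U : submodClosed V) :=
  [SubChoice_isSubLmodule of subm U by <:].

Fact submod_zmod_closed (U : submodClosed V) : zmod_closed U.
Proof. by case: (submodClosedP U) => U0 UD; split=> // x y xU yU;
  rewrite addrC -scaleN1r UD. Qed.
Definition submod_zmod (U : submodClosed V) : zmodClosed V :=
  HB.pack (U : {pred V}) (GRing.isZmodClosed.Build V (U : {pred V}) (submod_zmod_closed U)).

(* [{ideal_quot _}] is a quotient by an arbitrary additive subgroup. *)
Definition quotm (U : submodClosed V) : Type := {ideal_quot submod_zmod U}.

HB.instance Definition _ (U : submodClosed V) := GRing.Zmodule.on (quotm U).
HB.instance Definition _ (U : submodClosed V) := ZmodQuotient.on (quotm U).

Definition quotm_pi (U : submodClosed V) (x : V) : quotm U := \pi_(quotm U) x.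

Definition quotm_scale (U : submodClosed V) (a : A) (x : quotm U) : quotm U :=
  quotm_pi U (a *: repr x).

Lemma quotm_piP U x y : (quotm_pi U x = quotm_pi U y) <-> (x - y \in U).
Proof.
rewrite -[x - y \in U]/(x - y \in submod_zmod U) Quotient.idealrBE.
by split=> [h | /eqP //]; apply/eqP.
Qed.

Lemma quotm_reprK U (x : quotm U) : quotm_pi U (repr x) = x.
Proof. by rewrite /quotm_pi reprK. Qed.

Lemma quotm_piD U : {morph quotm_pi U : x y / x + y}.
Proof. by move=> x y; rewrite /quotm_pi [LHS](raddfD (\pi_(quotm U))). Qed.

Lemma quotm_pi0 U : quotm_pi U 0 = 0.
Proof. by apply: (addrI (quotm_pi U 0)); rewrite -quotm_piD !addr0. Qed.

Lemma quotm_piZ U a x : quotm_scale a (quotm_pi U x) = quotm_pi U (a *: x).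
Proof.
by apply/quotm_piP; rewrite -scalerBr rpredZ //; apply/quotm_piP/quotm_reprK.
Qed.

Fact quotm_scaleA U a b (x : quotm U) :
  quotm_scale a (quotm_scale b x) = quotm_scale (a * b) x.
Proof. by rewrite -[x]quotm_reprK !quotm_piZ scalerA. Qed.
Fact quotm_scale1 U : left_id 1 (@quotm_scale U).
Proof. by move=> x; rewrite -[x]quotm_reprK !quotm_piZ scale1r. Qed.
Fact quotm_scaleDr U : right_distributive (@quotm_scale U) +%R.
Proof.
move=> a x y; rewrite -[x]quotm_reprK -[y]quotm_reprK.
by rewrite -quotm_piD !quotm_piZ -quotm_piD scalerDr.
Qed.
Fact quotm_scaleDl U (x : quotm U) :
  {morph (@quotm_scale U)^~ x : a b / a + b}.
Proof.
by move=> a b; rewrite -[x]quotm_reprK !quotm_piZ -quotm_piD scalerDl.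
Qed.

HB.instance Definition _ (U : submodClosed V) :=
  GRing.Zmodule_isLmodule.Build A (quotm U) (@quotm_scaleA U) (@quotm_scale1 U)
    (@quotm_scaleDr U) (@quotm_scaleDl U).

End SubQuotient.

Section ModuleNotions.
Variables (A : comNzRingType) (V : lmodType A).

Definition fin_gen : Prop :=
  exists (t : nat) (g : 'I_t -> V),
    forall v, exists c : 'I_t -> A, v = \sum_i c i *: g i.

Definition is_basis (I : finType) (b : I -> V) : Prop :=
  forall v, exists! c : {ffun I -> A}, v = \sum_i c i *: b i.

Definition has_basis_of_card (t : nat) : Prop :=
  exists b : 'I_t -> V, is_basis b.

Definition free_fin : Prop := exists t, has_basis_of_card t.

Definition torsion : Prop := exists2 a : A, a != 0 & forall v : V, a *: v = 0.

Definition strict_chain (t : nat) (U : nat -> submodClosed V) : Prop :=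
  forall i, (i < t)%N -> {subset U i <= U i.+1} /\ ~ {subset U i.+1 <= U i}.

Definition has_length (t : nat) : Prop :=
  (exists U, strict_chain t U) /\
  (forall t' U, strict_chain t' U -> (t' <= t)%N).

End ModuleNotions.

Definition noetherian (A : comNzRingType) : Prop :=
  forall I : submodClosed A^o, fin_gen (subm I).

Section Factorization.
Variable A : idomainType.

Definition divides (a b : A) : Prop := exists c, b = a * c.

Definition associate (a b : A) : Prop :=
  exists2 u : A, u \is a GRing.unit & b = u * a.

Definition irreducible (a : A) : Prop :=
  [/\ a != 0, a \isn't a GRing.unit &
      forall b c, a = b * c -> b \is a GRing.unit \/ c \is a GRing.unit].

Definition ufd : Prop :=
  (forall a : A, a != 0 -> a \isn't a GRing.unit ->
     exists2 s : seq A, {in s, forall x, irreducible x} & a = \prod_(x <- s) x)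
  /\
  (forall s t : seq A,
     {in s, forall x, irreducible x} -> {in t, forall x, irreducible x} ->
     \prod_(x <- s) x = \prod_(x <- t) x ->
     exists t' : seq A, [/\ perm_eq t t', size s = size t' &
       forall i, (i < size s)%N -> associate s`_i t'`_i]).

Definition prime_elt (a : A) : Prop :=
  a \isn't a GRing.unit /\
  forall b c, divides a (b * c) -> divides a b \/ divides a c.

Lemma irreducibleZ u a :
  u \is a GRing.unit -> irreducible a -> irreducible (u * a).
Proof.
move=> uu [a0 aU aP]; split.
- by rewrite mulf_neq0 //; apply: contraTneq uu => ->; rewrite unitr0.
- by rewrite unitrM uu.
move=> b c e; have : a = (u^-1 * b) * c by rewrite -mulrA -e mulKr.
by case/aP; rewrite ?unitrM ?unitrV ?uu; [left | right].
Qed.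

Lemma ufd_irreducible_prime : ufd ->
  forall a, irreducible a -> prime_elt a.
Proof.
case=> fact uniq a ai; have [a0 aU aP] := ai; split=> // b c [e abc].
have [-> | b0] := eqVneq b 0; first by left; exists 0; rewrite mulr0.
have [-> | c0] := eqVneq c 0; first by right; exists 0; rewrite mulr0.
have [bu | bU] := boolP (b \is a GRing.unit).
  by right; exists (b^-1 * e); rewrite mulrCA -abc mulKr.
have [cu | cU] := boolP (c \is a GRing.unit).
  by left; exists (c^-1 * e); rewrite mulrCA -abc mulrC mulrK.
have e0 : e != 0.
  by apply: contra_neq (mulf_neq0 b0 c0) => e0; rewrite abc e0 mulr0.
have [t tI te] : exists2 t : seq A, {in t, forall x, irreducible x} &
    a * e = \prod_(x <- t) x /\ exists2 x, x \in t & divides a x.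
  have [eu | eU] := boolP (e \is a GRing.unit).
    exists [:: e * a].
      by move=> x; rewrite inE => /eqP ->; apply: irreducibleZ.
    split; first by rewrite big_seq1 mulrC.
    by exists (e * a); rewrite ?mem_head //; exists e; rewrite mulrC.
  have [t tI ->] := fact _ e0 eU; exists (a :: t).
    by move=> x; rewrite inE => /orP[/eqP -> | /tI].
  split; first by rewrite big_cons.
  by exists a; rewrite ?mem_head //; exists 1; rewrite mulr1.
have [s1 s1I s1e] := fact _ b0 bU; have [s2 s2I s2e] := fact _ c0 cU.
have {te} [te [x xt [y xy]]] := te.
have sI : {in s1 ++ s2, forall x, irreducible x}.
  by move=> z; rewrite mem_cat => /orP[/s1I | /s2I].
have [|t' [tt' sz ass]] := uniq _ _ sI tI.
  by rewrite big_cat /= -s1e -s2e abc te.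
have xt' : x \in t' by rewrite -(perm_mem tt').
have it : (index x t' < size (s1 ++ s2))%N by rewrite sz index_mem.
have [u uu] := ass _ it; rewrite nth_index // => xe.
set z := _`__ in xe; have az : divides a z.
  by exists (u^-1 * y); rewrite mulrCA -xy xe mulKr.
have zs : z \in s1 ++ s2 by apply: mem_nth.
have dvd_prod (s : seq A) : z \in s -> divides a (\prod_(w <- s) w).
  move=> zin; rewrite (perm_big _ (perm_to_rem zin)) big_cons.
  by case: az => w e'; exists (w * \prod_(j <- rem z s) j); rewrite mulrA -e'.
by move: zs; rewrite mem_cat => /orP[/dvd_prod | /dvd_prod];
  rewrite -?s1e -?s2e; [left | right].
Qed.

Definition nonzero : {pred A} := [pred a | a != 0].

Fact nonzero_mulr_closed : mulr_closed nonzero.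
Proof. by split=> [|a b]; rewrite !inE ?oner_eq0 //; apply: mulf_neq0. Qed.
HB.instance Definition _ := GRing.isMulClosed.Build A nonzero nonzero_mulr_closed.

Definition not_multiple (a : A) (_ : prime_elt a) : {pred A} :=
  [pred s | `[< ~ divides a s >]].

Fact not_multiple_mulr_closed a (pa : prime_elt a) :
  mulr_closed (not_multiple pa).
Proof.
case: (pa) => aU ap; split=> [|s t]; rewrite !inE.
  apply/asboolP => -[c e]; case/negP: aU.
  by apply/unitrPr; exists c.
by move=> /asboolP hs /asboolP ht; apply/asboolP => /ap[].
Qed.
HB.instance Definition _ a (pa : prime_elt a) :=
  GRing.isMulClosed.Build A (not_multiple pa) (not_multiple_mulr_closed pa).

End Factorization.

Section Localization.
Variable A : idomainType.
Variable S : mulrClosed A.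

Local Notation K := {fraction A}.
Local Notation denom := {s : A | s \in S}.

(* S^-1 A, as the subring of the a / s in the fraction field (for 0 not in S) *)
Definition locring_pred : {pred K} :=
  [pred x | `[< exists p : A * denom, x = p.1%:F / (sval p.2)%:F >]].

Definition denom1 : denom := exist _ 1 (rpred1 S).
Definition denomM (s t : denom) : denom :=
  exist _ (sval s * sval t) (rpredM (svalP s) (svalP t)).

Lemma locring_predP (x : K) :
  reflect (exists p : A * denom, x = p.1%:F / (sval p.2)%:F)
          (x \in locring_pred).
Proof. exact: asboolP. Qed.

Fact locring_subring_closed : subring_closed locring_pred.
Proof.
split=> [|_ _ /locring_predP[[a s] ->] /locring_predP[[b t] ->]|
         _ _ /locring_predP[[a s] ->] /locring_predP[[b t] ->]];
  apply/locring_predP => /=.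
- by exists (1, denom1); rewrite /= divr1.
- have [s0 | s0] := eqVneq (sval s) 0.
    by exists (- b, t); rewrite /= s0 tofrac0 invr0 mulr0 sub0r tofracN mulNr.
  have [t0 | t0] := eqVneq (sval t) 0.
    by exists (a, s); rewrite /= t0 tofrac0 invr0 mulr0 subr0.
  exists (a * sval t - b * sval s, denomM s t) => /=.
  rewrite tofracB !tofracM -mulNr addf_div ?tofrac_eq0 // mulNr.
  by rewrite [X in _ - X]mulrC mulrC.
exists (a * b, denomM s t) => /=.
by rewrite !tofracM mulf_div.
Qed.
HB.instance Definition _ :=
  GRing.isSubringClosed.Build K locring_pred locring_subring_closed.

Definition locring : Type := {x : K | x \in locring_pred}.
HB.instance Definition _ := SubChoice.copy locring {x : K | x \in locring_pred}.
HB.instance Definition _ := [SubChoice_isSubComNzRing of locring by <:].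

Lemma denomMC s t : denomM s t = denomM t s.
Proof. by apply: val_inj; rewrite /= mulrC. Qed.

Section LocalizedModule.
Variable V : lmodType A.

(* Fractions v / s, modulo
   v / s = w / t <-> u (t v - s w) = 0 for some u in S. *)
Definition loc_equiv (x y : V * denom) : bool :=
  `[< exists u : denom,
        sval u *: (sval y.2 *: x.1) = sval u *: (sval x.2 *: y.1) >].

Fact loc_equiv_class : equiv_class_of loc_equiv.
Proof.
split=> [x|x y|y x z].
- by apply/asboolP; exists denom1.
- by apply/asboolP/asboolP => -[u e]; exists u.
move=> /asboolP[u e] /asboolP[u' e']; apply/asboolP.
exists (denomM (denomM u u') (y.2)) => /=; rewrite !scalerA.
transitivity ((sval u' * sval z.2) *: (sval u *: (sval y.2 *: x.1))).
  by rewrite !scalerA; congr (_ *: _); ring.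
rewrite e; transitivity ((sval u * sval x.2) *: (sval u' *: (sval z.2 *: y.1))).
  by rewrite !scalerA; congr (_ *: _); ring.
by rewrite e' !scalerA; congr (_ *: _); ring.
Qed.

Canonical loc_equiv_equiv := EquivRelPack loc_equiv_class.
Canonical loc_equiv_encModRel := defaultEncModRel loc_equiv.

Definition locmod : Type := {eq_quot loc_equiv}.
HB.instance Definition _ := Choice.on locmod.

Definition locfrac (v : V) (s : denom) : locmod := \pi_({eq_quot loc_equiv}) (v, s).

Lemma fracP v s w t :
  locfrac v s = locfrac w t <->
  exists u : denom, sval u *: (sval t *: v) = sval u *: (sval s *: w).
Proof.
split=> [/eqmodP/asboolP // | h].
by apply/eqmodP/asboolP.
Qed.

Lemma fracW (x : locmod) : exists v s, x = locfrac v s.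
Proof. by case: (repr x) (reprK x) => v s <-; exists v, s. Qed.

Definition num (x : locmod) : V := (repr x).1.
Definition den (x : locmod) : denom := (repr x).2.

Lemma num_denK x : locfrac (num x) (den x) = x.
Proof. by rewrite /locfrac /num /den -surjective_pairing reprK. Qed.

Definition loc_add (x y : locmod) : locmod :=
  locfrac (sval (den y) *: num x + sval (den x) *: num y) (denomM (den x) (den y)).
Definition loc_opp (x : locmod) : locmod := locfrac (- num x) (den x).
Definition loc_zero : locmod := locfrac 0 denom1.

Lemma loc_addE v s w t :
  loc_add (locfrac v s) (locfrac w t) = locfrac (sval t *: v + sval s *: w) (denomM s t).
Proof.
have /fracP[u e] := num_denK (locfrac v s).
have /fracP[u' e'] := num_denK (locfrac w t).
rewrite /loc_add; move: (num (locfrac v s)) (den (locfrac v s)) e => v' s' e.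
move: (num (locfrac w t)) (den (locfrac w t)) e' => w' t' e'.
apply/fracP; exists (denomM u u') => /=; rewrite !scalerDr.
congr (_ + _); rewrite !scalerA.
  transitivity ((sval u' * sval t * sval t') *: (sval u *: (sval s *: v'))).
    by rewrite scalerA scalerA; congr (_ *: _); ring.
  by rewrite e !scalerA; congr (_ *: _); ring.
transitivity ((sval u * sval s * sval s') *: (sval u' *: (sval t *: w'))).
  by rewrite scalerA scalerA; congr (_ *: _); ring.
by rewrite e' !scalerA; congr (_ *: _); ring.
Qed.

Lemma loc_oppE v s : loc_opp (locfrac v s) = locfrac (- v) s.
Proof.
have /fracP[u e] := num_denK (locfrac v s); apply/fracP; exists u.
by rewrite !scalerN e.
Qed.

Lemma frac0 s : locfrac 0 s = loc_zero.
Proof. by apply/fracP; exists denom1; rewrite !scaler0. Qed.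

Lemma frac_cancel u v s : locfrac (sval u *: v) (denomM u s) = locfrac v s.
Proof.
by apply/fracP; exists denom1 => /=; rewrite !scalerA; congr (_ *: _); ring.
Qed.

Fact loc_addA : associative loc_add.
Proof.
move=> x y z; have [v [s ->]] := fracW x; have [w [t ->]] := fracW y.
have [r [p ->]] := fracW z; rewrite !loc_addE; apply/fracP; exists denom1 => /=.
by rewrite !scalerDr !scalerA addrA; do 2?[congr (_ + _)]; congr (_ *: _); ring.
Qed.

Fact loc_addC : commutative loc_add.
Proof.
move=> x y; have [v [s ->]] := fracW x; have [w [t ->]] := fracW y.
by rewrite !loc_addE addrC denomMC.
Qed.

Fact loc_add0 : left_id loc_zero loc_add.
Proof.
move=> x; have [v [s ->]] := fracW x; rewrite loc_addE scaler0 add0r.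
exact: frac_cancel.
Qed.

Fact loc_addN : left_inverse loc_zero loc_opp loc_add.
Proof.
move=> x; have [v [s ->]] := fracW x.
by rewrite loc_oppE loc_addE scalerN addNr frac0.
Qed.

HB.instance Definition _ :=
  GRing.isZmodule.Build locmod loc_addA loc_addC loc_add0 loc_addN.

Lemma fracD v s w t :
  locfrac v s + locfrac w t = locfrac (sval t *: v + sval s *: w) (denomM s t).
Proof. exact: loc_addE. Qed.

(* (a / s) (v / t) = (a v) / (s t), for a scalar a / s of the fraction field *)
Definition loc_scale (x : K) (y : locmod) : locmod :=
  match pselect (exists p : A * denom, x = p.1%:F / (sval p.2)%:F) with
  | left h => let: (a, s) := sval (cid h) in locfrac (a *: num y) (denomM s (den y))
  | right _ => 0
  end.

Lemma loc_scaleE x a s v t : x = a%:F / (sval s)%:F ->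
  loc_scale x (locfrac v t) = locfrac (a *: v) (denomM s t).
Proof.
rewrite /loc_scale => xe; case: pselect => [h | []]; last by exists (a, s).
case: (sval _) (svalP (cid h)) => a' s' /=; rewrite {}xe => /eqP xe.
have triv (r : denom) y y' : sval r = 0 -> y = y' :> locmod.
  move=> r0; have [v1 [s1 ->]] := fracW y; have [v2 [s2 ->]] := fracW y'.
  by apply/fracP; exists r; rewrite r0 !scale0r.
have [s0 | s0] := eqVneq (sval s) 0; first exact: triv s0.
have [s'0 | s'0] := eqVneq (sval s') 0; first exact: triv s'0.
move: xe; rewrite eqr_div ?tofrac_eq0 // -!tofracM tofrac_eq => /eqP xe.
have /fracP[u] := num_denK (locfrac v t).
move: (num _) (den _) => v' t' e; apply/fracP; exists u => /=.
rewrite !scalerA; transitivity ((a' * sval s) *: (sval u *: (sval t *: v'))).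
  by rewrite !scalerA; congr (_ *: _); ring.
by rewrite -xe e !scalerA; congr (_ *: _); ring.
Qed.

Fact loc_scaleA x y z : x \in locring_pred -> y \in locring_pred ->
  loc_scale x (loc_scale y z) = loc_scale (x * y) z.
Proof.
move=> /locring_predP[[a s] xe] /locring_predP[[b t] ye].
have [v [r ->]] := fracW z; rewrite (loc_scaleE _ _ ye) (loc_scaleE _ _ xe).
rewrite (@loc_scaleE _ (a * b) (denomM s t)) /=; last first.
  by rewrite xe ye /= !tofracM mulf_div.
rewrite scalerA; congr (locfrac _ _).
by apply: val_inj; rewrite /= mulrA.
Qed.

Fact loc_scale1 z : loc_scale 1 z = z.
Proof.
have [v [r ->]] := fracW z; rewrite (@loc_scaleE _ 1 denom1) /= ?divr1 //.
by rewrite -[RHS](frac_cancel denom1) /=.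
Qed.

Fact loc_scaleDr x y z : x \in locring_pred ->
  loc_scale x (y + z) = loc_scale x y + loc_scale x z.
Proof.
move=> /locring_predP[[a s] xe].
have [v [r ->]] := fracW y; have [w [t ->]] := fracW z.
rewrite fracD !(loc_scaleE _ _ xe) fracD; apply/fracP; exists denom1 => /=.
by rewrite !scalerDr !scalerA; congr (_ *: _ + _ *: _); ring.
Qed.

Fact loc_scaleDl x y z : x \in locring_pred -> y \in locring_pred ->
  loc_scale (x + y) z = loc_scale x z + loc_scale y z.
Proof.
move=> /locring_predP[[a s] xe] /locring_predP[[b t] ye].
have [v [r ->]] := fracW z; rewrite (loc_scaleE _ _ ye) (loc_scaleE _ _ xe).
have triv (p : denom) w w' : sval p = 0 -> w = w' :> locmod.
  move=> p0; have [v1 [s1 ->]] := fracW w; have [v2 [s2 ->]] := fracW w'.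
  by apply/fracP; exists p; rewrite p0 !scale0r.
have [s0 | s0] := eqVneq (sval s) 0; first exact: triv s0.
have [t0 | t0] := eqVneq (sval t) 0; first exact: triv t0.
rewrite (@loc_scaleE _ (a * sval t + b * sval s) (denomM s t)) /=; last first.
  by rewrite xe ye /= addf_div ?tofrac_eq0 // tofracD !tofracM.
rewrite fracD; apply/fracP; exists denom1 => /=.
rewrite !scalerDr !scalerA -scalerDl; congr (_ *: _); ring.
Qed.

Definition locmod_scale (x : locring) (y : locmod) : locmod :=
  loc_scale (val x) y.

Fact locmod_scaleA x y z :
  locmod_scale x (locmod_scale y z) = locmod_scale (x * y) z.
Proof. exact: loc_scaleA (valP x) (valP y). Qed.
Fact locmod_scale1 : left_id 1 locmod_scale.
Proof. exact: loc_scale1. Qed.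
Fact locmod_scaleDr : right_distributive locmod_scale +%R.
Proof. by move=> x y z; apply: loc_scaleDr (valP x). Qed.
Fact locmod_scaleDl z : {morph locmod_scale^~ z : x y / x + y}.
Proof. by move=> x y; apply: loc_scaleDl (valP x) (valP y). Qed.

HB.instance Definition _ :=
  GRing.Zmodule_isLmodule.Build locring locmod
    locmod_scaleA locmod_scale1 locmod_scaleDr locmod_scaleDl.

End LocalizedModule.

Definition locmap (V W : lmodType A) (g : V -> W) (x : locmod V) : locmod W :=
  locfrac (g (num x)) (den x).

Lemma locmapE (V W : lmodType A) (g : {linear V -> W}) v s :
  locmap g (locfrac v s) = locfrac (g v) s.
Proof.
have /fracP[u e] := num_denK (locfrac v s); apply/fracP; exists u.
have gZ a x : g (a *: x) = a *: g x by rewrite linearZ_LR.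
by rewrite -!gZ e.
Qed.

End Localization.

Lemma tofrac_num_den (A : idomainType) (r : {ratio A}) :
  \pi_({fraction A}) r = r.1%:F / r.2%:F.
Proof.
have d0 : r.2 != 0 := denom_ratioP r.
have dF : r.2%:F != 0 by rewrite tofrac_eq0.
apply: (mulIf dF); rewrite divfK //.
apply: etrans (_ : \pi_({fraction A}) (FracField.mulf r (Ratio r.2 1)) = _).
  rewrite FracField.pi_mul; congr (_ * _).
  by rewrite /tofrac; unlock FracField.tofrac.
rewrite /tofrac; unlock FracField.tofrac; apply/eqmodP.
rewrite /= FracField.equivfE /FracField.mulf.
rewrite !numden_Ratio ?mulf_neq0 ?oner_eq0 //.
by rewrite !mulr1 mulrC.
Qed.

(* V (x)_A K, realized as the localization of V at the nonzero elements of A *)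
Section GenericFiber.
Variables (A : idomainType) (V : lmodType A).

Local Notation K := {fraction A}.
Local Notation S := (@nonzero A : mulrClosed A).

Lemma nonzero_locringT (x : K) : x \in locring_pred S.
Proof.
apply/locring_predP.
exists ((repr x).1, exist _ (repr x).2 (denom_ratioP (repr x))).
by rewrite -tofrac_num_den reprK.
Qed.

Definition genmod : Type := locmod S V.
HB.instance Definition _ := GRing.Zmodule.on genmod.

Definition genmod_scale (x : K) (y : genmod) : genmod := loc_scale x y.

Fact genmod_scaleA x y z :
  genmod_scale x (genmod_scale y z) = genmod_scale (x * y) z.
Proof. exact: loc_scaleA (nonzero_locringT x) (nonzero_locringT y). Qed.
Fact genmod_scale1 : left_id 1 genmod_scale.
Proof. exact: loc_scale1. Qed.
Fact genmod_scaleDr : right_distributive genmod_scale +%R.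
Proof. by move=> x y z; apply: loc_scaleDr (nonzero_locringT x). Qed.
Fact genmod_scaleDl z : {morph genmod_scale^~ z : x y / x + y}.
Proof.
by move=> x y; apply: loc_scaleDl (nonzero_locringT x) (nonzero_locringT y).
Qed.

HB.instance Definition _ :=
  GRing.Zmodule_isLmodule.Build K genmod
    genmod_scaleA genmod_scale1 genmod_scaleDr genmod_scaleDl.

End GenericFiber.

Definition genmap (A : idomainType) (V W : lmodType A) (g : V -> W) :
  genmod V -> genmod W := locmap g.

(* [cdiff C i] is d_{i+1} and [clen C] is s; the objects beyond s are zero. *)
Record complex (A : comNzRingType) := Complex {
  cobj :> nat -> lmodType A;
  cdiff : forall i, {linear cobj i.+1 -> cobj i};
  clen : nat;
  cdiffK : forall i x, cdiff i (cdiff i.+1 x) = 0;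
  cobj_gt : forall i, (clen < i)%N -> forall x : cobj i, x = 0
}.

Section Determinant.
Variables (A : idomainType) (C : complex A).

Definition generically_exact : Prop :=
  (forall y : genmod (C 0), exists x, genmap (cdiff C 0) x = y) /\
  (forall i (y : genmod (C i.+1)),
     genmap (cdiff C i) y = 0 <-> exists x, genmap (cdiff C i.+1) x = y).

(* [rho i] is the cardinality of b_i'. Since the blocks are square, that of
   b_i'' is [rho_shift rho i]; in particular b_0'' is empty. *)
Definition rho_shift (rho : nat -> nat) (i : nat) : nat :=
  if i is j.+1 then rho j else 0%N.

Definition basis_idx (rho : nat -> nat) (i : nat) : finType :=
  ('I_(rho i) + 'I_(rho_shift rho i))%type.

(* [b i (inl _)] lists b_i' and [b i (inr _)] lists b_i''; [D i] is the matrix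
   of d_{i+1} and [block D i] its block phi_{i+1}. *)
Definition block (rho : nat -> nat)
    (D : forall i, basis_idx rho i -> basis_idx rho i.+1 -> A) (i : nat) :
  'M[A]_(rho i) :=
  \matrix_(j, l) D i (inl j) (inr l).

Definition cayley_det (delta : {fraction A}) : Prop :=
  exists (rho : nat -> nat) (b : forall i, basis_idx rho i -> C i)
         (D : forall i, basis_idx rho i -> basis_idx rho i.+1 -> A),
  [/\ rho (clen C) = 0%N,
      forall i, is_basis (b i),
      forall i l, cdiff C i (b i.+1 l) = \sum_j D i j l *: b i j,
      forall i, (i < clen C)%N -> \det (block D i) != 0 &
      delta = \prod_(i < clen C) (tofrac (\det (block D i)) ^ ((-1) ^+ i))].

End Determinant.

(* N_(a) as a module over A_(a), for an irreducible element a *)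
Definition locmod_at (A : idomainType) (ufdA : ufd A) (a : A)
    (ha : irreducible a) (N : lmodType A) :
  lmodType (locring (not_multiple (ufd_irreducible_prime ufdA ha))) :=
  locmod (not_multiple (ufd_irreducible_prime ufdA ha)) N.

(* [P] lists pairwise non-associate irreducibles, among which all those, up to
   associates, where N_(a) <> 0; the remaining factors of chi_A(N) are 1. *)
Definition content (A : idomainType) (ufdA : ufd A) (N : lmodType A) (c : A) :
  Prop :=
  exists (P : seq A) (len : A -> nat),
  [/\ {in P, forall a, irreducible a},
      forall i j, (i < j < size P)%N -> ~ associate P`_i P`_j,
      forall a (ha : irreducible a), has_length (locmod_at ufdA ha N) (len a),
      forall a, irreducible a -> len a <> 0%N -> exists2 b, b \in P & associate b a &
      c = \prod_(a <- P) a ^+ len a].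

Section Multigraded.
Variables (A : idomainType) (q : nat) (n : 'I_q -> nat).

Definition nvars : nat := #|{: {p : 'I_q & 'I_(n p).+1}}|.
Definition var (p : 'I_q) (i : 'I_(n p).+1) : 'I_nvars :=
  enum_rank (Tagged (fun p => 'I_(n p).+1) i).

Local Notation R := {mpoly A[nvars]}.
Local Notation Nq := 'X_{1..q}.

Definition multideg (m : 'X_{1..nvars}) : Nq :=
  [multinom (\sum_(i < (n p).+1) m (var i))%N | p < q].

Definition homogeneous (d : Nq) (g : R) : Prop :=
  forall m, m \in msupp g -> multideg m = d.

Definition eventually (P : Nq -> Prop) : Prop :=
  exists nu0, forall nu, (nu0 <= nu)%MM -> P nu.

Section Restriction.
Variable M : lmodType R.

Definition restr : Type := M.
HB.instance Definition _ := GRing.Zmodule.on restr.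
Definition restr_scale (a : A) (x : restr) : restr := a%:MP *: (x : M).

Fact restr_scaleA a b x :
  restr_scale a (restr_scale b x) = restr_scale (a * b) x.
Proof. by rewrite /restr_scale scalerA mpolyCM. Qed.
Fact restr_scale1 : left_id 1 restr_scale.
Proof. by move=> x; rewrite /restr_scale mpolyC1 scale1r. Qed.
Fact restr_scaleDr : right_distributive restr_scale +%R.
Proof. by move=> a x y; rewrite /restr_scale scalerDr. Qed.
Fact restr_scaleDl x : {morph restr_scale^~ x : a b / a + b}.
Proof. by move=> a b; rewrite /restr_scale mpolyCD scalerDl. Qed.
HB.instance Definition _ := GRing.Zmodule_isLmodule.Build A restr
  restr_scaleA restr_scale1 restr_scaleDr restr_scaleDl.
End Restriction.

(* A module over A[x] with a family of A-submodules; it is a multigraded module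
   when [multigraded] holds. *)
Record gmodule := GModule {
  gmod :> lmodType R;
  gcomp : Nq -> submodClosed (restr gmod)
}.

Definition multigraded (M : gmodule) : Prop :=
  [/\ forall x : M, exists (s : seq Nq) (c : Nq -> M),
        (forall nu, c nu \in gcomp M nu) /\ x = \sum_(nu <- s) c nu,
      forall (s : seq Nq) (c : Nq -> M), uniq s ->
        (forall nu, c nu \in gcomp M nu) -> \sum_(nu <- s) c nu = 0 ->
        forall nu, nu \in s -> c nu = 0 &
      forall d nu (g : R) (x : M), homogeneous d g -> x \in gcomp M nu ->
        g *: x \in gcomp M (d + nu)%MM].

Definition componentwise_free (M : gmodule) : Prop :=
  [/\ multigraded M, fin_gen M & forall nu, free_fin (subm (gcomp M nu))].

Lemma componentwise_free_multigraded (M : gmodule) :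
  componentwise_free M -> multigraded M.
Proof. by case. Qed.

(* [msize] is the total degree plus one, and 0 on the zero polynomial. *)
Definition has_rdim (M : gmodule) (r : int) : Prop :=
  exists H : {mpoly rat[q]},
    eventually (fun nu => exists2 t : nat,
      has_basis_of_card (genmod (subm (gcomp M nu))) t &
      H.@[fun p => (nu p)%:R] = t%:R) /\
    r = (msize H)%:Z - 1.

Section Quotient.
Variables (M : gmodule) (U : submodClosed M).

Definition gquot_comp_pred (nu : Nq) : {pred restr (quotm U)} :=
  [pred y | `[< exists2 x, x \in gcomp M nu & y = quotm_pi U x >]].

Fact gquot_comp_closed nu : subsemimod_closed (gquot_comp_pred nu).
Proof.
split; [split|].
- by apply/asboolP; exists 0; rewrite ?rpred0 //; apply/esym/quotm_pi0.
- move=> _ _ /asboolP[x xM ->] /asboolP[y yM ->]; apply/asboolP.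
  by exists (x + y : restr M); rewrite ?rpredD // -quotm_piD.
move=> a _ /asboolP[x xM ->]; apply/asboolP.
exists (a *: (x : restr M)); first exact: rpredZ.
exact: quotm_piZ.
Qed.

HB.instance Definition _ nu :=
  GRing.isSubSemiModClosed.Build A (restr (quotm U)) (gquot_comp_pred nu)
    (gquot_comp_closed nu).

Definition gquot : gmodule := @GModule (quotm U) gquot_comp_pred.

End Quotient.

Section FormsSubmodule.
Variables (M : lmodType R) (k : nat) (f : 'I_k -> R) (i : nat).

Definition forms_pred : {pred M} :=
  [pred x | `[< exists c : 'I_k -> M, x = \sum_(j < k | (j < i)%N) f j *: c j >]].

Fact forms_closed : subsemimod_closed forms_pred.
Proof.
split; [split|].
- apply/asboolP; exists (fun _ => 0); rewrite big1 // => j _.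
  by rewrite scaler0.
- move=> _ _ /asboolP[c ->] /asboolP[c' ->]; apply/asboolP.
  exists (fun j => c j + c' j); rewrite -big_split /=.
  by apply: eq_bigr => j _; rewrite scalerDr.
move=> a _ /asboolP[c ->]; apply/asboolP; exists (fun j => a *: c j).
by rewrite scaler_sumr; apply: eq_bigr => j _; rewrite !scalerA mulrC.
Qed.

HB.instance Definition _ :=
  GRing.isSubSemiModClosed.Build R M forms_pred forms_closed.

(* (f_0, ..., f_{i-1}) M *)
Definition forms_submod : submodClosed M := forms_pred.

End FormsSubmodule.

(* (0 :_M g) is eventually zero *)
Definition filter_regular (M : gmodule) (g : R) : Prop :=
  (exists d, homogeneous d g) /\
  eventually (fun nu => forall x : M, x \in gcomp M nu -> g *: x = 0 -> x = 0).

Definition filter_regular_seq (M : gmodule) (k : nat) (f : 'I_k -> R) : Prop :=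
  (forall i, exists d, homogeneous d (f i)) /\
  forall i : 'I_k, filter_regular (gquot (forms_submod M f i)) (f i).

Section Koszul.
Variables (M : gmodule) (k : nat) (f : 'I_k -> R) (d : 'I_k -> Nq).
Hypothesis grM : multigraded M.
Hypothesis hf : forall i, homogeneous (d i) (f i).

(* [phi : {ffun {set 'I_k} -> M}] stands for the sum of the e_I (x) phi I, where
   e_I is the wedge of the e_i for i in I in increasing order; the p-th exterior
   power is the part supported on the I with #|I| = p. *)
Local Notation ext := {ffun {set 'I_k} -> restr M}.

Definition ksign (i : 'I_k) (I : {set 'I_k}) : nat := #|[set j in I | (j < i)%N]|.

Definition kdiff (phi : ext) : ext :=
  [ffun J : {set 'I_k} => \sum_(I : {set 'I_k}) \sum_(i in I | I :\ i == J)
     (-1) ^+ ksign i I *: (f i *: (phi I : M))].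

Definition kdeg (I : {set 'I_k}) : Nq := (\sum_(i in I) d i)%MM.

Definition kcomp_pred (nu : Nq) (p : nat) : {pred ext} :=
  [pred phi : ext | [forall I : {set 'I_k},
     if (#|I| == p) && (kdeg I <= nu)%MM
     then phi I \in gcomp M (nu - kdeg I)%MM else phi I == 0]].

Fact kcomp_closed nu p : subsemimod_closed (kcomp_pred nu p).
Proof.
split; [split|].
- apply/forallP => I; rewrite ffunE; case: ifP => _ //; exact: rpred0.
- move=> x y /forallP xP /forallP yP; apply/forallP => I; rewrite ffunE.
  move: (xP I) (yP I); case: ifP => _; first exact: rpredD.
  by move=> /eqP -> /eqP ->; rewrite addr0.
move=> a x /forallP xP; apply/forallP => I; rewrite ffunE.
move: (xP I); case: ifP => _; first exact: rpredZ.
by move=> /eqP ->; rewrite scaler0.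
Qed.

HB.instance Definition _ nu p :=
  GRing.isSubSemiModClosed.Build A ext (kcomp_pred nu p) (kcomp_closed nu p).

Definition kcomp (nu : Nq) (p : nat) : submodClosed ext := kcomp_pred nu p.

Lemma kdiff_linear : linear kdiff.
Proof.
move=> a x y; apply/ffunP => J; rewrite !ffunE scaler_sumr -big_split /=.
apply: eq_bigr => I _; rewrite scaler_sumr -big_split /=.
apply: eq_bigr => i _; rewrite !ffunE.
rewrite -[a *: _ + _]/((a%:MP *: (x I : M) + (y I : M)) : M).
rewrite -[a *: _]/(a%:MP *: (_ : M)).
by rewrite !scalerDr !scalerA [f i * _]mulrC mulrA [(-1) ^+ _ * a%:MP]mulrC.
Qed.

Lemma ksign_swap (I : {set 'I_k}) (i j : 'I_k) :
  i \in I -> j \in I -> (i < j)%N ->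
  (ksign j (I :\ i)).+1 = ksign j I /\ ksign i (I :\ j) = ksign i I.
Proof.
move=> iI jI ij; split; rewrite /ksign.
  rewrite [RHS](cardsD1 i) inE iI ij add1n; congr (_.+1); apply: eq_card => l.
  by rewrite !inE andbA.
apply: eq_card => l; rewrite !inE.
by case: eqVneq => [-> | _] //=; rewrite (leq_gtF (ltnW ij)) andbF.
Qed.

Lemma kdiffK phi : kdiff (kdiff phi) = 0.
Proof.
pose F (J I : {set 'I_k}) (i j : 'I_k) : M :=
  if [&& i \in I, j \in I, i != j & I :\ i :\ j == J] then
    ((-1) ^+ ksign j (I :\ i) * (-1) ^+ ksign i I) *: (f j *: (f i *: (phi I : M)))
  else 0.
have FN J I i j : F J I i j = - F J I j i.
  have E : I :\ i :\ j = I :\ j :\ i by rewrite !setDDl setUC.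
  rewrite /F E andbCA [j == i]eq_sym; case: ifP; last by rewrite oppr0.
  case/and4P=> jI iI ij _; rewrite -scaleNr !scalerA; congr (_ *: _).
  have [lt | gt] : (i < j)%N \/ (j < i)%N by apply/orP; rewrite -neq_ltn.
    by have [<- ->] := ksign_swap iI jI lt; rewrite exprS; ring.
  by have [<- ->] := ksign_swap jI iI gt; rewrite exprS; ring.
have Fii J I i : F J I i i = 0 by rewrite /F eqxx !andbF.
have F0 J I : \sum_i \sum_j F J I i j = 0.
  rewrite (eq_bigr (fun i : 'I_k => \sum_(j < k | (i < j)%N) F J I i j +
                                    \sum_(j < k | (j < i)%N) F J I i j)).
    rewrite big_split /= (exchange_big_dep xpredT) //= -big_split /=.
    apply: big1 => i _; rewrite -big_split /=; apply: big1 => j _.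
    by rewrite FN addNr.
  move=> i _; rewrite (bigID (fun j : 'I_k => (i < j)%N)) /=; congr (_ + _).
  rewrite (bigID (fun j : 'I_k => (j < i)%N)) /= [X in _ + X]big1 ?addr0.
    by apply: eq_bigl => j; rewrite -leqNgt; case: ltngtP.
  move=> j /andP[]; rewrite -!leqNgt => le1 le2.
  by rewrite (_ : j = i) ?Fii //; apply/val_inj/anti_leq; rewrite le1.
apply/ffunP => J; rewrite !ffunE.
transitivity (\sum_I \sum_i \sum_j F J I i j); last first.
  by apply: big1 => I _; apply: F0.
pose G (I I' : {set 'I_k}) (i i' : 'I_k) : M :=
  if [&& i \in I, I :\ i == J, i' \in I' & I' :\ i' == I] then
    ((-1) ^+ ksign i I * (-1) ^+ ksign i' I') *:
      (f i *: (f i' *: (phi I' : M)))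
  else 0.
transitivity (\sum_I \sum_i \sum_I' \sum_i' G I I' i i').
  apply: eq_bigr => I _; rewrite big_mkcond; apply: eq_bigr => i _.
  rewrite ffunE; case: ifP => [/andP[iI IJ] | niI].
    rewrite 2!scaler_sumr; apply: eq_bigr => I' _.
    rewrite 2!scaler_sumr big_mkcond; apply: eq_bigr => i' _.
    rewrite /G iI IJ /=; case: ifP => // _.
    rewrite !scalerA -!mulrA [f i * (_ * _)]mulrCA.
    by [].
  symmetry; apply: big1 => I' _; apply: big1 => i' _.
  by rewrite /G andbA niI.
under eq_bigr => I _ do rewrite exchange_big /=.
rewrite exchange_big /=; apply: eq_bigr => I' _.
under eq_bigr => I _ do rewrite exchange_big /=.
rewrite exchange_big /=; apply: eq_bigr => i' _.
rewrite exchange_big /=; apply: eq_bigr => i _.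
rewrite (bigD1 (I' :\ i')) //= [X in _ + X]big1 ?addr0; last first.
  by move=> I nI; rewrite /G [_ == I]eq_sym (negPf nI) !andbF.
rewrite /G /F eqxx andbT !inE.
have -> : [&& (i != i') && (i \in I'), I' :\ i' :\ i == J & i' \in I'] =
          [&& i' \in I', i \in I', i' != i & I' :\ i' :\ i == J].
  by rewrite [i == i']eq_sym; do 4!case: (_ \in _) || case: (_ == _).
by case: ifP => // _; congr (_ *: _); rewrite mulrC.
Qed.

Lemma kdiff_comp nu p phi : phi \in kcomp nu p.+1 -> kdiff phi \in kcomp nu p.
Proof.
case: grM => _ _ grZ /forallP phiP; apply/forallP => J; rewrite ffunE.
have termP (I : {set 'I_k}) (i : 'I_k) : i \in I -> I :\ i = J ->
    if (#|J| == p) && (kdeg J <= nu)%MM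
    then f i *: (phi I : M) \in gcomp M (nu - kdeg J)%MM
    else f i *: (phi I : M) == 0.
  move=> iI IJ; have cI : (#|I| == p.+1) = (#|J| == p).
    by rewrite (cardsD1 i) iI IJ add1n eqSS.
  have dI : kdeg I = (d i + kdeg J)%MM by rewrite /kdeg (big_setD1 i) //= IJ.
  move: (phiP I); rewrite cI; case: (#|J| == p) => /=; last first.
    by move=> /eqP ->; rewrite scaler0.
  case: (boolP (kdeg I <= nu)%MM) => [le | nle].
    have leJ : (kdeg J <= nu)%MM.
      by apply: lepm_trans le; rewrite dI; exact: lem_addl.
    rewrite leJ => /(grZ _ _ _ _ (@hf i)).
    rewrite (_ : (d i + (nu - kdeg I))%MM = (nu - kdeg J)%MM) //.
    apply/mnmP => l; have /mnm_lepP /(_ l) := le.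
    by rewrite dI !(mnmDE, mnmBE) => le_l; rewrite addnBA // subnDl.
  move=> /eqP ->; rewrite scaler0; case: ifP => // _; exact: rpred0.
case: ifP => [hJ | hJ]; last first.
  apply/eqP; apply: big1 => I _; apply: big1 => i /andP[iI /eqP IJ].
  by move: (termP I i iI IJ); rewrite hJ => /eqP ->; rewrite scaler0.
rewrite rpred_sum // => I _; rewrite rpred_sum // => i /andP[iI /eqP IJ].
move: (termP I i iI IJ); rewrite hJ => fI.
rewrite -signr_odd scaler_sign; case: ifP => // _.
by move: (rpredZ (-1) fI); rewrite scaleN1r.
Qed.

Definition koszul_diff nu p (phi : subm (kcomp nu p.+1)) : subm (kcomp nu p) :=
  exist _ (kdiff (val phi)) (kdiff_comp (valP phi)).

Fact koszul_diff_linear nu p : linear (@koszul_diff nu p).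
Proof. by move=> a x y; apply: val_inj; rewrite /= kdiff_linear. Qed.

HB.instance Definition _ nu p := GRing.isLinear.Build A
  (subm (kcomp nu p.+1)) (subm (kcomp nu p)) *:%R (@koszul_diff nu p)
  (@koszul_diff_linear nu p).

Fact koszul_diffK nu p (x : subm (kcomp nu p.+2)) :
  koszul_diff (koszul_diff x) = 0.
Proof. by apply: val_inj; rewrite /= kdiffK. Qed.

Fact koszul_gt nu p : (k < p)%N -> forall x : subm (kcomp nu p), x = 0.
Proof.
move=> kp x; apply: val_inj; apply/ffunP => I /=; rewrite ffunE.
have /forallP /(_ I) := valP x; rewrite ifN; first by move/eqP.
rewrite negb_and neq_ltn (leq_ltn_trans _ kp) //.
by rewrite -[X in (_ <= X)%N]card_ord max_card.
Qed.

Definition koszul (nu : Nq) : complex A :=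
  @Complex A (fun p => subm (kcomp nu p)) (fun p => @koszul_diff nu p)
    k (@koszul_diffK nu) (@koszul_gt nu).

End Koszul.

End Multigraded.

(* Main.v *)
Require Import Defs.
From HB Require Import structures.
From mathcomp Require Import all_boot all_algebra.
From mathcomp Require Import mpoly.
From mathcomp Require Import boolp.
From mathcomp Require Import ring zify.

(** The Koszul complex of a filter-regular sequence is exact in positive homological
    degrees for large multidegrees: one adds the forms one at a time, and splits the
    cycles according to whether or not they involve the last form.  Each form lowers
    the degree of the rank polynomial of the successive quotients by at least one, so
    [(M/(f)M)_nu] is torsion for large [nu], and the Koszul strand is a finite free
    resolution of it.

    The determinant formula is then proved one irreducible element [a] at a time.
    Given adapted bases [b_i = b_i' + b_i''], let [ell_i] be the length over [A_(a)]
    of the cokernel of the composite of [d_{i+1}] with the projection to the span of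
    [b_i'].  Exactness gives [ell_i + ell_{i+1} = v_a (det phi_{i+1})], while
    [ell_0] is the local length of [H_0] and the last [ell_i] vanishes; hence the
    alternating sum of the valuations of the [det phi_i] is the exponent of [a] in the
    content, whatever the bases.

    Localizing at a multiplicative set [S] is avoided by counting, in chains of
    submodules, only the steps which no element of [S] kills.  The same notion gives
    the rank when [S] is the set of nonzero elements. *)

Set Implicit Arguments.
Unset Strict Implicit.
Unset Printing Implicit Defensive.

Import GRing.Theory.
Local Open Scope ring_scope.

(** * Length after localization *)

(** Determinant and content enter as relations, so both must be shown to exist and to agree for
    every choice. Adapted bases are built from degree 0 upwards, by selecting a nonzero maximal
    minor over the fraction field; lengths are computed from the top degree downwards, starting
    where the rank is zero. Finiteness of the local lengths comes out of this descent: [ell_i]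
    measures a quotient of the cokernel of a square matrix, whose local length is the valuation of
    the determinant. The local length of [H_0] at an irreducible is then at most the valuation of
    the product [E] of the blocks with exponent 1, so only the finitely many irreducible factors of
    [E] enter the content. As for torsion, [k] forms meet a rank polynomial of degree [k - 1], and
    the zero polynomial counts as degree -1: the forms are just numerous enough to exhaust it. *)

Section LinearSubsets.
Variables (A : comNzRingType) (V : lmodType A).

(** A [Prop]-valued substitute for [submodClosed], so that sums, images, preimages and intersections
    are formed without packaging a structure each time. *)
Definition lsub (U : V -> Prop) : Prop :=
  U 0 /\ forall a u v, U u -> U v -> U (a *: u + v).

Definition incl (U W : V -> Prop) : Prop := forall v, U v -> W v.

Lemma incl_trans U U' U'' : incl U U' -> incl U' U'' -> incl U U''.
Proof. by move=> h h' v /h /h'. Qed.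

Lemma lsubZ U a v : lsub U -> U v -> U (a *: v).
Proof. by case=> U0 UD Uv; rewrite -[_ *: _]addr0; apply: UD. Qed.
Lemma lsubD U v w : lsub U -> U v -> U w -> U (v + w).
Proof. by case=> U0 UD Uv Uw; rewrite -[v]scale1r; apply: UD. Qed.
Lemma lsubN U v : lsub U -> U v -> U (- v).
Proof. by move=> lU Uv; rewrite -scaleN1r; apply: lsubZ. Qed.
Lemma lsubB U v w : lsub U -> U v -> U w -> U (v - w).
Proof. by move=> lU Uv Uw; apply: lsubD => //; apply: lsubN. Qed.
Lemma lsub_sum U I (r : seq I) (P : pred I) (F : I -> V) : lsub U ->
  (forall i, P i -> U (F i)) -> U (\sum_(i <- r | P i) F i).
Proof.
by move=> lU UF; elim/big_ind: _ => //; [case: lU | move=> *; apply: lsubD].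
Qed.

Definition lsum (U W : V -> Prop) (v : V) : Prop :=
  exists u w, [/\ U u, W w & v = u + w].

Lemma lsub_lsum U W : lsub U -> lsub W -> lsub (lsum U W).
Proof.
move=> lU lW; split; first by exists 0, 0; rewrite addr0; split; [case: lU | case: lW |].
move=> a _ _ [u [w [Uu Ww ->]]] [u' [w' [Uu' Ww' ->]]].
exists (a *: u + u'), (a *: w + w'); split; [by apply: lU.2 | by apply: lW.2 |].
by rewrite scalerDr addrACA.
Qed.

Lemma lsub_and U W : lsub U -> lsub W -> lsub (fun v => U v /\ W v).
Proof.
move=> [U0 UD] [W0 WD]; split=> // a u v [Uu Wu] [Uv Wv].
by split; [apply: UD | apply: WD].
Qed.

Lemma lsub0 : lsub (fun v => v = 0).
Proof. by split=> // a u v -> ->; rewrite scaler0 addr0. Qed.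
Lemma lsubT : lsub (fun _ => True). Proof. by []. Qed.

Lemma lsub_mem (U : submodClosed V) : lsub (fun v => v \in U).
Proof. by split=> [|a u v Uu Uv]; rewrite ?rpred0 // rpredD // rpredZ. Qed.

End LinearSubsets.

Section ImagePreimage.
Variables (A : comNzRingType) (V W : lmodType A) (g : V -> W).
Hypothesis gP : linear g.

(** For bare functions with a proof of [linear], the form in which projections, quotient maps and
    [kdiff] occur. *)
Lemma lin_subD u v : g (u + v) = g u + g v.
Proof. by rewrite -{1}[u]scale1r gP scale1r. Qed.
Lemma lin_sub0 : g 0 = 0.
Proof. by apply: (addrI (g 0)); rewrite -lin_subD !addr0. Qed.
Lemma lin_subZ a u : g (a *: u) = a *: g u.
Proof. by rewrite -[a *: u]addr0 gP lin_sub0 addr0. Qed.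
Lemma lin_subB u v : g (u - v) = g u - g v.
Proof. by rewrite addrC -scaleN1r gP scaleN1r addrC. Qed.
Lemma lin_sub_sum I (r : seq I) (P : pred I) (F : I -> V) :
  g (\sum_(i <- r | P i) F i) = \sum_(i <- r | P i) g (F i).
Proof. exact: (big_morph g lin_subD lin_sub0). Qed.

Definition img (U : V -> Prop) (w : W) : Prop := exists2 v, U v & w = g v.

Lemma lsub_img U : lsub U -> lsub (img U).
Proof.
move=> [U0 UD]; split; first by exists 0; rewrite ?lin_sub0.
move=> a _ _ [u Uu ->] [v Uv ->].
by exists (a *: u + v); [apply: UD | rewrite gP].
Qed.

Lemma lsub_preim U : lsub U -> lsub (fun v => U (g v)).
Proof.
move=> [U0 UD]; split; first by rewrite lin_sub0.
by move=> a u v Uu Uv; rewrite gP; apply: UD.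
Qed.

End ImagePreimage.

Section LocalizedLength.
Variables (A : idomainType) (S : mulrClosed A).

Section Intervals.
Variable V : lmodType A.
Implicit Types X Y Z : V -> Prop.

(** For submodules [U] inside [W], this says that [S^-1 U] and [S^-1 W] differ. *)
Definition lstrict (U W : V -> Prop) : Prop :=
  exists2 v, W v & forall s, s \in S -> ~ U (s *: v).

(** Steps may be trivial and the chain never ends: such chains stay chains under intersection, sum,
    image and preimage, and [nstrict] alone does the counting. *)
Definition lchain X Y (U : nat -> V -> Prop) : Prop :=
  forall i, [/\ lsub (U i), incl X (U i), incl (U i) Y & incl (U i) (U i.+1)].

Definition nstrict (U : nat -> V -> Prop) (t : nat) : nat :=
  \sum_(i < t) `[< lstrict (U i) (U i.+1) >].

(* The length of [S^-1 (Y / X)], read off chains of submodules between [X] and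
   [Y]: only the steps that survive the localization are counted. *)
Definition loclen X Y (a : nat) : Prop :=
  (exists t U, lchain X Y U /\ (a <= nstrict U t)%N) /\
  (forall t U, lchain X Y U -> (nstrict U t <= a)%N).

Lemma lchain_incl X Y U i j : lchain X Y U -> (i <= j)%N -> incl (U i) (U j).
Proof.
move=> cU; elim: j => [|j IH]; first by rewrite leqn0 => /eqP ->.
rewrite leq_eqVlt => /predU1P[-> // | lt] v Uv.
by have [_ _ _] := cU j; apply; apply: IH.
Qed.

Lemma loclen_uniq X Y a b : loclen X Y a -> loclen X Y b -> a = b.
Proof.
move=> [[t [U [cU le]]] ub] [[t' [U' [cU' le']]] ub']; apply/anti_leq.
by rewrite (leq_trans le (ub' _ _ cU)) (leq_trans le' (ub _ _ cU')).
Qed.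

Lemma loclen_ext X Y X' Y' a : (forall v, X v <-> X' v) ->
  (forall v, Y v <-> Y' v) -> loclen X Y a -> loclen X' Y' a.
Proof.
move=> eX eY [[t [U [cU le]]] ub]; split.
  exists t, U; split=> // i; have [h1 h2 h3 h4] := cU i.
  by split=> // v; [move/eX/h2 | move/h3/eY].
move=> t' U' cU'; apply: ub => i; have [h1 h2 h3 h4] := cU' i.
by split=> // v; [move/eX/h2 | move/h3/eY].
Qed.

Lemma loclen0 X Y : lsub X -> incl X Y ->
  (forall v, Y v -> exists2 s, s \in S & X (s *: v)) -> loclen X Y 0.
Proof.
move=> lX XY sY; split.
  by exists 0%N, (fun _ => X); split=> // i; split.
move=> t U cU; rewrite leqn0 /nstrict big1 // => i _.
case: asboolP => // -[v Uv ns].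
have [_ _ UY _] := cU i.+1; have [s Ss Xs] := sY v (UY v Uv).
by case: (ns s Ss); have [_ XU _ _] := cU i; apply: XU.
Qed.

Lemma loclen0P X Y : lsub X -> lsub Y -> incl X Y -> loclen X Y 0 ->
  forall v, Y v -> exists2 s, s \in S & X (s *: v).
Proof.
move=> lX lY XY [_ ub] v Yv; apply: contrapT => /forall2NP /= ns.
(* Otherwise the chain jumping from [X] to [Y] would have a strict step. *)
have /ub : lchain X Y (fun i => if i is 0 then X else Y) by case=> [|i]; split.
move=> /(_ 1%N); rewrite /nstrict big_ord1 /=; case: asboolP => // -[].
by exists v => // s Ss Xs; have [] := ns s.
Qed.

(* By the modular law a strict step stays strict after intersection with [Y] or
   after addition of [Y]. *)
Lemma loclenD X Y Z a b : lsub Y -> lsub Z -> incl X Y ->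
  incl Y Z -> loclen X Y a -> loclen Y Z b -> loclen X Z (a + b).
Proof.
move=> lY lZ XY YZ [[t [U [cU leU]]] ubU] [[t' [W [cW leW]]] ubW]; split.
  (* The extra index joins [U t] to [W 0]; it can only add to the count, and a lower bound
     suffices. *)
  exists (t.+1 + t')%N, (fun i => if (i <= t)%N then U i else W (i - t.+1)%N).
  split=> [i|].
    case: (leqP i t) => it; case: (leqP i.+1 t) => it'.
    - have [h1 h2 h3 h4] := cU i; split=> // v /h3; exact: YZ.
    - have [h1 h2 h3 h4] := cU i; split=> // v /h3; first exact: YZ.
      by have [_ + _ _] := cW (i.+1 - t.+1)%N; apply.
    - by lia.
    have [h1 h2 h3 h4] := cW (i - t.+1)%N; rewrite subSn //.
    by split=> // v /XY; exact: h2.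
  rewrite /nstrict big_split_ord /= leq_add //.
    apply: (leq_trans leU); rewrite big_ord_recr /=.
    apply: leq_trans (leq_addr _ _); apply: leq_sum => i _.
    by rewrite ltn_ord (ltnW (ltn_ord i)).
  apply: (leq_trans leW); apply: leq_sum => i _.
  have e1 : (t.+1 + i <= t)%N = false by lia.
  have e2 : (t.+1 + i < t)%N = false by lia.
  by rewrite e1 e2 -addnS !addKn.
move=> s T cT.
have cI : lchain X Y (fun i v => T i v /\ Y v).
  move=> i; have [h1 h2 h3 h4] := cT i; split.
  - exact: lsub_and.
  - by move=> v Xv; split; [exact: h2 | exact: XY].
  - by move=> v [].
  by move=> v [/h4].
have cS : lchain Y Z (fun i => lsum (T i) Y).
  move=> i; have [h1 h2 h3 h4] := cT i; split.
  - exact: lsub_lsum.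
  - by move=> v Yv; exists 0, v; rewrite add0r; split=> //; case: h1.
  - move=> _ [u [w [/h3 Zu /YZ Zw ->]]]; exact: lsubD.
  by move=> _ [u [w [/h4 Tu Yw ->]]]; exists u, w.
apply: leq_trans (leq_add (ubU s _ cI) (ubW s _ cS)).
rewrite /nstrict -big_split /=; apply: leq_sum => i _.
case: (asboolP (lstrict (T i) _)) => // -[v Tv nv].
have [lT _ _ _] := cT i; have [lT1 _ _ sT] := cT i.+1.
case: asboolP => // nI; case: asboolP => // nS; exfalso.
(* If neither chain jumps, then [s1 v = u + y] with [y] both in [T i.+1] and in [Y], and some [s2 y]
   falls into [T i]; hence so does [s2 s1 v]. *)
have [s1 Ss1 [u [y [Tu Yy e]]]] : exists2 s, s \in S & lsum (T i) Y (s *: v).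
  apply: contrapT => /forall2NP ns; apply: nS; exists v.
    by exists v, 0; rewrite addr0; split=> //; case: lY.
  by move=> r Sr Tr; case: (ns r).
have Ty : T i.+1 y.
  have -> : y = s1 *: v - u by rewrite e addrC addKr.
  have [_ _ _ sTi] := cT i.
  by apply: lsubB => //; [apply: lsubZ | apply: sTi].
have [s2 Ss2 [Ts2 _]] : exists2 s, s \in S & T i (s *: y) /\ Y (s *: y).
  apply: contrapT => /forall2NP ns; apply: nI; exists y => //.
  by move=> r Sr Tr; case: (ns r).
apply: (nv (s2 * s1)); first by rewrite rpredM.
by rewrite -scalerA e scalerDr; apply: lsubD => //; apply: lsubZ.
Qed.

Lemma loclen_exists X Y c : lsub X -> incl X Y ->
  (forall t U, lchain X Y U -> (nstrict U t <= c)%N) -> exists a, loclen X Y a.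
Proof.
move=> lX XY ub.
pose P a := `[< exists t U, lchain X Y U /\ (a <= nstrict U t)%N >].
have P0 : exists a, P a.
  exists 0%N; apply/asboolP; exists 0%N, (fun _ => X).
  by split=> // i; split.
have Pub a : P a -> (a <= c)%N.
  by move=> /asboolP[t [U [cU /leq_trans]]]; apply; apply: ub.
have [a /asboolP Pa aM] := ex_maxnP P0 Pub.
exists a; split=> // t U cU; apply: aM; apply/asboolP; by exists t, U.
Qed.

(** A chain between [Y] and [Z] is also one between [X] and [Z], so its count is bounded; additivity
    then gives the value. *)
Lemma loclenB X Y Z a c : lsub Y -> lsub Z -> incl X Y -> incl Y Z ->
  loclen X Y a -> loclen X Z c -> exists2 b, loclen Y Z b & c = (a + b)%N.
Proof.
move=> lY lZ XY YZ la lc.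
have [|b lb] := @loclen_exists Y Z c lY YZ.
  move=> t U cU; apply: lc.2 => i; have [h1 h2 h3 h4] := cU i.
  by split=> // v /XY /h2.
by exists b => //; apply: loclen_uniq lc _; apply: loclenD la lb.
Qed.

(** [Y / X] is generated by [w], and every scalar either becomes invertible or kills [w] modulo [X]:
    the localized quotient is simple. *)
Lemma loclen_adjoin X Y (w : V) : lsub X -> Y w ->
  (forall v, Y v <-> exists a x, X x /\ v = x + a *: w) ->
  (forall a, a \in S \/ X (a *: w)) ->
  (forall s, s \in S -> ~ X (s *: w)) -> loclen X Y 1.
Proof.
move=> lX Yw YP SX nX.
have lY : lsub Y.
  split; first by apply/YP; exists 0, 0; rewrite scale0r addr0; case: lX.
  move=> c _ _ /YP[a [x [Xx ->]]] /YP[a' [x' [Xx' ->]]]; apply/YP.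
  exists (c * a + a'), (c *: x + x'); split; first by apply: lX.2.
  by rewrite scalerDr scalerA scalerDl addrACA.
have XY : incl X Y.
  by move=> x Xx; apply/YP; exists 0, x; rewrite scale0r addr0.
split.
  exists 1%N, (fun i => if i is 0 then X else Y); split; first by case=> [|i]; split.
  rewrite /nstrict big_ord1 /=; case: asboolP => // -[].
  by exists w.
move=> t U cU.
(* A strict step starts inside [X] and ends outside it, so a chain has at most one. *)
have stX i : lstrict (U i) (U i.+1) -> incl (U i) X /\ ~ incl (U i.+1) X.
  have [lU XU UY UU] := cU i; case=> v Uv nv; split; last first.
    by move=> h; apply: (nv 1); rewrite ?rpred1 // scale1r; apply/XU/h.
  move=> u Uu; have /YP[a [x [Xx ue]]] := UY u Uu.
  rewrite ue; apply: lsubD => //; case: (SX a) => // Sa; exfalso.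
  apply: (nv a Sa); have [_ _ UY1 _] := cU i.+1.
  have /YP[b [y [Xy ->]]] := UY1 v Uv.
  rewrite scalerDr; apply: lsubD => //; first by apply: lsubZ => //; apply: XU.
  rewrite scalerA mulrC -scalerA; apply: lsubZ => //.
  have -> : a *: w = u - x by rewrite ue addrC addKr.
  by apply: lsubB => //; apply: XU.
elim: t => [|t IH]; first by rewrite /nstrict big_ord0.
rewrite /nstrict big_ord_recr /=; case: asboolP => [st | _]; last by rewrite addn0.
rewrite big1 // => i _; case: asboolP => // sti.
case: (stX _ sti) => _ []; apply: incl_trans (stX _ st).1.
exact: (lchain_incl cU (ltn_ord i)).
Qed.

End Intervals.

(** The hypotheses say that [g] induces an isomorphism from [Y / X] to [Y' / X']. Chains are pushed
    forward by [X' + g(U)] and pulled back by intersecting [Y] with the preimage of [U]; neither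
    operation loses a strict step. *)
Lemma loclen_transport (V W : lmodType A) (g : V -> W) (X Y : V -> Prop)
    (X' Y' : W -> Prop) a : linear g -> lsub Y -> lsub X' ->
  (forall v, X v <-> Y v /\ X' (g v)) ->
  (forall w, Y' w <-> exists x v, [/\ X' x, Y v & w = x + g v]) ->
  loclen X Y a <-> loclen X' Y' a.
Proof.
move=> gP lY lX' XP YP.
have g0 := lin_sub0 gP; have gZ := lin_subZ gP.
have push U : lchain X Y U ->
    lchain X' Y' (fun i => lsum X' (img g (U i))) /\
    forall t, (nstrict U t <= nstrict (fun i => lsum X' (img g (U i))) t)%N.
  move=> cU; split=> [i | t].
    have [lU XU UY UU] := cU i; split.
    - by apply: lsub_lsum => //; apply: lsub_img.
    - by move=> x Xx; exists x, 0; rewrite addr0; split=> //; exists 0;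
        rewrite ?g0 //; case: lU.
    - by move=> _ [x [_ [Xx [v Uv ->] ->]]]; apply/YP; exists x, v; split=> //; apply: UY.
    by move=> _ [x [_ [Xx [v Uv ->] ->]]]; exists x, (g v); split=> //; exists v => //;
      apply: UU.
  apply: leq_sum => i _; case: asboolP => // -[v Uv nv].
  have [lU XU UY UU] := cU i; have [_ _ UY1 _] := cU i.+1.
  case: asboolP => // -[]; exists (g v).
    by exists 0, (g v); rewrite add0r; split=> //; [case: lX' | exists v].
  move=> s Ss [x [_ [Xx [u Uu ->] e]]]; apply: (nv s Ss).
  rewrite -[s *: v](subrK u); apply: lsubD => //; apply: XU; apply/XP; split.
    by apply: lsubB => //; [apply: lsubZ => //; apply: UY1 | apply: UY].
  by rewrite (lin_subB gP) gZ e addrK.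
have pull U : lchain X' Y' U ->
    lchain X Y (fun i v => Y v /\ U i (g v)) /\
    forall t, (nstrict U t <= nstrict (fun i v => Y v /\ U i (g v)) t)%N.
  move=> cU; split=> [i | t].
    have [lU XU UY UU] := cU i; split.
    - by apply: lsub_and => //; apply: lsub_preim.
    - by move=> v /XP[Yv Xv]; split=> //; apply: XU.
    - by move=> v [].
    by move=> v [Yv /UU].
  apply: leq_sum => i _; case: asboolP => // -[w Uw nw].
  have [lU XU UY UU] := cU i; have [lU1 XU1 UY1 _] := cU i.+1.
  have /YP[x [v [Xx Yv we]]] := UY1 w Uw.
  case: asboolP => // -[]; exists v.
    split=> //; have -> : g v = w - x by rewrite we addrC addKr.
    by apply: lsubB => //; apply: XU1.
  move=> s Ss [_ Ug]; apply: (nw s Ss); rewrite we scalerDr -gZ.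
  by apply: lsubD => //; apply: lsubZ => //; apply: XU.
split=> -[[t [U [cU le]]] ub]; split.
- have [cU' le'] := push U cU; exists t, (fun i => lsum X' (img g (U i))).
  by split=> //; apply: leq_trans le (le' t).
- by move=> s T cT; have [cT' le'] := pull T cT; apply: leq_trans (le' s) (ub _ _ cT').
- have [cU' le'] := pull U cU; exists t, (fun i v => Y v /\ U i (g v)).
  by split=> //; apply: leq_trans le (le' t).
by move=> s T cT; have [cT' le'] := push T cT; apply: leq_trans (le' s) (ub _ _ cT').
Qed.

(** [has_length] wants every step strict, so [h] skips the idle steps of the chain. *)
Lemma lchain_compress (V : lmodType A) (X Y : V -> Prop) U t : lchain X Y U ->
  exists h : nat -> nat, (h (nstrict U t) <= t)%N /\
    forall i, (i < nstrict U t)%N ->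
      (h i <= h i.+1)%N /\ lstrict (U (h i)) (U (h i.+1)).
Proof.
move=> cU; elim: t => [|t [h [ht hP]]].
  by exists (fun _ => 0%N); split=> // i; rewrite /nstrict big_ord0.
rewrite /nstrict big_ord_recr /= -/(nstrict U t); case: asboolP => [st | _]; last first.
  by exists h; rewrite addn0; split=> //; apply: leqW.
exists (fun i => if (i <= nstrict U t)%N then h i else t.+1); rewrite addn1 ltnn.
split=> // i; rewrite ltnS /= => it; case: (eqVneq i (nstrict U t)) => [-> | ne].
  rewrite leqnn ltnn; split; first exact: leqW.
  by case: st => v Uv nv; exists v => // s /nv ns /(lchain_incl cU ht).
have lt : (i < nstrict U t)%N by rewrite ltn_neqAle ne.
by rewrite it lt; apply: hP.
Qed.

(** * Chains in a module and submodules of its localization *)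

Section LocalizedSubmodules.
Variable V : lmodType A.
Local Notation VS := (locmod S V : lmodType (locring S)).

Fact tofrac_locring (a : A) (s : {s : A | s \in S}) :
  tofrac a / tofrac (sval s) \in locring_pred S.
Proof. by apply/locring_predP; exists (a, s). Qed.

Definition locquo (a : A) (s : {s : A | s \in S}) : locring S :=
  exist (fun x => x \in locring_pred S) _ (tofrac_locring a s).

Lemma locquoZ a s (v : V) t :
  locquo a s *: (locfrac v t : VS) = locfrac (a *: v) (denomM s t).
Proof. exact: loc_scaleE. Qed.

Section Extension.
Variables (U : V -> Prop) (lU : lsub U).

Definition locsub_pred : {pred VS} :=
  [pred x | `[< exists v s, U v /\ x = locfrac v s >]].

Fact locsub_closed : subsemimod_closed locsub_pred.
Proof.
split; [split|].
- by apply/asboolP; exists 0, (denom1 S); split=> //; case: lU.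
- move=> _ _ /asboolP[v [s [Uv ->]]] /asboolP[w [t [Uw ->]]]; apply/asboolP.
  exists (sval t *: v + sval s *: w), (denomM s t).
  by split; [apply: lsubD => //; apply: lsubZ | exact: fracD].
move=> [a aP] _ /asboolP[v [s [Uv ->]]]; apply/asboolP.
have /locring_predP[[b t] e] := aP.
exists (b *: v), (denomM t s); split; first exact: lsubZ.
by rewrite -(locquoZ b t); congr (_ *: _); apply: val_inj; rewrite /= e.
Qed.
HB.instance Definition _ := GRing.isSubSemiModClosed.Build (locring S) VS
  locsub_pred locsub_closed.
Definition locsub : submodClosed VS := locsub_pred.

Lemma locsubP (x : VS) : x \in locsub <-> exists v s, U v /\ x = locfrac v s.
Proof. by split=> [/asboolP | h]; last exact/asboolP. Qed.

End Extension.

(** Submodules are extended to [S^-1 V] in one direction and contracted to [V] in the other. *)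
Lemma has_length_locmod t :
  loclen (fun v : V => v = 0) (fun _ => True) t -> has_length VS t.
Proof.
move=> [[m [U [cU tm]]] ub]; split.
  have [h [_ hP]] := lchain_compress m cU.
  have lU i : lsub (U i) by have [] := cU i.
  exists (fun i => locsub (lU (h i))) => i it.
  have [le [v Uv nv]] := hP i (leq_trans it tm); split.
    move=> x /locsubP[w [s [Uw ->]]]; apply/locsubP; exists w, s; split=> //.
    exact: lchain_incl cU le _ Uw.
  move=> /(_ (locfrac v (denom1 S))) h1.
  have /h1/locsubP[w [s [Uw /fracP[u /=]]]] :
      locfrac v (denom1 S) \in locsub (lU (h i.+1)).
    by apply/locsubP; exists v, (denom1 S).
  rewrite scalerA => e; apply: (nv (sval u * sval s)).
    by rewrite rpredM ?(svalP u) ?(svalP s).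
  by rewrite e scalerA; apply: lsubZ.
move=> t' W sW.
(* [strict_chain] constrains only the first [t'] steps, so the contracted chain is frozen from [t']
   on. *)
pose U' i := fun v : V => (locfrac v (denom1 S) : VS) \in W (minn i t').
have WS i j : (i <= j)%N -> (j <= t')%N -> {subset W i <= W j}.
  move=> + jt; elim: j jt => [|j IH] jt; first by rewrite leqn0 => /eqP ->.
  rewrite leq_eqVlt => /predU1P[-> // | lt] x Wx.
  by have [+ _] := sW j jt; apply; apply: IH => //; apply: ltnW.
have cU' : lchain (fun v => v = 0) (fun _ => True) U'.
  move=> i; split=> //.
  - split; first by rewrite /U' frac0 rpred0.
    move=> a u v Uu Uv; rewrite /U'.
    have -> : (locfrac (a *: u + v) (denom1 S) : VS) =
        locquo a (denom1 S) *: (locfrac u (denom1 S) : VS) + locfrac v (denom1 S).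
      rewrite locquoZ [RHS]fracD /= ?mul1r; congr locfrac; first by rewrite !scale1r.
      by apply: val_inj; rewrite /= !mul1r.
    by rewrite rpredD // rpredZ.
  - by move=> _ ->; rewrite /U' frac0 rpred0.
  by move=> v; apply: WS; rewrite ?geq_minr // leq_min geq_minr geq_min leqnSn.
apply: leq_trans (ub t' U' cU'); rewrite -[X in (X <= _)%N]card_ord -sum1_card.
apply: leq_sum => i _; case: asboolP => // -[].
have [_ /existsNP[x]] := sW i (ltn_ord i).
have [v [s ->]] := fracW x => /not_implyP[W1 nW]; exists v.
  rewrite /U' (minn_idPl (ltn_ord i)).
  have -> : (locfrac v (denom1 S) : VS) = locquo (sval s) (denom1 S) *: (locfrac v s : VS).
    rewrite locquoZ; apply/fracP; exists (denom1 S) => /=.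
    by rewrite !mul1r !scale1r.
  by rewrite rpredZ.
move=> r Sr; rewrite /U' (minn_idPl (ltnW (ltn_ord i))) => Wr; apply: nW.
suff -> : (locfrac v s : VS) =
    locquo 1 (denomM (exist _ r Sr) s) *: (locfrac (r *: v) (denom1 S) : VS).
  by rewrite rpredZ.
rewrite locquoZ; apply/fracP; exists (denom1 S) => /=.
by rewrite !scalerA; congr (_ *: _); ring.
Qed.

End LocalizedSubmodules.
End LocalizedLength.

(** * Valuations and determinants *)

Section Valuation.
Variable A : idomainType.
Implicit Types a x y : A.

Lemma dividesM a x y : divides a x -> divides a (x * y).
Proof. by case=> c ->; exists (c * y); rewrite mulrA. Qed.

Lemma divides0 a : divides a 0.
Proof. by exists 0; rewrite mulr0. Qed.

Lemma dividesD a x y : divides a x -> divides a y -> divides a (x + y).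
Proof. by case=> c -> [c' ->]; exists (c + c'); rewrite mulrDr. Qed.

Lemma prime_elt_ndiv_unit a u : prime_elt a -> u \is a GRing.unit -> ~ divides a u.
Proof.
move=> [/negP aU _] uu [c e]; apply: aU; apply/unitrPr; exists (c / u).
by rewrite mulrA -e divrr.
Qed.

Definition has_val a x v := exists2 s, ~ divides a s & x = a ^+ v * s.

(** For nonzero [a], the default 0 covers [x = 0], which has no exact exponent. *)
Definition val_at a x : nat :=
  if pselect (exists v, has_val a x v) is left h then sval (cid h) else 0%N.

Lemma has_val_uniq a x v w : a != 0 -> has_val a x v -> has_val a x w -> v = w.
Proof.
move=> a0; wlog le : v w / (v <= w)%N => [hw h h' | [s ns ->] [t nt]].
  by case/orP: (leq_total v w) => le; [apply: hw | apply/esym/hw].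
rewrite -(subnKC le) exprD -mulrA => /(mulfI (expf_neq0 _ a0)).
case: (w - v)%N => [|k]; first by rewrite addn0.
by rewrite exprS -mulrA => e; case: ns; exists (a ^+ k * t).
Qed.

Lemma val_atE a x v : a != 0 -> has_val a x v -> val_at a x = v.
Proof.
move=> a0 h; rewrite /val_at; case: pselect => [h'|[]]; last by exists v.
exact: has_val_uniq (svalP (cid h')) h.
Qed.

Lemma has_valM a x y v w : prime_elt a ->
  has_val a x v -> has_val a y w -> has_val a (x * y) (v + w).
Proof.
move=> [_ ap] [s ns ->] [t nt ->]; exists (s * t); first by move=> /ap[].
by rewrite exprD mulrACA.
Qed.

Section UFD.
Hypothesis ufdA : ufd A.

Lemma irreducible_prime a : irreducible a -> prime_elt a.
Proof. exact: ufd_irreducible_prime. Qed.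

(** The exponent is counted along a factorization of [x]: an irreducible factor divisible by [a] is
    a unit times [a], the others are prime to [a]. *)
Lemma has_val_exists a x : irreducible a -> x != 0 -> exists v, has_val a x v.
Proof.
move=> ai; have ap := irreducible_prime ai; have [a0 aU aP] := ai.
have h_unit u : u \is a GRing.unit -> exists v, has_val a u v.
  move=> uu; exists 0%N, u; rewrite ?mul1r //; exact: prime_elt_ndiv_unit.
move=> x0; have [/h_unit // | xU] := boolP (x \is a GRing.unit).
have [s sI ->] := ufdA.1 x x0 xU.
elim: s sI => [|b s IH] sI; first by rewrite big_nil; apply/h_unit/unitr1.
have [|w hw] := IH; first by move=> c cs; apply: sI; rewrite inE cs orbT.
have bi : irreducible b by apply: sI; rewrite mem_head.
rewrite big_cons; have [v hv] : exists v, has_val a b v; last first.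
  by exists (v + w)%N; apply: has_valM.
have [[c e] | nd] := pselect (divides a b); last by exists 0%N, b; rewrite ?mul1r.
have [_ _ /(_ _ _ e)[au | cu]] := bi; first by rewrite au in aU.
by exists 1%N, c; rewrite ?expr1 //; apply: prime_elt_ndiv_unit.
Qed.

Lemma val_atP a x : irreducible a -> x != 0 -> has_val a x (val_at a x).
Proof.
by move=> ai x0; have [v hv] := has_val_exists ai x0; rewrite (val_atE _ hv) //; case: ai.
Qed.

Lemma val_atM a x y : irreducible a -> x != 0 -> y != 0 ->
  val_at a (x * y) = (val_at a x + val_at a y)%N.
Proof.
move=> ai x0 y0; apply: val_atE; first by case: ai.
by apply: has_valM; [exact: irreducible_prime | exact: val_atP | exact: val_atP].
Qed.

Lemma val_at_ndiv a x : irreducible a -> ~ divides a x -> val_at a x = 0%N.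
Proof.
by case=> a0 _ _ nd; apply: val_atE => //; exists x; rewrite ?mul1r.
Qed.

Lemma val_at_unit a u : irreducible a -> u \is a GRing.unit -> val_at a u = 0%N.
Proof.
move=> ai uu; apply: val_at_ndiv => //.
by apply: prime_elt_ndiv_unit uu; apply: irreducible_prime.
Qed.

Lemma val_at_gt0 a x : irreducible a -> x != 0 -> (0 < val_at a x)%N -> divides a x.
Proof.
move=> ai x0; have [s _] := val_atP ai x0; case: val_at => // v -> _.
by exists (a ^+ v * s); rewrite exprS mulrA.
Qed.

Lemma val_at_self a : irreducible a -> val_at a a = 1%N.
Proof.
move=> ai; have [a0 aU _] := ai; apply: val_atE => //.
by exists 1; rewrite ?mulr1 //; apply: (prime_elt_ndiv_unit (irreducible_prime ai)) (unitr1 _).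
Qed.

Lemma val_atX a x m : irreducible a -> x != 0 -> val_at a (x ^+ m) = (m * val_at a x)%N.
Proof.
move=> ai x0; elim: m => [|m IH]; first by rewrite val_at_unit ?unitr1.
by rewrite exprS val_atM ?expf_neq0 // IH mulSn.
Qed.

Lemma val_at_prod a I (r : seq I) (F : I -> A) : irreducible a ->
  (forall i, F i != 0) -> val_at a (\prod_(i <- r) F i) = (\sum_(i <- r) val_at a (F i))%N.
Proof.
move=> ai F0; elim: r => [|i r IH]; first by rewrite !big_nil val_at_unit ?unitr1.
rewrite !big_cons val_atM // ?IH //.
by elim/big_rec: _ => [|j z _ z0]; rewrite ?oner_neq0 // mulf_neq0.
Qed.

Lemma associate_sym a b : associate a b -> associate b a.
Proof. by case=> u uu ->; exists u^-1; rewrite ?unitrV // mulKr. Qed.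

Lemma associate_trans a b c : associate a b -> associate b c -> associate a c.
Proof.
by case=> u uu -> [v vv ->]; exists (v * u); rewrite ?unitrM ?uu ?vv // mulrA.
Qed.

Lemma irreducible_divides a b : irreducible a -> irreducible b ->
  divides a b -> associate a b.
Proof.
move=> [_ aU _] [_ _ bP] [c e]; case: (bP _ _ e) => [au | cu].
  by rewrite au in aU.
by exists c; rewrite // mulrC.
Qed.

Lemma val_at_associate a b x : irreducible a -> irreducible b -> x != 0 ->
  associate a b -> val_at a x = val_at b x.
Proof.
move=> ai bi x0 [u uu be]; have [s ns e] := val_atP ai x0.
apply/esym/val_atE; first by case: bi.
set v := val_at a x in e *; have uV : u ^+ v \is a GRing.unit by rewrite unitrX.
exists (u ^- v * s).
  move=> [c e']; apply: ns; exists (u * u ^+ v * c).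
  by rewrite -[s](mulVKr uV) e' be; ring.
by rewrite be exprMn e [u ^+ v * _]mulrC -mulrA mulVKr.
Qed.

(** One irreducible factor of [x] at a time is cancelled from both sides. *)
Lemma val_at_divides x y : x != 0 -> y != 0 ->
  (forall a, irreducible a -> (val_at a x <= val_at a y)%N) -> divides x y.
Proof.
move=> x0; have [xu | xU] := boolP (x \is a GRing.unit).
  by move=> _ _; exists (x^-1 * y); rewrite mulVKr.
have [s sI ->] := ufdA.1 x x0 xU.
elim: s sI y => [|b s IH] sI y y0 hv; first by exists y; rewrite big_nil mul1r.
have bi : irreducible b by apply: sI; rewrite mem_head.
have sI' : {in s, forall c, irreducible c}.
  by move=> c cs; apply: sI; rewrite inE cs orbT.
have b0 : b != 0 by case: bi.
have s0 : \prod_(c <- s) c != 0.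
  by rewrite prodf_seq_neq0; apply/allP => c /sI'[].
have [z ze] : divides b y.
  apply: val_at_gt0 => //; apply: leq_trans (hv b bi).
  by rewrite big_cons val_atM // val_at_self.
have z0 : z != 0 by apply: contra_neq y0; rewrite ze => ->; rewrite mulr0.
have [|t te] := IH sI' z z0; last by exists t; rewrite ze te big_cons mulrA.
move=> a ai; have := hv a ai.
by rewrite ze big_cons !val_atM // leq_add2l.
Qed.

(** Turns the computations at all irreducibles back into an identity up to a unit. *)
Lemma val_at_eq x y : x != 0 -> y != 0 ->
  (forall a, irreducible a -> val_at a x = val_at a y) ->
  exists2 u, u \is a GRing.unit & x = u * y.
Proof.
move=> x0 y0 h.
have [c ce] : divides x y by apply: val_at_divides => // a /h ->.
have [c' ce'] : divides y x by apply: val_at_divides => // a /h ->.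
exists c'; last by rewrite mulrC.
apply/unitrPr; exists c; apply: (mulfI x0).
by rewrite mulr1 mulrCA -ce mulrC.
Qed.

(** Picks one representative per associate class, as [content] demands. *)
Lemma irreducible_transversal (s : seq A) : {in s, forall a, irreducible a} ->
  exists P : seq A, [/\ {in P, forall a, irreducible a},
    forall i j, (i < j < size P)%N -> ~ associate P`_i P`_j &
    {in s, forall a, exists2 b, b \in P & associate b a}].
Proof.
elim: s => [|a s IH] sI.
  by exists [::]; split=> // i j; rewrite ltn0 andbF.
have [|P [PI Pn Ps]] := IH; first by move=> c cs; apply: sI; rewrite inE cs orbT.
have [[b bP ba] | nb] := pselect (exists2 b, b \in P & associate b a).
  exists P; split=> // c; rewrite inE => /predU1P[-> |]; [by exists b | exact: Ps].
exists (a :: P); split.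
- by move=> c; rewrite inE => /predU1P[-> | /PI //]; apply: sI; rewrite mem_head.
- move=> [|i] [|j] //=; last by rewrite !ltnS; apply: Pn.
  rewrite ltnS => jP /associate_sym ja; apply: nb.
  by exists P`_j => //; apply: mem_nth.
move=> c; rewrite inE => /predU1P[-> | /Ps[b bP bc]].
  by exists a; rewrite ?mem_head //; exists 1; rewrite ?unitr1 ?mul1r.
by exists b => //; rewrite inE bP orbT.
Qed.

(** By primality [a] divides a member of a fixed factorization of [x]. This will bound the support
    of the content. *)
Lemma irreducible_factors x : x != 0 ->
  exists s : seq A, {in s, forall a, irreducible a} /\
    forall a, irreducible a -> divides a x -> exists2 b, b \in s & associate b a.
Proof.
move=> x0; have [xu | xU] := boolP (x \is a GRing.unit).
  exists [::]; split=> // a /irreducible_prime ap.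
  by move=> /(prime_elt_ndiv_unit ap xu).
have [s sI ->] := ufdA.1 x x0 xU; exists s; split=> // a ai.
elim: s sI => [|b s IH] sI; rewrite ?big_nil ?big_cons => ad.
  by case: (prime_elt_ndiv_unit (irreducible_prime ai) (unitr1 A) ad).
have [_ ap] := irreducible_prime ai; case: (ap _ _ ad) => [ab | as'].
  exists b; rewrite ?mem_head //; apply/associate_sym/irreducible_divides => //.
  by apply: sI; rewrite mem_head.
have [|c cs ca] := IH _ as'; first by move=> c cs; apply: sI; rewrite inE cs orbT.
by exists c; rewrite // inE cs orbT.
Qed.

End UFD.
End Valuation.

(** * Matrices modulo a prime element *)

Section ResidueRing.
Local Open Scope quotient_scope.
Variables (A : idomainType) (a : A) (pa : prime_elt a).

Definition multiples : {pred A} := fun x => `[< divides a x >].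

Fact multiples_idealr : idealr_closed multiples.
Proof.
split; first by apply/asboolP/divides0.
  apply/negP => /asboolP; exact: prime_elt_ndiv_unit (unitr1 A).
move=> b u v /asboolP au /asboolP av; apply/asboolP.
by apply: dividesD => //; rewrite mulrC; apply: dividesM.
Qed.
HB.instance Definition _ := isIdealr.Build A multiples multiples_idealr.

(** [A/(a)] is made an integral domain so that the kernel criterion [det0P] applies to matrices
    modulo [a]. *)
Definition residue : Type := {ideal_quot (multiples : idealr A)}.
HB.instance Definition _ := GRing.ComNzRing.on residue.

Definition residue_pi (x : A) : residue := \pi_({ideal_quot (multiples : idealr A)}) x.

Lemma residue_pi_is_zmod : zmod_morphism residue_pi.
Proof. exact: pi_is_zmod_morphism. Qed.
Lemma residue_pi_is_monoid : monoid_morphism residue_pi.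
Proof. by split=> [|x y]; rewrite /residue_pi !piE. Qed.
HB.instance Definition _ := GRing.isZmodMorphism.Build A residue residue_pi residue_pi_is_zmod.
HB.instance Definition _ := GRing.isMonoidMorphism.Build A residue residue_pi residue_pi_is_monoid.

Lemma residue_piK (x : residue) : residue_pi (repr x) = x.
Proof. exact: reprK. Qed.

Lemma residue_pi0 x : (residue_pi x = 0) <-> divides a x.
Proof.
split=> [h | h].
  suff /asboolP : x - 0 \in (multiples : idealr A) by rewrite subr0.
  by rewrite Quotient.idealrBE; apply/eqP; rewrite [LHS]h -[RHS]/(residue_pi 0) rmorph0.
rewrite -(rmorph0 residue_pi); apply/eqP.
by rewrite /residue_pi -Quotient.idealrBE subr0; apply/asboolP.
Qed.

Fact residue_integral (x y : residue) : x * y = 0 -> (x == 0) || (y == 0).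
Proof.
rewrite -[x]residue_piK -[y]residue_piK -rmorphM => /residue_pi0/pa.2[] h.
  by apply/orP; left; apply/eqP/residue_pi0.
by apply/orP; right; apply/eqP/residue_pi0.
Qed.

(** Invertibility is decided classically, since the integral domain structure asks for an inverse
    operation. *)
Definition residue_unit : {pred residue} := fun x => `[< exists y, y * x = 1 >].
Definition residue_inv (x : residue) : residue :=
  if pselect (exists y, y * x = 1) is left h then sval (cid h) else x.

Fact residue_mulVr : {in residue_unit, left_inverse 1 residue_inv *%R}.
Proof.
move=> x /asboolP xu; rewrite /residue_inv; case: pselect => // h.
exact: svalP (cid h).
Qed.
Fact residue_unitP (x y : residue) : y * x = 1 -> residue_unit x.
Proof. by move=> e; apply/asboolP; exists y. Qed.
Fact residue_inv_out : {in [predC residue_unit], residue_inv =1 id}.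
Proof. by move=> x /asboolP xu; rewrite /residue_inv; case: pselect. Qed.

HB.instance Definition _ := GRing.ComNzRing_hasMulInverse.Build residue
  residue_mulVr residue_unitP residue_inv_out.
HB.instance Definition _ := GRing.ComUnitRing_isIntegral.Build residue residue_integral.

(** Modulo [a] the matrix is singular; [c] lifts a nonzero kernel vector. *)
Lemma det_divides_ker n (phi : 'M[A]_n) : divides a (\det phi) ->
  exists (c w : 'rV[A]_n) (i : 'I_n), ~ divides a (c 0 i) /\ c *m phi = a *: w.
Proof.
move=> /residue_pi0; rewrite -det_map_mx => /eqP/det0P[v v0 vphi].
pose c : 'rV[A]_n := map_mx (@repr _ _ : residue -> A) v.
have cv : map_mx residue_pi c = v.
  by apply/rowP => j; rewrite !mxE residue_piK.
have /rV0Pn[i vi] := v0.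
have wP j : exists x, (c *m phi) 0 j = a * x.
  apply/residue_pi0; rewrite -cv -map_mxM in vphi.
  by have := congr1 (fun u : 'rV_n => u 0 j) vphi; rewrite !mxE.
exists c, (\row_j sval (cid (wP j))), i; split.
  by move=> /residue_pi0 e; case/eqP: vi; rewrite -cv mxE.
by apply/rowP => j; rewrite [RHS]mxE [in RHS]mxE; apply: svalP (cid (wP j)).
Qed.

End ResidueRing.

(** * Local length of the cokernel of a square matrix *)

Section DeterminantLength.
Variables (A : idomainType) (ufdA : ufd A) (a : A) (ai : irreducible a).

Definition val_denom : mulrClosed A := not_multiple (ufd_irreducible_prime ufdA ai).

Lemma val_denomP s : s \in val_denom <-> ~ divides a s.
Proof. by split=> [/asboolP | h]; last exact/asboolP. Qed.

Definition row_image n (phi : 'M[A]_n) (w : 'rV[A]_n) : Prop :=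
  exists u : 'rV[A]_n, w = u *m phi.

Lemma lsub_row_image n (phi : 'M[A]_n) : lsub (row_image phi).
Proof.
split; first by exists 0; rewrite mul0mx.
move=> c _ _ [u ->] [v ->]; exists (c *: u + v).
by rewrite mulmxDl scalemxAl.
Qed.

(* By induction on the valuation of the determinant.  If it is positive, some
   combination [c *m phi], with a coefficient prime to [a], is [a *: w]; adding [w]
   to the row space then increases it by one step, and lowers the valuation of the
   determinant by one. *)
Lemma loclen_det n (phi : 'M[A]_n) : \det phi != 0 ->
  loclen val_denom (row_image phi) (fun _ => True) (val_at a (\det phi)).
Proof.
have a0 : a != 0 by case: (ai).
have [aU ap] := irreducible_prime ufdA ai.
move: {2}(val_at _ _) (erefl (val_at a (\det phi))) => v.
elim: v phi => [|v IH] phi ve d0.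
  rewrite ve; apply: loclen0 => //; first exact: lsub_row_image.
  move=> w _; exists (\det phi).
    apply/val_denomP; have [s ns e] := val_atP ufdA ai d0.
    by move: e ns; rewrite ve mul1r => <-.
  by exists (w *m \adj phi); rewrite -mulmxA mul_adj_mx mul_mx_scalar.
have /det_divides_ker : divides a (\det phi).
  by apply: (val_at_gt0 ufdA ai d0); rewrite ve.
move=> /(_ (irreducible_prime ufdA ai))[c [w [i [nci cw]]]].
(* [w] takes the place of row [i], whose coefficient in [c] is prime to [a]. *)
pose phi' : 'M[A]_n := \matrix_(j, l) if j == i then w 0 l else phi j l.
have phi'i : row i phi' = w by apply/rowP => l; rewrite !mxE eqxx.
have phi'j j : j != i -> row j phi' = row j phi.
  by move=> ji; apply/rowP => l; rewrite !mxE (negPf ji).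
have cE : c *m phi = c 0 i *: row i phi + \sum_(j | j != i) c 0 j *: row j phi.
  by rewrite mulmx_sum_row (bigD1 i).
(* Entry [i] of [c *m phi *m \adj phi] computed in two ways: entry [i] of [w *m \adj phi] is the
   expansion of [\det phi'] along row [i]. *)
have de : c 0 i * \det phi = a * \det phi'.
  transitivity ((c *m phi *m \adj phi) 0 i).
    by rewrite -mulmxA mul_mx_adj mul_mx_scalar !mxE mulrC.
  rewrite cw -scalemxAl mxE; congr (_ * _).
  rewrite mxE (expand_det_row phi' i); apply: eq_bigr => l _.
  rewrite !mxE eqxx; congr (_ * (_ * \det _)).
  by apply/matrixP => r s; rewrite !mxE [_ == i]eq_sym (negPf (neq_lift _ _)).
have c0 : c 0 i != 0 by apply/eqP => c0; apply: nci; rewrite c0; apply: divides0.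
have d0' : \det phi' != 0.
  by apply: contraTneq (mulf_neq0 c0 d0) => d0'; rewrite de d0' mulr0 eqxx.
have ve' : val_at a (\det phi') = v.
  have := congr1 (val_at a) de; rewrite !(val_atM ufdA) //.
  by rewrite (val_at_ndiv ai nci) (val_at_self ufdA ai) ve add0n add1n => -[].
pose Y x := exists b y, row_image phi y /\ x = y + b *: w.
have lX := lsub_row_image phi; have lX' := lsub_row_image phi'.
have lY : lsub Y.
  split; first by exists 0, 0; rewrite scale0r addr0; split=> //; case: lX.
  move=> e _ _ [b [x [Xx ->]]] [b' [x' [Xx' ->]]].
  exists (e * b + b'), (e *: x + x'); split; first by apply: lX.2.
  by rewrite scalerDr scalerA scalerDl addrACA.
have XY : incl (row_image phi) Y by move=> y Xy; exists 0, y; rewrite scale0r addr0.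
have aw : row_image phi (a *: w) by exists c.
have Yw : Y w by exists 1, 0; rewrite scale1r add0r; split=> //; case: lX.
have l1 : loclen val_denom (row_image phi) Y 1.
  apply: (loclen_adjoin (w := w)) => //.
  - move=> b; have [ba | nb] := pselect (divides a b); last by left; apply/val_denomP.
    by right; have [e ->] := ba; rewrite mulrC -scalerA; apply: lsubZ.
  - move=> s /val_denomP ns [u e].
    (* If [s *: w] were in the row space, cancelling [phi] would give [s * c 0 i = a * u 0 i],
       against primality of [a]. *)
    have : s *: (c *m phi) = (a *: u) *m phi by rewrite cw -scalemxAl -e !scalerA mulrC.
    rewrite scalemxAl => /(congr1 (mulmx^~ (\adj phi))).
    rewrite -!mulmxA mul_mx_adj !mul_mx_scalar => /(scalemx_inj d0).
    move=> /rowP/(_ i); rewrite !mxE => sc.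
    by have [] : divides a s \/ divides a (c 0 i) by apply: ap; exists (u 0 i).
have X'row j : row_image phi' (row j phi') by exists (delta_mx 0 j); rewrite rowE.
have Xrow j : row_image phi (row j phi) by exists (delta_mx 0 j); rewrite rowE.
have X'Y : incl (row_image phi') Y.
  move=> _ [u ->]; rewrite mulmx_sum_row; apply: lsub_sum => // j _.
  apply: lsubZ => //; have [-> | ji] := eqVneq j i; first by rewrite phi'i.
  by rewrite phi'j //; apply: XY.
(* As [c 0 i] is prime to [a], this makes [Y] and the row space of [phi'] agree after
   localization. *)
have X'cY y : Y y -> row_image phi' (c 0 i *: y).
  move=> [b [_ [[u ->] ->]]]; rewrite scalerDr; apply: lsubD => //; last first.
    by apply: lsubZ => //; apply: lsubZ; rewrite // -phi'i.
  rewrite mulmx_sum_row scaler_sumr; apply: lsub_sum => // j _.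
  rewrite scalerA mulrC -scalerA; apply: lsubZ => //.
  have [-> | ji] := eqVneq j i; last by apply: lsubZ => //; rewrite -phi'j.
  have -> : c 0 i *: row i phi =
      a *: w - \sum_(j | j != i) c 0 j *: row j phi by rewrite -cw cE addrK.
  apply: lsubB => //; first by apply: lsubZ => //; rewrite -phi'i.
  by apply: lsub_sum => // l li; apply: lsubZ => //; rewrite -phi'j.
have l0 : loclen val_denom (row_image phi') Y 0.
  by apply: loclen0 => // y Yy; exists (c 0 i); [apply/val_denomP | apply: X'cY].
have [b lb be] := loclenB lY (lsubT _) X'Y (fun _ _ => I) l0 (IH phi' ve' d0').
rewrite ve -ve' be; exact: (loclenD lY (lsubT _) XY (fun _ _ => I) l1 lb).
Qed.

End DeterminantLength.

(** * Bases *)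

Section Bases.
Variables (A : comNzRingType) (V : lmodType A).

Lemma is_basisI (I : finType) (b : I -> V) :
  (forall v, exists c : I -> A, v = \sum_i c i *: b i) ->
  (forall c : I -> A, \sum_i c i *: b i = 0 -> forall i, c i = 0) -> is_basis b.
Proof.
move=> span free v; have [c ve] := span v; exists [ffun i => c i]; split.
  by rewrite ve; apply: eq_bigr => i _; rewrite ffunE.
move=> c' ve'; apply/ffunP => i; rewrite ffunE; apply/eqP; rewrite -subr_eq0.
apply/eqP; apply: (free (fun i => c i - c' i)).
under eq_bigr => j _ do rewrite scalerBl.
by rewrite sumrB -ve -ve' subrr.
Qed.

Lemma is_basis_reindex (I J : finType) (b : I -> V) (h : J -> I) :
  bijective h -> is_basis b -> is_basis (b \o h).
Proof.
move=> [h' hK h'K] bb; apply: is_basisI => [v | c c0 j].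
  have [c [-> _]] := bb v; exists (c \o h).
  by rewrite (reindex h) //; exists h' => i _.
have [c1 [_ c1U]] := bb 0.
have u0 : c1 = [ffun => 0].
  by apply: c1U; rewrite big1 // => i _; rewrite ffunE scale0r.
have uc : c1 = [ffun i => c (h' i)].
  apply: c1U; rewrite -[LHS]c0 [RHS](reindex h) /=; last by exists h' => i _.
  by apply: eq_bigr => i _; rewrite ffunE hK.
by have := congr1 (fun f : {ffun _ -> _} => f (h j)) uc; rewrite u0 !ffunE hK.
Qed.

Section Coordinates.
Variables (I : finType) (b : I -> V) (bb : is_basis b).

Definition bcoord (v : V) : {ffun I -> A} := sval (cid (bb v)).

Lemma bcoord_sum v : v = \sum_i bcoord v i *: b i.
Proof. by rewrite /bcoord; case: cid => c []. Qed.

Lemma bcoordE v (c : I -> A) : v = \sum_i c i *: b i -> forall i, bcoord v i = c i.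
Proof.
move=> ve i; rewrite /bcoord; case: cid => c' [_ /= /(_ [ffun i => c i]) ->].
  by rewrite ffunE.
by rewrite ve; apply: eq_bigr => j _; rewrite ffunE.
Qed.

Lemma bcoordP a u v i : bcoord (a *: u + v) i = a * bcoord u i + bcoord v i.
Proof.
apply: (@bcoordE _ (fun i => a * bcoord u i + bcoord v i)).
under eq_bigr => j _ do rewrite scalerDl -scalerA.
by rewrite big_split /= -scaler_sumr -!bcoord_sum.
Qed.

Lemma bcoord_basis i j : bcoord (b j) i = (i == j)%:R.
Proof.
apply: (@bcoordE _ (fun i => (i == j)%:R)).
rewrite (bigD1 j) //= eqxx scale1r big1 ?addr0 // => l /negPf->.
by rewrite scale0r.
Qed.

Lemma bcoord_eq0 v : (forall i, bcoord v i = 0) -> v = 0.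
Proof.
by move=> h; rewrite [v]bcoord_sum big1 // => i _; rewrite h scale0r.
Qed.

End Coordinates.

Lemma is_basis_free (I : finType) (b : I -> V) : is_basis b ->
  forall c : I -> A, \sum_i c i *: b i = 0 -> forall i, c i = 0.
Proof.
move=> bb c c0 i; rewrite -(bcoordE bb (esym c0)).
by apply: (@bcoordE _ _ bb _ (fun _ => 0)); rewrite big1 // => j _; rewrite scale0r.
Qed.

End Bases.

Lemma is_basis_torsion_free (A : idomainType) (V : lmodType A) (I : finType)
  (b : I -> V) (a : A) (v : V) : is_basis b -> a != 0 -> a *: v = 0 -> v = 0.
Proof.
move=> bb a0 av; apply: (bcoord_eq0 (bb := bb)) => i; apply: (mulfI a0).
have := bcoordP bb a v 0 i; rewrite av addr0 => e.
by apply: (addIr (bcoord bb 0 i)); rewrite -e mulr0 add0r.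
Qed.

Section CayleyStep.
Variables (A : idomainType) (V W : lmodType A) (g : {linear W -> V}).

(* [Z] is generically isomorphic to the span of the [e (inl _)], by projection
   parallel to the [e (inr _)]. *)
Definition complements (U : lmodType A) (Z : U -> Prop) r r' (e : 'I_r + 'I_r' -> U) : Prop :=
  [/\ is_basis e,
      forall c : 'I_r' -> A, Z (\sum_l c l *: e (inr l)) -> \sum_l c l *: e (inr l) = 0 &
      forall j, exists (a : A) (c : 'I_r' -> A),
        a != 0 /\ Z (a *: e (inl j) + \sum_l c l *: e (inr l))].

(** Generically [Z] is the image of [g], so the projection of [g] to the first block has full rank
    [r] over the fraction field. Vectors of [w] giving a nonzero minor become the second block of
    the new basis; by Cramer's rule they correct a nonzero multiple of every other vector into the
    kernel of [g]. *)
Lemma complements_next (Z : V -> Prop) r r' (e : 'I_r + 'I_r' -> V) m (w : 'I_m -> W)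
    (ee : is_basis e) :
  complements Z e -> is_basis w -> (forall y, Z (g y)) ->
  (forall z, Z z -> exists2 a, a != 0 & exists y, a *: z = g y) ->
  exists r2 (e2 : 'I_r2 + 'I_r -> W), complements (fun y => g y = 0) e2 /\
    \det (\matrix_(j < r, l < r) bcoord ee (g (e2 (inr l))) (inl j)) != 0.
Proof.
move=> [_ einj esurj] wb Zg Zim.
pose pr (v : V) : 'rV[A]_r := \row_j bcoord ee v (inl j).
have prP a u v : pr (a *: u + v) = a *: pr u + pr v.
  by apply/rowP => j; rewrite !mxE bcoordP.
have pr0 := lin_sub0 prP; have prZ := lin_subZ prP; have prD := lin_subD prP.
have prS := lin_sub_sum prP.
have prr l : pr (e (inr l)) = 0 by apply/rowP => j; rewrite !mxE bcoord_basis.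
have pr_inj z : Z z -> pr z = 0 -> z = 0.
  move=> Zz pz; have ze : z = \sum_l bcoord ee z (inr l) *: e (inr l).
    rewrite [LHS](bcoord_sum ee) big_sumType /= big1 ?add0r // => j _.
    by have /rowP/(_ j) := pz; rewrite !mxE => ->; rewrite scale0r.
  by rewrite ze; apply: einj; rewrite -ze.
pose D : 'M[A]_(m, r) := \matrix_(l, j) pr (g (w l)) 0 j.
have rowD l : row l D = pr (g (w l)) by apply/rowP => j; rewrite !mxE.
have prg (c : 'I_m -> A) : pr (g (\sum_l c l *: w l)) = (\row_l c l) *m D.
  rewrite linear_sum prS mulmx_sum_row; apply: eq_bigr => l _.
  by rewrite linearZ_LR prZ rowD mxE.
(* A nonzero multiple of the [j]-th unit vector is the projection of an element of [Z], hence, up to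
   another scalar, of the image of [g]. *)
have fullD : row_full (map_mx (@tofrac A) D).
  rewrite -sub1mx; apply/row_subP => j; rewrite row1.
  have [a [c [a0 Zz]]] := esurj j; have [a' a'0 [y ze]] := Zim _ Zz.
  have := congr1 pr ze; rewrite [y](bcoord_sum wb) prg prZ prD prZ prS.
  rewrite big1 ?addr0 => [|l _]; last by rewrite prZ prr scaler0.
  have -> : pr (e (inl j)) = delta_mx 0 j.
    by apply/rowP => l; rewrite !mxE bcoord_basis eqxx.
  rewrite scalerA => /(congr1 (map_mx (@tofrac A))).
  rewrite map_mxM map_mxZ map_delta_mx => e1.
  have a1 : tofrac (a' * a) != 0 by rewrite tofrac_eq0 mulf_neq0.
  by rewrite -[delta_mx 0 j](scalerK a1) e1 scalemx_sub // submxMl.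
pose f := fullrankfun fullD.
have finj : injective f := @fullrankfun_inj _ _ _ _ fullD.
pose B := rowsub f D.
have B0 : \det B != 0.
  have := fullrowsub_unit fullD; rewrite -map_mxsub unitmxE unitfE det_map_mx.
  by rewrite tofrac_eq0.
(* The vectors left out by the minor form the first block. *)
pose T := ~: [set f x | x : 'I_r].
pose h (x : 'I_#|T| + 'I_r) : 'I_m := match x with inl i => enum_val i | inr l => f l end.
have hbij : bijective h.
  apply: inj_card_bij.
    move=> [i|l] [i'|l'] /=; first by move=> /enum_val_inj ->.
    - move=> e1; have := enum_valP i; rewrite e1 inE => /negP[].
      by apply/imsetP; exists l'.
    - move=> e1; have := enum_valP i'; rewrite -e1 inE => /negP[].
      by apply/imsetP; exists l.
    by move=> /finj ->.
  rewrite card_sum !card_ord; have := cardsC [set f x | x : 'I_r].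
  by rewrite card_imset // !card_ord addnC => ->.
have e2b : is_basis (w \o h) := is_basis_reindex hbij wb.
have prgr (c : 'I_r -> A) : pr (g (\sum_l c l *: (w \o h) (inr l))) = (\row_l c l) *m B.
  rewrite linear_sum prS mulmx_sum_row; apply: eq_bigr => l _.
  by rewrite linearZ_LR prZ mxE row_rowsub rowD.
exists #|T|, (w \o h); split; last first.
  rewrite -det_tr (_ : _^T = B) //.
  by apply/matrixP => l j; rewrite !mxE.
split=> // [c /(congr1 pr) | j].
  rewrite prgr pr0 => /(congr1 (mulmx^~ (\adj B))).
  rewrite -mulmxA mul_mx_adj mul_mx_scalar mul0mx => e1.
  have c0 : \row_l c l = 0 by apply: (scalemx_inj B0); rewrite scaler0.
  by rewrite big1 // => l _; have /rowP/(_ l) := c0; rewrite !mxE => ->; rewrite scale0r.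
(* Cramer's rule: [u *m B] is [- \det B] times the projection to be cancelled. *)
pose u := - (pr (g (w (h (inl j)))) *m \adj B).
exists (\det B), (fun l => u 0 l); split=> //.
apply: pr_inj; first exact: Zg.
rewrite linearD linearZ_LR prD prZ prgr (_ : \row_l u 0 l = u); last first.
  by apply/rowP => l; rewrite !mxE.
by rewrite mulNmx -mulmxA mul_adj_mx mul_mx_scalar subrr.
Qed.

End CayleyStep.

(** * Existence of adapted bases *)

Definition nz_denom (A : idomainType) (a : A) (a0 : a != 0) :
  {s : A | s \in (@nonzero A : mulrClosed A)} :=
  exist (fun s => s \in (@nonzero A : mulrClosed A)) a a0.

Section Complexes.
Variables (A : idomainType) (C : complex A).
Hypothesis exC : forall i (z : C i.+1), cdiff C i z = 0 -> exists y, cdiff C i.+1 y = z.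

(** Clearing denominators turns a cycle of the localized complex into a cycle of [C], which bounds
    by [exC]. *)
Lemma generically_exact_torsion :
  (forall x : C 0, exists2 a : A, a != 0 & exists y, a *: x = cdiff C 0 y) ->
  generically_exact C.
Proof.
move=> torC; split=> [y | i y].
  have [v [s ->]] := fracW y; have [a a0 [z e]] := torC v.
  exists (locfrac z (denomM (nz_denom a0) s)).
  by rewrite /genmap locmapE -e (frac_cancel (nz_denom a0)).
have [v [s ->]] := fracW y; split.
  rewrite /genmap locmapE => e0.
  have /fracP[u] : locfrac (cdiff C i v) s = locfrac 0 s by rewrite frac0.
  rewrite !scaler0 scalerA => e.
  have us0 : sval u * sval s != 0 
    by apply: mulf_neq0; [exact: (svalP u) | exact: (svalP s)].
  have [x xe] : exists x, cdiff C i.+1 x = (sval u * sval s) *: v.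
    by apply: exC; rewrite linearZ_LR.
  exists (locfrac x (denomM (nz_denom us0) s)); rewrite locmapE xe.
  exact: (frac_cancel (nz_denom us0)).
case=> x <-; have [w [t ->]] := fracW x.
by rewrite /genmap !locmapE cdiffK; apply: frac0.
Qed.

Section CayleyExists.
Hypothesis freeC : forall i, free_fin (C i).
Hypothesis torC : forall x : C 0, exists2 a : A, a != 0 & exists y, a *: x = cdiff C 0 y.

(** All of [C 0] in degree 0, so that in every degree the boundaries are generically all the
    cycles. *)
Definition cycles i : C i -> Prop :=
  match i with 0 => fun _ => True | j.+1 => fun z => cdiff C j z = 0 end.

(** A sigma type, because the bases are chosen recursively, each from the one below. *)
Definition partial_basis i : Type :=
  {r' : nat & {r : nat & {e : 'I_r + 'I_r' -> C i | complements (@cycles i) e}}}.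

Definition prank i (x : partial_basis i) : nat := projT1 (projT2 x).

Definition pbasis i (x : partial_basis i) : 'I_(prank x) + 'I_(projT1 x) -> C i :=
  sval (projT2 (projT2 x)).

Lemma pbasisP i (x : partial_basis i) : complements (@cycles i) (pbasis (x := x)).
Proof. exact: (svalP (projT2 (projT2 x))). Qed.

Lemma pbasis_is_basis i (x : partial_basis i) : is_basis (pbasis (x := x)).
Proof. by case: (pbasisP x). Qed.

Lemma partial_basis0 : exists x : partial_basis 0, projT1 x = 0%N.
Proof.
have [t [b bb]] := freeC 0.
pose h (x : 'I_t + 'I_0) : 'I_t :=
  match x with inl i => i | inr (Ordinal _ l0) => False_rect _ (notF l0) end.
have hb : bijective h.
  exists inl => // -[] // [] //.
suff H : complements (@cycles 0) (b \o h) by exists (existT _ 0%N (existT _ t (exist _ _ H))).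
split=> [|c _|j]; first exact: is_basis_reindex.
  by rewrite big_ord0.
by exists 1, (fun _ => 0); rewrite oner_neq0.
Qed.

Lemma cycles_im i (z : C i) : cycles z -> exists2 a : A, a != 0 & exists y, a *: z = cdiff C i y.
Proof.
case: i z => [|i] z; first by move=> _; apply: torC.
by move=> /exC[y <-]; exists 1; rewrite ?oner_neq0 //; exists y; rewrite scale1r.
Qed.

Lemma cycles_diff i (y : C i.+1) : cycles (cdiff C i y).
Proof. by case: i y => //= i y; apply: cdiffK. Qed.

Lemma partial_basis_next i (x : partial_basis i) :
  {r2 : nat & {e2 : 'I_r2 + 'I_(prank x) -> C i.+1 |
    complements (@cycles i.+1) e2 /\
    \det (\matrix_(j < prank x, l < prank x)
      bcoord (pbasis_is_basis x) (cdiff C i (e2 (inr l))) (inl j)) != 0}}.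
Proof.
have /cid[m /cid[w wb]] := freeC i.+1.
have /cid[r2 /cid h] := complements_next (pbasis_is_basis x) (pbasisP x) wb
  (@cycles_diff i) (@cycles_im i).
by exists r2.
Qed.

Fixpoint pbasis_seq i : partial_basis i :=
  match i with
  | 0 => sval (cid partial_basis0)
  | j.+1 => let n := partial_basis_next (pbasis_seq j) in
     existT _ (prank (pbasis_seq j)) (existT _ (projT1 n)
        (exist _ (sval (projT2 n)) (svalP (projT2 n)).1))
  end.

Definition cayley_rho i := prank (pbasis_seq i).

Lemma cayley_rhoS i : projT1 (pbasis_seq i) = rho_shift cayley_rho i.
Proof. by case: i => //=; apply: (svalP (cid partial_basis0)). Qed.

(** The size of the second block equals [rho_shift cayley_rho i] only by a case analysis on [i],
    hence the cast. *)
Definition cayley_basis i : basis_idx cayley_rho i -> C i :=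
  fun x => pbasis (x := pbasis_seq i)
    match x with inl j => inl j | inr l => inr (cast_ord (esym (cayley_rhoS i)) l) end.

Lemma cayley_basisP i : is_basis (@cayley_basis i).
Proof.
apply: (is_basis_reindex _ (pbasis_is_basis (pbasis_seq i))).
exists (fun x => match x with inl j => inl j | inr l => inr (cast_ord (cayley_rhoS i) l) end).
  by case=> // l; rewrite cast_ordKV.
by case=> // l; rewrite cast_ordK.
Qed.

Definition cayley_mx i (j : basis_idx cayley_rho i) (l : basis_idx cayley_rho i.+1) : A :=
  bcoord (@cayley_basisP i) (cdiff C i (cayley_basis l)) j.

Lemma cayley_block i : \det (block cayley_mx i) != 0.
Proof.
have := (svalP (projT2 (partial_basis_next (pbasis_seq i)))).2.
rewrite (_ : \matrix_(_, _) _ = block cayley_mx i) //.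
apply/matrixP => j l; rewrite !mxE /cayley_mx.
have -> : cayley_basis (inr l : basis_idx cayley_rho i.+1) =
  sval (projT2 (partial_basis_next (pbasis_seq i))) (inr l).
  by rewrite /cayley_basis /pbasis /=; congr (sval _ (inr _)); apply: val_inj.
move: (cdiff C i _) => v; pose c := bcoord (@cayley_basisP i) v.
pose h (x : basis_idx cayley_rho i) : 'I_(prank (pbasis_seq i)) + 'I_(projT1 (pbasis_seq i)) :=
  match x with inl j => inl j | inr l => inr (cast_ord (esym (cayley_rhoS i)) l) end.
pose h' (x : 'I_(prank (pbasis_seq i)) + 'I_(projT1 (pbasis_seq i))) : basis_idx cayley_rho i :=
  match x with inl j => inl j | inr l => inr (cast_ord (cayley_rhoS i) l) end.
rewrite (@bcoordE _ _ _ _ _ _ (fun x => c (h' x))) //.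
rewrite [LHS](bcoord_sum (@cayley_basisP i)) (reindex h').
  apply: eq_bigr => x _; congr (_ *: pbasis (x := _) _).
  by case: x => //= l'; rewrite cast_ordK.
by exists h; case=> //= l' _; rewrite ?cast_ordK ?cast_ordKV.
Qed.

(** A vector of the first block in top degree would yield a cycle involving it; the next object
    being zero, a nonzero multiple of this cycle vanishes, which is a relation between basis
    vectors. *)
Lemma cayley_rho_len : cayley_rho (clen C) = 0%N.
Proof.
apply/eqP; rewrite -leqn0 leqNgt; apply/negP => r0.
have [eb _ esurj] := pbasisP (pbasis_seq (clen C)).
have [a [c [a0 /cycles_im[a' a'0 [y]]]]] := esurj (Ordinal r0).
rewrite (cobj_gt (leqnn _) y) linear0 => e0.
have {}e0 := is_basis_torsion_free eb a'0 e0.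
pose f (x : 'I_(prank (pbasis_seq (clen C))) + 'I_(projT1 (pbasis_seq (clen C)))) : A :=
  match x with inl j => if j == Ordinal r0 then a else 0 | inr l => c l end.
suff f0 : \sum_x f x *: pbasis x = 0.
  by have := is_basis_free eb f0 (inl (Ordinal r0)); rewrite /f eqxx; apply/eqP.
rewrite big_sumType /= -[RHS]e0; congr (_ + _).
rewrite /f (bigD1 (Ordinal r0)) //= big1 ?addr0 // => j /negPf->.
by rewrite scale0r.
Qed.

Lemma cayley_det_exists : exists delta, cayley_det C delta.
Proof.
exists (\prod_(i < clen C) (tofrac (\det (block cayley_mx i)) ^ ((-1) ^+ i))).
exists cayley_rho, cayley_basis, cayley_mx; split=> //.
- exact: cayley_rho_len.
- exact: cayley_basisP.
- by move=> i l; apply: bcoord_sum.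
by move=> i _; apply: cayley_block.
Qed.

End CayleyExists.

End Complexes.

(** * Determinants and local lengths *)

Lemma has_length_uniq (B : comNzRingType) (V : lmodType B) s t :
  has_length V s -> has_length V t -> s = t.
Proof.
move=> [[U sU] ubs] [[W tW] ubt]; apply/anti_leq.
by rewrite (ubt _ _ sU) (ubs _ _ tW).
Qed.

Section DeterminantOfResolution.
Variables (A : idomainType) (ufdA : ufd A) (C : complex A).
Hypothesis exC : forall i (z : C i.+1), cdiff C i z = 0 -> exists y, cdiff C i.+1 y = z.

Variables (rho : nat -> nat) (b : forall i, basis_idx rho i -> C i)
  (D : forall i, basis_idx rho i -> basis_idx rho i.+1 -> A).
Hypotheses (rho_len : rho (clen C) = 0%N) (bb : forall i, is_basis (b (i := i)))
  (DE : forall i l, cdiff C i (b (i := i.+1) l) = \sum_j D j l *: b j)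
  (Dneq0 : forall i, (i < clen C)%N -> \det (block D i) != 0).

Arguments bb : clear implicits.

Definition cproj i (x : C i) : 'rV[A]_(rho i) := \row_j bcoord (bb i) x (inl j).

Lemma cproj_linear i : linear (@cproj i).
Proof. by move=> a x y; apply/rowP => j; rewrite !mxE bcoordP. Qed.

Lemma cprojE i (x : C i) : x = \sum_j cproj x 0 j *: b (inl j) +
  \sum_l bcoord (bb i) x (inr l) *: b (inr l).
Proof.
rewrite [LHS](bcoord_sum (bb i)) big_sumType /=; congr (_ + _).
by apply: eq_bigr => j _; rewrite mxE.
Qed.

Lemma cproj_basis i (c : 'I_(rho i) -> A) (c' : 'I_(rho_shift rho i) -> A) :
  cproj (\sum_j c j *: b (inl j) + \sum_l c' l *: b (inr l)) = \row_j c j.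
Proof.
apply/rowP => j; rewrite !mxE.
rewrite (@bcoordE _ _ _ _ (bb i) _ (fun x => match x with inl j => c j | inr l => c' l end)) //.
by rewrite big_sumType.
Qed.

Lemma cproj_surj i (w : 'rV[A]_(rho i)) : exists x : C i, cproj x = w.
Proof.
exists (\sum_j w 0 j *: b (inl j) + \sum_l 0 *: b (inr l)).
by rewrite cproj_basis; apply/rowP => j; rewrite mxE.
Qed.

(** The columns of [block D i] hold the projected differentials, so its transpose acts on row
    vectors. *)
Lemma cproj_diff i (c : 'I_(rho i) -> A) :
  cproj (cdiff C i (\sum_l c l *: b (inr l : basis_idx rho i.+1))) =
  (\row_l c l) *m (block D i)^T.
Proof.
rewrite linear_sum (lin_sub_sum (@cproj_linear i)) mulmx_sum_row.
apply: eq_bigr => l _; rewrite linearZ_LR (lin_subZ (@cproj_linear i)) mxE.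
congr (_ *: _); rewrite DE big_sumType cproj_basis.
by apply/rowP => j; rewrite !mxE.
Qed.

(** A boundary with zero projection lies in the span of the second block, on which the projected
    differential one degree lower is injective, its block having nonzero determinant; but a boundary
    is a cycle. In degree 0 the second block is empty. *)
Lemma cproj_diff_inj i (y : C i.+1) : (i <= clen C)%N ->
  cproj (cdiff C i y) = 0 -> cdiff C i y = 0.
Proof.
case: i y => [|i] y ilt.
  move=> p0; rewrite [LHS]cprojE p0 [X in _ + X]big_ord0 addr0 big1 // => j _.
  by rewrite mxE scale0r.
move: (cdiff C _ y) (cdiffK (c := C) y) => {y} z dz pz.
pose c : 'rV[A]_(rho i) := \row_l bcoord (bb i.+1) z (inr l).
have ze : z = \sum_l c 0 l *: b (inr l : basis_idx rho i.+1).
  rewrite [LHS]cprojE pz big1 ?add0r => [|j _]; last by rewrite mxE scale0r.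
  by apply: eq_bigr => l _; rewrite mxE.
have : c *m (block D i)^T = 0.
  transitivity (cproj (cdiff C i z)); last by rewrite dz (lin_sub0 (@cproj_linear i)).
  rewrite ze cproj_diff; congr (_ *m _); apply/rowP => l; rewrite !mxE.
  by congr (bcoord _ _ _).
move=> /(congr1 (mulmx^~ (\adj (block D i)^T))).
rewrite -mulmxA mul_mx_adj mul_mx_scalar mul0mx det_tr => c0.
have {}c0 : c = 0 by apply: (scalemx_inj (Dneq0 ilt)); rewrite scaler0.
by rewrite ze c0 big1 // => l _; rewrite mxE scale0r.
Qed.

Section LocalLength.
Variables (a : A) (ai : irreducible a).

Definition boundary_proj i (w : 'rV[A]_(rho i)) : Prop :=
  exists y : C i.+1, w = cproj (cdiff C i y).

Lemma lsub_boundary_proj i : lsub (@boundary_proj i).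
Proof.
split; first by exists 0; rewrite linear0 (lin_sub0 (@cproj_linear i)).
move=> c _ _ [x ->] [y ->]; exists (c *: x + y).
by rewrite linearP cproj_linear.
Qed.

(* Local length of the cokernel of [d_{i+1}] projected to the span of [b_i']. *)
Definition coker_len i n : Prop :=
  loclen (val_denom ufdA ai) (@boundary_proj i) (fun _ => True) n.

(* With [Z] the cycles and [F''] the span of [b_{i+1}''], the quotient of [C_{i+1}] by
   [Z + F''] is isomorphic both to [boundary_proj i / row_image B], through
   [cproj \o d_{i+1}], and to the quotient defining [coker_len i.+1], through [cproj]. *)
Lemma coker_len_step i m : (i < clen C)%N -> coker_len i.+1 m ->
  exists2 m', coker_len i m' & (m' + m = val_at a (\det (block D i)))%N.
Proof.
move=> ilt lm; set B := (block D i)^T.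
have B0 : \det B != 0 by rewrite det_tr Dneq0.
have gP : linear (fun x : C i.+1 => cproj (cdiff C i x)).
  by move=> c x y; rewrite linearP cproj_linear.
have lX := lsub_row_image B.
pose X (x : C i.+1) := row_image B (cproj (cdiff C i x)).
have kerpr (x : C i.+1) : cproj x = 0 -> row_image B (cproj (cdiff C i x)).
  move=> px; exists (\row_l bcoord (bb i.+1) x (inr l)).
  rewrite -cproj_diff; congr cproj; congr (cdiff C i _).
  rewrite [LHS]cprojE px big1 ?add0r // => j _; by rewrite mxE scale0r.
have imB w : row_image B w -> exists2 x : C i.+1, cproj x = 0 & w = cproj (cdiff C i x).
  move=> [u ->]; exists (\sum_j 0 *: b (inl j) + \sum_l u 0 l *: b (inr l : basis_idx rho i.+1)).
    by rewrite cproj_basis; apply/rowP => j; rewrite !mxE.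
  rewrite big1 ?add0r => [|j _]; last by rewrite scale0r.
  by rewrite cproj_diff; congr (_ *m _); apply/rowP => l; rewrite mxE.
(* [X] is the sum of the cycles and the span of the second block: [cproj_diff_inj] makes [x - x''] a
   cycle, and exactness makes it a boundary. *)
have XE x : X x <-> boundary_proj (cproj x).
  split=> [/imB[x'' px'' e] | [y e]].
    have [|y ye] := exC (z := x - x'').
      apply: cproj_diff_inj; first exact: ltnW.
      by rewrite (lin_subB gP) e subrr.
    by exists y; rewrite ye (lin_subB (@cproj_linear i.+1)) px'' subr0.
  rewrite /X; have -> : cproj (cdiff C i x) = cproj (cdiff C i (x - cdiff C i.+1 y)).
    by rewrite linearB /= cdiffK subr0.
  by apply: kerpr; rewrite (lin_subB (@cproj_linear i.+1)) e subrr.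
have l1 : loclen (val_denom ufdA ai) (row_image B) (@boundary_proj i) m.
  apply/(@loclen_transport _ _ _ _ _ X (fun _ => True) _ _ m gP) => //.
  - by move=> x; split=> [|[]].
  - move=> w; split=> [[y ->] | [_ [y [[u ->] _ ->]]]].
      by exists 0, y; rewrite add0r; split=> //; case: lX.
    have [x _ ->] := imB _ (ex_intro _ u erefl).
    by exists (x + y); rewrite (lin_subD gP).
  apply/(@loclen_transport _ _ _ _ _ X (fun _ => True) _ _ m (@cproj_linear i.+1)); last exact: lm.
  - by [].
  - exact: lsub_boundary_proj.
  - by move=> x; rewrite XE; split=> [|[]].
  move=> w; split=> // _; have [x <-] := cproj_surj w.
  by exists 0, x; rewrite add0r; split=> //; case: (lsub_boundary_proj i.+1).
have XY : incl (row_image B) (@boundary_proj i).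
  by move=> w /imB[x _ ->]; exists x.
have [m' lm' e] := loclenB (lsub_boundary_proj i) (lsubT _) XY (fun _ _ => I) l1
  (loclen_det ufdA ai B0).
by exists m' => //; rewrite addnC -e det_tr.
Qed.

Lemma coker_len_last : coker_len (clen C) 0.
Proof.
apply: loclen0 => //; first exact: lsub_boundary_proj.
move=> w _; exists 1; first exact: rpred1.
suff -> : 1 *: w = 0 by case: (lsub_boundary_proj (clen C)).
by apply/rowP => j; have : (j < 0)%N by rewrite -[X in (_ < X)%N]rho_len ltn_ord.
Qed.

(** Positions are counted from [i], so that passing to [i.+1] exchanges the even and the odd sum;
    keeping the two apart avoids subtraction of naturals. *)
Definition det_even m i := (\sum_(j < m)
  (if odd j then 0 else val_at a (\det (block D (i + j)%N))))%N.
Definition det_odd m i := (\sum_(j < m)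
  (if odd j then val_at a (\det (block D (i + j)%N)) else 0))%N.

(** The induction descends from the top degree, each length inheriting its finiteness from the one
    above. *)
Lemma coker_len_sum m i : (i + m = clen C)%N ->
  exists2 n, coker_len i n & (n + det_odd m i = det_even m i)%N.
Proof.
elim: m i => [|m IH] i.
  rewrite addn0 => ->; exists 0%N; first exact: coker_len_last.
  by rewrite /det_odd /det_even !big_ord0.
rewrite addnS -addSn => e; have [n ln ne] := IH _ e.
have ilt : (i < clen C)%N by rewrite -e addSn ltnS leq_addr.
have [n' ln' ne'] := coker_len_step ilt ln; exists n' => //.
have -> : det_odd m.+1 i = det_even m i.+1.
  rewrite /det_odd big_ord_recl add0n; apply: eq_bigr => j _.
  by rewrite lift0 /= addnS addSn; case: odd.
have -> : det_even m.+1 i = (val_at a (\det (block D i)) + det_odd m i.+1)%N.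
  rewrite /det_even big_ord_recl addn0; congr addn; apply: eq_bigr => j _.
  by rewrite lift0 /= addnS addSn; case: odd.
by rewrite -ne -ne' addnA.
Qed.

Variables (N : lmodType A) (p : C 0 -> N).
Hypotheses (p_lin : linear p) (p_surj : forall y, exists x, p x = y)
  (p_ker : forall x, p x = 0 <-> exists y, x = cdiff C 0 y).

(** [p] identifies [N] with the cokernel of the first differential, and [cproj] is bijective in
    degree 0 because the second block is empty there. *)
Lemma has_length_coker : exists n, has_length (locmod_at ufdA ai N) n /\
  (n + det_odd (clen C) 0 = det_even (clen C) 0)%N.
Proof.
have [//|n ln e] := @coker_len_sum (clen C) 0; exists n; split=> //.
apply: has_length_locmod.
pose X (x : C 0) := p x = 0.
apply/(@loclen_transport _ _ _ _ p X (fun _ => True) _ _ n p_lin); rewrite /X.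
- by [].
- exact: lsub0.
- by move=> x; split=> [|[]].
- move=> w; split=> // _; have [x <-] := p_surj w.
  by exists 0, x; rewrite add0r.
apply/(@loclen_transport _ _ _ _ _ X (fun _ => True) _ _ n (@cproj_linear 0)); last exact: ln.
- by [].
- exact: lsub_boundary_proj.
- move=> x; rewrite /X; split=> [/p_ker[y ->] | [_ [y e']]].
    by split=> //; exists y.
  apply/p_ker; exists y; rewrite [LHS]cprojE [RHS]cprojE e'.
  by rewrite !big_ord0.
move=> w; split=> // _; have [x <-] := cproj_surj w.
by exists 0, x; rewrite add0r; split=> //; case: (lsub_boundary_proj 0).
Qed.

End LocalLength.
End DeterminantOfResolution.

Lemma content_neq0 (A : idomainType) (ufdA : ufd A) (N : lmodType A) c :
  content ufdA N c -> c != 0.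
Proof.
move=> [P [len [PI _ _ _ ->]]]; rewrite prodf_seq_neq0.
by apply/allP => a /PI[a0 _ _] /=; rewrite expf_neq0.
Qed.

(** * Comparison of the determinant with the content *)

Section DeterminantContent.
Variables (A : idomainType) (ufdA : ufd A) (C : complex A).
Hypothesis exC : forall i (z : C i.+1), cdiff C i z = 0 -> exists y, cdiff C i.+1 y = z.
Variables (N : lmodType A) (p : C 0 -> N).
Hypotheses (p_lin : linear p) (p_surj : forall y, exists x, p x = y)
  (p_ker : forall x, p x = 0 <-> exists y, x = cdiff C 0 y).

(** [E] and [O] gather the blocks with exponent 1 and -1, so that the identity is read in [A], where
    valuations are defined. *)
Lemma cayley_det_length delta : cayley_det C delta ->
  exists E O, [/\ E != 0, O != 0, delta = tofrac E / tofrac O &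
    forall a (ai : irreducible a), exists n, has_length (locmod_at ufdA ai N) n /\
      (n + val_at a O = val_at a E)%N].
Proof.
move=> [rho [b [D [rho_len bb DE Dneq0 ->]]]].
pose F (e : bool) (i : 'I_(clen C)) := if odd i == e then \det (block D i) else 1.
have F0 e i : F e i != 0 by rewrite /F; case: ifP => _; rewrite ?oner_neq0 ?Dneq0.
have prod0 e : \prod_i F e i != 0 by apply/prodf_neq0 => i _.
exists (\prod_i F false i), (\prod_i F true i); split=> //.
  rewrite !rmorph_prod -prodf_div; apply: eq_bigr => i _.
  rewrite -signr_odd /F; case: odd; rewrite /= ?expr1 ?expr0.
    by rewrite rmorph1 mul1r exprN1.
  by rewrite rmorph1 divr1 expr1z.
move=> a ai; have [n [ln e]] :=
  has_length_coker ufdA exC rho_len bb DE Dneq0 ai p_lin p_surj p_ker.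
exists n; split=> //; rewrite !(val_at_prod ufdA) // -/(index_enum _).
suff [-> ->] : (\sum_i val_at a (F false i) = det_even D a (clen C) 0)%N /\
  (\sum_i val_at a (F true i) = det_odd D a (clen C) 0)%N by [].
split; apply: eq_bigr => i _; rewrite /F add0n; case: odd => //=;
  exact: (val_at_unit ufdA ai (unitr1 A)).
Qed.

Hypothesis detC : exists delta, cayley_det C delta.

Lemma has_length_locmod_exists a (ai : irreducible a) :
  exists n, has_length (locmod_at ufdA ai N) n.
Proof.
by have [_ /cayley_det_length[E [O [_ _ _ /(_ a ai)[n [ln _]]]]]] := detC; exists n.
Qed.

(** The two localizations are different types; their lengths are compared through the valuations of
    [E] and [O]. *)
Lemma has_length_associate a b (ai : irreducible a) (bi : irreducible b) m n :
  associate a b -> has_length (locmod_at ufdA ai N) m ->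
  has_length (locmod_at ufdA bi N) n -> m = n.
Proof.
move=> ab lm ln; have [_ /cayley_det_length[E [O [E0 O0 _ h]]]] := detC.
have [m' [lm' em]] := h a ai; have [n' [ln' en]] := h b bi.
rewrite (has_length_uniq lm lm') (has_length_uniq ln ln').
apply: (@addIn (val_at a O)); rewrite em (val_at_associate ufdA ai bi O0 ab) en.
exact: (val_at_associate ufdA ai bi E0 ab).
Qed.

(** The local length at [a] is at most the valuation of [E], so representatives of the irreducible
    factors of [E] suffice for [P]. *)
Lemma content_exists : exists c, content ufdA N c.
Proof.
have [_ /cayley_det_length[E [O [E0 O0 _ h]]]] := detC.
pose len a := if pselect (irreducible a) is left ai
  then sval (cid (has_length_locmod_exists ai)) else 0%N.
have lenP a (ai : irreducible a) : has_length (locmod_at ufdA ai N) (len a).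
  rewrite /len; case: pselect => // ai'.
  by rewrite (Prop_irrelevance ai ai'); apply: svalP (cid _).
have [s [sI sE]] := irreducible_factors ufdA E0.
have [P [PI Pn Ps]] := irreducible_transversal sI.
exists (\prod_(a <- P) a ^+ len a), P, len; split=> // a ai /eqP l0.
have [n [ln e]] := h a ai.
have aE : divides a E.
  apply: (val_at_gt0 ufdA ai E0); rewrite -e ltn_addr //.
  by rewrite -(has_length_uniq (lenP a ai) ln) lt0n.
have [b bs ba] := sE a ai aE; have [b' b'P b'b] := Ps b bs.
by exists b' => //; apply: associate_trans ba.
Qed.

(** At most one member of [P] is associate to [a], and the other factors have valuation 0; if there
    is none, the length at [a] is 0 by the choice of [P]. *)
Lemma val_at_content c a (ai : irreducible a) n : content ufdA N c ->
  has_length (locmod_at ufdA ai N) n -> val_at a c = n.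
Proof.
move=> [P [len [PI Pn lenP Plen ->]]] ln.
have P0 i : (i < size P)%N -> irreducible P`_i by move=> iP; apply/PI/mem_nth.
rewrite (big_nth 0) big_mkord.
pose F (i : 'I_(size P)) := P`_i ^+ len P`_i.
have F0 i : F i != 0 by rewrite expf_neq0 //; case: (P0 i (ltn_ord i)).
rewrite (val_at_prod ufdA) //.
have Fv (i : 'I_(size P)) : val_at a (F i) = (len (P`_i)%R * val_at a (P`_i)%R)%N.
  by rewrite (val_atX ufdA) //; case: (P0 i (ltn_ord i)).
have nv (i : 'I_(size P)) : ~ associate a P`_i -> val_at a (F i) = 0%N.
  move=> na; rewrite Fv (val_at_ndiv ai) ?muln0 // => /irreducible_divides.
  by move=> /(_ ai (P0 i (ltn_ord i))).
have [[i ia] | ni] := pselect (exists i : 'I_(size P), associate a P`_i).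
  rewrite (bigD1 i) //= big1 ?addn0 => [|j ji].
    rewrite Fv (val_at_associate ufdA ai (P0 i (ltn_ord i)) _ ia); last first.
      by case: (P0 i (ltn_ord i)).
    rewrite (val_at_self ufdA (P0 i (ltn_ord i))) muln1; apply/esym.
    exact: has_length_associate ia ln (lenP _ (P0 i (ltn_ord i))).
  apply: nv => aj; have ij := associate_trans (associate_sym ia) aj.
  have := ji; rewrite -val_eqE /= neq_ltn => /orP[lt | lt].
    by apply: (Pn j i); rewrite ?lt //=; apply: associate_sym.
  by apply: (Pn i j); rewrite ?lt //=.
rewrite big1 => [|i _]; last by apply: nv => ia; apply: ni; exists i.
rewrite (has_length_uniq ln (lenP a ai)); apply/esym/eqP/negPn/negP => /eqP l0.
have [b /(nthP 0)[i iP <-] ba] := Plen a ai l0.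
by apply: ni; exists (Ordinal iP); apply: associate_sym.
Qed.

(** [E] and [c * O] have the same valuation at every irreducible. *)
Lemma cayley_det_content delta c : cayley_det C delta -> content ufdA N c ->
  exists2 u : A, u \is a GRing.unit & delta = tofrac (u * c).
Proof.
move=> /cayley_det_length[E [O [E0 O0 -> h]]] cc.
have c0 := content_neq0 cc.
have [|u uu e] := val_at_eq ufdA E0 (mulf_neq0 c0 O0).
  move=> a ai; have [n [ln <-]] := h a ai; rewrite (val_atM ufdA) //.
  by rewrite (val_at_content cc ln).
exists u => //; rewrite e mulrA [LHS](_ : _ = tofrac (u * c)) // tofracM mulfK //.
by rewrite tofrac_eq0.
Qed.

End DeterminantContent.

(** * Rank polynomials *)

Section Differences.
Variables (q : nat) (d : 'X_{1..q}).
Implicit Types p H : {mpoly rat[q]}.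

Definition mshift H : {mpoly rat[q]} :=
  H \mPo [tuple 'X_i - ((d i)%:R)%:MP | i < q].

Lemma msize_sum_le s I (r : seq I) (P : pred I) (F : I -> {mpoly rat[q]}) :
  (forall i, P i -> msize (F i) <= s)%N -> (msize (\sum_(i <- r | P i) F i) <= s)%N.
Proof.
move=> le; elim/big_ind: _ => //; first by rewrite msize0.
by move=> x y xs ys; apply: leq_trans (msizeD_le _ _) _; rewrite geq_max xs.
Qed.

Lemma msizeXU_le i p : (msize ('X_i * p) <= (msize p).+1)%N.
Proof.
have [-> | p0] := eqVneq p 0; first by rewrite mulr0 msize0.
have X0 : ('X_i : {mpoly rat[q]}) != 0 by rewrite -msize_poly_eq0 msizeX.
by rewrite msizeM // msizeX mdeg1.
Qed.

(** Induction on the degree, both bounds together: with [m = U_(i) + m'], the difference for [m] is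
    ['X_i] times the difference for [m'] plus [d i] times the shift of ['X_[m']]. *)
Lemma msize_shiftX m : (msize (mshift 'X_[m]) <= (mdeg m).+1)%N /\
  (msize ('X_[m] - mshift 'X_[m]) <= mdeg m)%N.
Proof.
move: {2}(mdeg m) (erefl (mdeg m)) => t; elim: t m => [|t IH] m mt.
  move/eqP: mt; rewrite mdeg_eq0 => /eqP->.
  by rewrite mpolyX0 /mshift comp_mpoly1 subrr msize0 msize1.
have [i mi] : exists i, (0 < m i)%N.
  have [i mi | m0] := pickP (fun i => 0 < m i)%N; first by exists i.
  by move: mt; rewrite mdegE big1 // => i _; move/negbT: (m0 i); case: (m i).
pose m' := (m - U_(i))%MM.
have me : m = (U_(i) + m')%MM.
  by apply/mnmP => l; rewrite mnmDE mnmBE mnm1E; case: eqVneq => [<- | _]; lia.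
have m't : mdeg m' = t by move: mt; rewrite {1}me mdegD mdeg1; lia.
have [IH1 IH2] := IH m' m't; rewrite mt me mpolyXD.
have e : mshift ('X_[U_(i)] * 'X_[m']) =
    'X_i * mshift 'X_[m'] - (d i)%:R *: mshift 'X_[m'].
  rewrite /mshift rmorphM /= comp_mpolyXU -tnth_nth tnth_mktuple mulrBl.
  by rewrite mul_mpolyC.
have le1 : (msize ((d i)%:R *: mshift 'X_[m']) <= t.+1)%N.
  by apply: leq_trans (msizeZ_le _ _) _; rewrite -m't.
have le2 : (msize ('X_i * mshift 'X_[m']) <= t.+2)%N.
  by apply: leq_trans (msizeXU_le _ _) _; rewrite ltnS -m't.
split.
  rewrite e; apply: leq_trans (msizeD_le _ _) _; rewrite geq_max msizeN le2 /=.
  exact: leqW.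
rewrite e opprB addrCA -mulrBr; apply: leq_trans (msizeD_le _ _) _.
by rewrite geq_max le1 (leq_trans (msizeXU_le _ _)) // ltnS -m't.
Qed.

Lemma msize_difference H s : (msize H <= s.+1)%N -> (msize (H - mshift H) <= s)%N.
Proof.
move=> Hs; rewrite [X in X - _](mpolyE H) /mshift comp_mpolyEX -sumrB.
rewrite big_seq_cond; apply: msize_sum_le => m /andP[mH _].
rewrite -scalerBr; apply: leq_trans (msizeZ_le _ _) _.
apply: leq_trans (msize_shiftX m).2 _.
by rewrite -ltnS; apply: leq_trans Hs; apply: msize_mdeg_lt.
Qed.

Lemma mshift_eval H (nu : 'X_{1..q}) : (d <= nu)%MM ->
  (mshift H).@[fun i => (nu i)%:R] = H.@[fun i => ((nu - d)%MM i)%:R].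
Proof.
move=> /mnm_lepP le; rewrite /mshift comp_mpoly_meval; apply: meval_eq => i.
by rewrite tnth_mktuple mevalB mevalXU mevalC mnmBE natrB.
Qed.

End Differences.

(** * Generic rank as a length *)

Section GenericRank.
Variables (A : idomainType) (V : lmodType A).
Local Notation S := (@nonzero A : mulrClosed A).

(** The spans of the first [j] vectors form a chain in which each step adjoins one vector; above the
    full span only torsion remains. *)
Lemma loclen_free t (v : 'I_t -> V) :
  (forall a : 'I_t -> A, \sum_i a i *: v i = 0 -> forall i, a i = 0) ->
  (forall w, exists2 s, s \in S & exists a : 'I_t -> A, s *: w = \sum_i a i *: v i) ->
  loclen S (fun w : V => w = 0) (fun _ => True) t.
Proof.
move=> vfree vspan.
pose Y j w := exists a : 'I_t -> A, w = \sum_(i < t | (i < j)%N) a i *: v i.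
have lY j : lsub (Y j).
  split; first by exists (fun _ => 0); rewrite big1 // => i _; rewrite scale0r.
  move=> c _ _ [a ->] [b ->]; exists (fun i => c * a i + b i).
  rewrite scaler_sumr -big_split; apply: eq_bigr => i _.
  by rewrite scalerDl scalerA.
have Y0 w : Y 0%N w <-> w = 0.
  split=> [[a ->] | ->]; first by rewrite big_pred0.
  by exists (fun _ => 0); rewrite big_pred0.
have Yj j : (j <= t)%N -> loclen S (Y 0%N) (Y j) j.
  elim: j => [|j IH] jt.
    apply: loclen0 => // w Yw; exists 1; first exact: rpred1.
    by rewrite scale1r.
  pose oj := Ordinal jt.
  have YS w : Y j.+1 w <-> exists a x, Y j x /\ w = x + a *: v oj.
    have E a : \sum_(i < t | (i < j.+1)%N) a i *: v i =
        \sum_(i < t | (i < j)%N) a i *: v i + a oj *: v oj.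
      rewrite (bigD1 oj) //= addrC; congr (_ + _); apply: eq_bigl => i.
      by rewrite -val_eqE /= ltnS ltn_neqAle andbC.
    split=> [[a ->] | [a [_ [[c ->] ->]]]].
      by rewrite E; exists (a oj), (\sum_(i < t | (i < j)%N) a i *: v i); split=> //; exists a.
    exists (fun i => if i == oj then a else c i); rewrite E eqxx; congr (_ + _).
    by apply: eq_bigr => i ij; rewrite ifN // -val_eqE /= neq_ltn ij.
  suff : loclen S (Y 0%N) (Y j.+1) (j + 1)%N by rewrite addn1.
  apply: (loclenD (lY j) (lY j.+1)); last 1 first.
  - apply: (loclen_adjoin (w := v oj)) => //.
    + by apply/YS; exists 1, 0; rewrite add0r scale1r; split=> //; case: (lY j).
    + move=> a; have [-> | a0] := eqVneq a 0; last by left.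
      by right; rewrite scale0r; case: (lY j).
    (* If [s *: v oj] were in the span of the earlier vectors, this would be a vanishing combination
       with coefficient [- s] at [oj]. *)
    move=> s s0 [a e]; have := vfree (fun i => if (i < j)%N then a i else - s *+ (i == oj)).
    move=> /(_ _ oj); rewrite ltnn eqxx mulr1n => h; case/eqP: (s0 : s != 0).
    apply/eqP; rewrite -oppr_eq0; apply/eqP; apply: h.
    rewrite (bigID (fun i : 'I_t => (i < j)%N)) /=.
    rewrite (eq_bigr (fun i => a i *: v i)) => [|i ->] //; rewrite -e.
    rewrite (bigD1 oj) /= ?ltnn // eqxx mulr1n big1 ?addr0 => [|i /andP[/negPf-> /negPf->]].
      by rewrite scaleNr subrr.
    by rewrite mulr0n scale0r.
  - by move=> w /Y0->; case: (lY j).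
  - by move=> w Yw; apply/YS; exists 0, w; rewrite scale0r addr0.
  exact/IH/ltnW.
apply: (loclen_ext Y0 (Y := fun _ => True)) => //.
rewrite -[t]addn0; apply: (loclenD (lY t)) => //; [| exact: Yj |].
  by move=> w /Y0->; case: (lY t).
apply: loclen0 => // w _; have [s s0 [a e]] := vspan w; exists s => //.
by exists a; rewrite e; apply: eq_bigl => i; rewrite ltn_ord.
Qed.

Lemma locfrac_sum (I : finType) (P : pred I) (x : I -> V) :
  (\sum_(i | P i) locfrac (x i) (denom1 S) : genmod V) =
  locfrac (\sum_(i | P i) x i) (denom1 S).
Proof.
apply/esym; apply: (big_morph (fun x => locfrac x (denom1 S) : genmod V)); last first.
  exact: frac0.
move=> u v; rewrite [RHS]fracD /= !scale1r; congr locfrac.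
by apply: val_inj; rewrite /= mulr1.
Qed.

Lemma genmodZ a (s : {s | s \in S}) (v : V) t :
  (tofrac a / tofrac (sval s)) *: (locfrac v t : genmod V) = locfrac (a *: v) (denomM s t).
Proof. exact: loc_scaleE. Qed.

(** The numerators of a basis over the fraction field serve: denominators are cleared in relations
    and in expansions. *)
Lemma has_basis_loclen t : has_basis_of_card (genmod V) t ->
  loclen S (fun w : V => w = 0) (fun _ => True) t.
Proof.
move=> [e eb]; pose v i := num (e i); pose s i := den (e i).
have eE i : e i = locfrac (v i) (s i) by rewrite num_denK.
apply: (loclen_free (v := v)) => [a a0 i | w].
  have aE j : (tofrac (a j * sval (s j))) *: e j = locfrac (a j *: v j) (denom1 S).
    have e1 x : tofrac x = tofrac x / tofrac (sval (denom1 S)) by rewrite /= tofrac1 divr1.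
    rewrite eE [tofrac _]e1 genmodZ.
    apply/fracP; exists (denom1 S); rewrite /= !scalerA; congr (_ *: _); ring.
  have := is_basis_free eb (c := fun j => tofrac (a j * sval (s j))) _ i.
  rewrite (eq_bigr (fun j => locfrac (a j *: v j) (denom1 S))); last by [].
  rewrite locfrac_sum a0 => /(_ (frac0 _ _))/eqP; rewrite tofrac_eq0 mulf_eq0.
  by rewrite (negPf (svalP (s i) : sval (s i) != 0)) orbF => /eqP.
pose P (y : genmod V) := exists (a : 'I_t -> A) s, y = locfrac (\sum_i a i *: v i) s.
have PD x y : P x -> P y -> P (x + y).
  move=> [a [r ->]] [b [r' ->]]; exists (fun i => sval r' * a i + sval r * b i), (denomM r r').
  rewrite [LHS]fracD !scaler_sumr -big_split; congr locfrac; apply: eq_bigr => i _.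
  by rewrite scalerDl !scalerA.
have [c [we _]] := eb (locfrac w (denom1 S)).
have [a [r e0]] : P (locfrac w (denom1 S)).
  rewrite we; elim/big_ind: _ => //.
    exists (fun _ => 0), (denom1 S); rewrite big1 ?frac0 // => i _; exact: scale0r.
  move=> i _; have /locring_predP[[b r] ->] := nonzero_locringT (c i).
  exists (fun j => b *+ (j == i)), (denomM r (s i)); rewrite eE genmodZ /=.
  rewrite (bigD1 i) //= eqxx mulr1n big1 ?addr0 // => j /negPf->.
  by rewrite mulr0n scale0r.
have /fracP[u /= e1] := e0; exists (sval u * sval r).
  by rewrite rpredM ?(svalP u) ?(svalP r).
exists (fun i => sval u * a i); move: e1; rewrite scalerA scale1r => ->.
by rewrite scaler_sumr; apply: eq_bigr => i _; rewrite scalerA.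
Qed.

End GenericRank.

(** * Multigraded modules *)

Section Eventually.
Variable q : nat.
Implicit Types P Q : 'X_{1..q} -> Prop.

Lemma eventually_and P Q : eventually P -> eventually Q ->
  eventually (fun nu => P nu /\ Q nu).
Proof.
move=> [a aP] [b bQ]; exists (a + b)%MM => nu le; split.
  by apply: aP; apply: lepm_trans le; apply: lem_addr.
by apply: bQ; apply: lepm_trans le; apply: lem_addl.
Qed.

Lemma eventually_mono P Q : (forall nu, P nu -> Q nu) -> eventually P -> eventually Q.
Proof. by move=> PQ [a aP]; exists a => nu /aP/PQ. Qed.

Lemma eventually_shift d P : eventually P ->
  eventually (fun nu => (d <= nu)%MM /\ P (nu - d)%MM).
Proof.
move=> [a aP]; exists (a + d)%MM => nu le; split.
  by apply: lepm_trans le; apply: lem_addl.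
apply: aP; apply/mnm_lepP => i; have /mnm_lepP/(_ i) := le.
by rewrite mnmDE mnmBE => ?; lia.
Qed.

End Eventually.

(** * Homogeneous components *)

Section GradedDecomposition.
Variables (A : idomainType) (q : nat) (n : 'I_q -> nat) (M : gmodule A n).
Hypothesis grM : multigraded M.
Local Notation Nq := 'X_{1..q}.

(** A total function with finite support, so that decompositions are added and compared degree by
    degree. *)
Definition hdecomp (x : M) (c : Nq -> M) : Prop :=
  (forall nu, c nu \in gcomp M nu) /\
  exists s, [/\ uniq s, forall nu, nu \notin s -> c nu = 0 & x = \sum_(nu <- s) c nu].

Lemma gcomp0 nu : (0 : M) \in gcomp M nu.
Proof. exact: (rpred0 (gcomp M nu)). Qed.
Lemma gcompD nu (x y : M) : x \in gcomp M nu -> y \in gcomp M nu -> x + y \in gcomp M nu.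
Proof. by move=> xM yM; apply: (rpredD (S := gcomp M nu)) xM yM. Qed.
Lemma gcompB nu (x y : M) : x \in gcomp M nu -> y \in gcomp M nu -> x - y \in gcomp M nu.
Proof.
by move=> xM yM; apply: gcompD => //; have := rpredZ (-1) yM; rewrite scaleN1r.
Qed.
Lemma sum_widen (c : Nq -> M) s t : uniq s -> uniq t ->
  (forall nu, nu \notin s -> c nu = 0) -> {subset s <= t} ->
  \sum_(nu <- t) c nu = \sum_(nu <- s) c nu.
Proof.
move=> us ut cs st; rewrite (bigID (mem s)) /= [X in _ + X]big1 ?addr0 => [|nu /cs //].
rewrite -big_filter; apply: perm_big; apply: uniq_perm; rewrite ?filter_uniq //.
by move=> nu; rewrite mem_filter andb_idr //; apply: st.
Qed.

Lemma hdecomp_exists x : exists c, hdecomp x c.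
Proof.
have [/(_ x)[s [c [cM ->]]] _ _] := grM.
(* [s] may repeat a degree, hence the multiplicities. *)
exists (fun nu => c nu *+ count_mem nu s); split=> [nu|].
  exact: (rpredMn (S := gcomp M nu)) (cM nu).
exists (undup s); split; first exact: undup_uniq.
  by move=> nu; rewrite mem_undup => /count_memPn->.
exact/esym/(big_undup_iterop_count +%R).
Qed.

Lemma hdecompD x y c c' : hdecomp x c -> hdecomp y c' ->
  hdecomp (x + y) (fun nu => c nu + c' nu).
Proof.
move=> dx dy; have [cM [s [us cs xe]]] := dx; have [cM' [s' [us' cs' ye]]] := dy.
split=> [nu|]; first exact: gcompD.
exists (undup (s ++ s')); split; first exact: undup_uniq.
  by move=> nu; rewrite mem_undup mem_cat negb_or => /andP[/cs-> /cs'->]; rewrite addr0.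
rewrite big_split xe ye; congr (_ + _); apply/esym.
  by apply: sum_widen => //; [exact: undup_uniq |]; move=> nu ns;
    rewrite mem_undup mem_cat ns.
by apply: sum_widen => //; [exact: undup_uniq |]; move=> nu ns;
  rewrite mem_undup mem_cat ns orbT.
Qed.

Lemma hdecomp0 : hdecomp 0 (fun _ => 0).
Proof. by split=> [nu|]; [exact: gcomp0 | exists [::]; rewrite big_nil]. Qed.

Lemma hdecomp_sum (I : finType) (P : pred I) (x : I -> M) (c : I -> Nq -> M) :
  (forall i, hdecomp (x i) (c i)) ->
  hdecomp (\sum_(i | P i) x i) (fun nu => \sum_(i | P i) c i nu).
Proof.
move=> h; rewrite -![\sum_(i | P i) _]big_filter.
rewrite (_ : (fun nu => _) = fun nu => \sum_(i <- filter P (index_enum I)) c i nu); last first.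
  by apply/funext => nu; rewrite big_filter.
elim: (filter _ _) => [|i r IH].
  rewrite big_nil (_ : (fun nu => _) = fun=> 0); first exact: hdecomp0.
  by apply/funext => nu; rewrite big_nil.
rewrite big_cons (_ : (fun nu => _) = fun nu => c i nu + \sum_(j <- r) c j nu).
  exact: hdecompD.
by apply/funext => nu; rewrite big_cons.
Qed.

(** Subtraction of multidegrees is truncated, hence the guard. *)
Lemma hdecomp_scale d g x c : homogeneous d g -> hdecomp x c ->
  hdecomp (g *: x) (fun nu => if (d <= nu)%MM then g *: c (nu - d)%MM else 0).
Proof.
move=> hg [cM [s [us cs ->]]]; have [_ _ grZ] := grM.
split=> [nu|].
  case: ifP => [le | _]; last exact: gcomp0.
  by have := grZ _ _ _ _ hg (cM (nu - d)%MM); rewrite addmC submK.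
exists [seq (d + nu)%MM | nu <- s]; split.
- by rewrite map_inj_uniq //; apply: addmI.
- move=> nu ns; case: ifP => // le; rewrite cs ?scaler0 //.
  by apply: contra ns => ns; apply/mapP; exists (nu - d)%MM; rewrite // addmC submK.
rewrite big_map scaler_sumr; apply: eq_bigr => nu _.
by rewrite lem_addr addmC addmK.
Qed.

Lemma hdecomp_hom nu x : x \in gcomp M nu -> hdecomp x (fun mu => if mu == nu then x else 0).
Proof.
move=> xM; split=> [mu|]; first by case: eqVneq => [-> | _] //; exact: gcomp0.
exists [:: nu]; rewrite big_seq1 eqxx; split=> // mu.
by rewrite inE => /negPf->.
Qed.

Lemma hdecomp_uniq x c c' : hdecomp x c -> hdecomp x c' -> forall nu, c nu = c' nu.
Proof.
move=> dx dx' nu; have [cM [s [us cs xe]]] := dx; have [cM' [s' [us' cs' xe']]] := dx'.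
pose t := undup (nu :: s ++ s'); have [_ ind _] := grM.
apply/eqP; rewrite -subr_eq0; apply/eqP.
apply: (ind t (fun mu => c mu - c' mu)); first exact: undup_uniq.
- by move=> mu; apply: gcompB.
- rewrite sumrB (sum_widen (c := c) (t := t) us) ?(sum_widen (c := c') (t := t) us') ?undup_uniq //.
  + by rewrite -xe -xe' subrr.
  + by move=> mu ms; rewrite mem_undup inE mem_cat ms !orbT.
  by move=> mu ms; rewrite mem_undup inE mem_cat ms !orbT.
by rewrite mem_undup mem_head.
Qed.

Section Forms.
Variables (k : nat) (f : 'I_k -> {mpoly A[nvars n]}) (d : 'I_k -> Nq).
Hypothesis degf : forall i, homogeneous (d i) (f i).

Lemma forms_submodP j (x : M) : x \in forms_submod M f j <->
  exists c : 'I_k -> M, x = \sum_(i < k | (i < j)%N) f i *: c i.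
Proof. by split=> [/asboolP | h]; last exact/asboolP. Qed.

(** Taking components of degree [nu] in any expression of [x] makes its coefficients homogeneous. *)
Lemma forms_submod_hom j nu (x : M) : x \in gcomp M nu -> x \in forms_submod M f j ->
  exists m : 'I_k -> M,
    (forall i, if (d i <= nu)%MM then m i \in gcomp M (nu - d i)%MM else m i == 0) /\
    x = \sum_(i < k | (i < j)%N) f i *: m i.
Proof.
move=> xM /forms_submodP[c xe].
pose e i := sval (cid (hdecomp_exists (c i))).
have de i : hdecomp (c i) (e i) := svalP (cid (hdecomp_exists (c i))).
exists (fun i => if (d i <= nu)%MM then e i (nu - d i)%MM else 0); split.
  by move=> i; case: (d i <= nu)%MM => //; case: (de i) => + _; apply.
have := hdecomp_sum (fun i : 'I_k => (i < j)%N) (fun i => hdecomp_scale (@degf i) (de i)).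
rewrite -xe => /(hdecomp_uniq (hdecomp_hom xM))/(_ nu); rewrite eqxx => ->.
by apply: eq_bigr => i _; case: ifP => // _; rewrite scaler0.
Qed.

Lemma forms_gcomp nu (m : 'I_k -> M) i : (d i <= nu)%MM ->
  m i \in gcomp M (nu - d i)%MM -> f i *: m i \in gcomp M nu.
Proof.
have [_ _ grZ] := grM; move=> le mM.
by have := grZ _ _ _ _ (@degf i) mM; rewrite addmC submK.
Qed.

Hypothesis regf : filter_regular_seq M f.

(** Filter-regularity read on elements of [M], where the later arguments take place. *)
Lemma filter_regular_forms (i : 'I_k) : eventually (fun nu => forall m : M,
  m \in gcomp M nu -> f i *: m \in forms_submod M f i -> m \in forms_submod M f i).
Proof.
have [_ /(_ i)[_ ev]] := regf; apply: eventually_mono ev => nu h m mM fm.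
have pi_eq0 (y : M) : quotm_pi (forms_submod M f i) y = 0 <-> y \in forms_submod M f i.
  by rewrite -(quotm_pi0 (forms_submod M f i)); split=> [/quotm_piP | hy];
    [rewrite subr0 | apply/quotm_piP; rewrite subr0].
apply/pi_eq0/h; first by apply/asboolP; exists m.
by rewrite [LHS](quotm_piZ (forms_submod M f i) (f i) m); apply/pi_eq0.
Qed.

End Forms.
End GradedDecomposition.

(** * Ranks of the successive quotients *)

Section RankOfQuotients.
Variables (A : idomainType) (q : nat) (n : 'I_q -> nat) (M : gmodule A n).
Hypothesis grM : multigraded M.
Variables (k : nat) (f : 'I_k -> {mpoly A[nvars n]}) (d : 'I_k -> 'X_{1..q}).
Hypotheses (degf : forall i, homogeneous (d i) (f i)) (regf : filter_regular_seq M f).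
Local Notation S := (@nonzero A : mulrClosed A).

Definition forms_comp j nu (x : restr M) : Prop :=
  x \in gcomp M nu /\ (x : M) \in forms_submod M f j.

Lemma lsub_forms_comp j nu : lsub (forms_comp j nu).
Proof.
split.
  by split; [exact: (rpred0 (gcomp M nu)) | exact: (rpred0 (forms_submod M f j))].
move=> a x y [xM xF] [yM yF]; split; first by rewrite rpredD ?rpredZ.
exact: (rpredD (S := forms_submod M f j)) (rpredZ a%:MP xF) yF.
Qed.

(** The surjectivity condition of [loclen_transport] for multiplication by [f j]; homogeneous
    coefficients keep it within one degree. *)
Lemma forms_compS (j : 'I_k) nu (w : restr M) : (d j <= nu)%MM ->
  forms_comp j.+1 nu w <-> exists (x v : restr M),
    [/\ forms_comp j nu x, v \in gcomp M (nu - d j)%MM & w = x + (f j *: (v : M))].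
Proof.
move=> dj.
have E (c : 'I_k -> M) : \sum_(i < k | (i < j.+1)%N) f i *: c i =
    \sum_(i < k | (i < j)%N) f i *: c i + f j *: c j.
  rewrite (bigD1 j) //= addrC; congr (_ + _); apply: eq_bigl => i.
  by rewrite -val_eqE /= ltnS ltn_neqAle andbC.
have fv v : v \in gcomp M (nu - d j)%MM -> f j *: v \in gcomp M nu.
  by move=> vM; apply: (@forms_gcomp _ _ _ _ grM _ f d degf nu (fun _ => v)).
split=> [[wM wF] | [x [v [[xM /forms_submodP[c xe]] vM ->]]]].
  have [m [mM we]] := forms_submod_hom grM degf wM wF.
  rewrite E in we; exists (\sum_(i < k | (i < j)%N) f i *: m i), (m j); split=> //.
  - split; last by apply/forms_submodP; exists m.
    have -> : \sum_(i < k | (i < j)%N) f i *: m i = w - f j *: m j by rewrite we addrK.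
    by apply: gcompB => //; apply: fv; have := mM j; rewrite dj.
  by have := mM j; rewrite dj.
split; first by apply: gcompD => //; apply: fv.
apply/forms_submodP; exists (fun i => if i == j then v : M else c i).
rewrite E eqxx xe; congr (_ + _); apply: eq_bigr => i ij.
by rewrite ifN // -val_eqE /= neq_ltn ij.
Qed.

Hypothesis rdimM : has_rdim M (k%:Z - 1).

(** [H] gives the rank of [(M / (f_0, ..., f_{j-1})M)_nu]. For large [nu], multiplication by [f_j]
    embeds the component of degree [nu - d_j] of this quotient into that of degree [nu], with the
    next quotient as cokernel, so [H - mshift (d j) H] comes next. *)
Lemma forms_rank j : (j <= k)%N -> exists H : {mpoly rat[q]}, (msize H <= k - j)%N /\
  eventually (fun nu => exists t,
    loclen S (forms_comp j nu) (fun x => x \in gcomp M nu) t /\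
    H.@[fun p => (nu p)%:R] = t%:R).
Proof.
elim: j => [|j IH] jk.
  have [H [ev e]] := rdimM; exists H; split.
    by rewrite subn0; move: e => /(addIr (-1)) => -[->].
  apply: eventually_mono ev => nu [t bt Ht]; exists t; split=> //.
  have := has_basis_loclen bt.
  have tr := @loclen_transport A S _ _ (fun x : subm (gcomp M nu) => val x)
    (fun v => v = 0) (fun _ => True) (forms_comp 0 nu) (fun x => x \in gcomp M nu) t.
  apply: (tr _ _ _ _ _).1.
  - by [].
  - by [].
  - exact: lsub_forms_comp.
  - move=> v; split=> [-> | [_ [_ /forms_submodP[c]]]].
      by split=> //; apply: (lsub_forms_comp 0 nu).1.
    by rewrite big_pred0 // => v0; apply: val_inj.
  move=> w; split=> [wM | [x [v [[xM _] _ ->]]]].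
    exists 0, (exist _ w wM); rewrite add0r; split=> //.
    exact: (lsub_forms_comp 0 nu).1.
  by rewrite rpredD // (svalP v).
have [H [Hk ev]] := IH (ltnW jk).
pose oj := Ordinal jk.
exists (H - mshift (d oj) H); split.
  by apply: msize_difference; rewrite -subSn // subSS.
have evr := filter_regular_forms regf oj.
have := eventually_and ev (eventually_shift (d oj) (eventually_and ev evr)).
apply: eventually_mono => nu [[t [lt Ht]] [le [[t' [lt' Ht']] reg]]].
have l1 : loclen S (forms_comp j nu) (forms_comp j.+1 nu) t'.
  pose g (x : restr M) : restr M := f oj *: (x : M).
  have tr := @loclen_transport A S _ _ g (forms_comp j (nu - d oj)%MM)
    (fun x => x \in gcomp M (nu - d oj)%MM) (forms_comp j nu) (forms_comp j.+1 nu) t'.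
  apply: (tr _ _ _ _ _).1 => //.
  - by move=> a x y; rewrite /g scalerDr !scalerA mulrC -scalerA.
  - exact: lsub_mem.
  - exact: lsub_forms_comp.
  - move=> v; split=> [[vM vF] | [vM [_ vF]]]; last by split=> //; apply: reg.
    split=> //; split; first exact: (@forms_gcomp _ _ _ _ grM _ f d degf nu (fun _ => v)).
    exact: (rpredZ (f oj) vF).
  by move=> w; rewrite (@forms_compS oj nu w le); split=> -[x [v [h1 h2 h3]]]; exists x, v.
have inc : incl (forms_comp j nu) (forms_comp j.+1 nu).
  move=> x [xM /forms_submodP[c xe]]; split=> //; apply/forms_submodP.
  exists (fun i : 'I_k => if (i < j)%N then c i else 0).
  rewrite xe big_mkcond [RHS]big_mkcond; apply: eq_bigr => i _.
  case: (boolP (i < j)%N) => ij; first by rewrite (ltnW ij : (i < j.+1)%N).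
  by rewrite scaler0; case: ifP.
have [b lb tb] := loclenB (lsub_forms_comp j.+1 nu) (lsub_mem (gcomp M nu))
  inc (fun x => @proj1 _ _) l1 lt.
exists b; split=> //.
by rewrite mevalB mshift_eval // Ht Ht' tb natrD addrC addKr.
Qed.

(** After all [k] forms the rank polynomial is zero, so the generic length is 0. *)
Lemma forms_torsion : eventually (fun nu => forall x : M, x \in gcomp M nu ->
  exists2 s : A, s != 0 & s%:MP *: x \in forms_submod M f k).
Proof.
have [H [Hk ev]] := forms_rank (leqnn k).
apply: eventually_mono ev => nu [t [lt Ht]] x xM.
have H0 : H = 0 by apply/eqP; rewrite -msize_poly_eq0 -leqn0 -(subnn k).
move: Ht; rewrite H0 meval0 => /esym/eqP; rewrite Num.Theory.pnatr_eq0 => /eqP t0.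
rewrite t0 in lt; have [s s0 [_ sF]] := loclen0P (lsub_forms_comp k nu) (lsub_mem (gcomp M nu))
  (fun x => @proj1 _ _) lt xM.
by exists s.
Qed.

End RankOfQuotients.

(** * Exactness of the Koszul complex *)

Section KoszulExact.
Variables (A : idomainType) (q : nat) (n : 'I_q -> nat) (M : gmodule A n).
Hypothesis grM : multigraded M.
Variables (k : nat) (f : 'I_k -> {mpoly A[nvars n]}) (d : 'I_k -> 'X_{1..q}).
Hypothesis degf : forall i, homogeneous (d i) (f i).
Local Notation ext := {ffun {set 'I_k} -> restr M}.
Implicit Types (phi psi : ext) (I J : {set 'I_k}) (nu : 'X_{1..q}).

Lemma kdiffE phi J : kdiff f phi J =
  \sum_(i | i \notin J) (-1) ^+ ksign i (i |: J) *: (f i *: (phi (i |: J) : M)).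
Proof.
rewrite ffunE (exchange_big_dep xpredT) //= [RHS]big_mkcond.
apply: eq_bigr => i _; case: ifP => [iJ | /negbFE iJ].
  rewrite (big_pred1 (i |: J)) // => I /=.
  apply/andP/eqP => [[iI /eqP <-] | ->]; first by rewrite setD1K.
  by rewrite setU11 setU1K.
rewrite big_pred0 // => I; apply/negP => /andP[iI /eqP e].
by move: iJ; rewrite -e !inE eqxx.
Qed.

Lemma kcompP nu p phi : phi \in kcomp M d nu p <->
  forall I, if (#|I| == p) && (kdeg d I <= nu)%MM
     then phi I \in gcomp M (nu - kdeg d I)%MM else phi I == 0.
Proof. by split=> [/forallP | h]; last exact/forallP. Qed.

Lemma kcomp_set0 nu phi : phi \in kcomp M d nu 0 -> phi set0 \in gcomp M nu.
Proof.
move=> /kcompP/(_ set0); rewrite cards0 /kdeg big_set0 subm0 ifT //.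
by apply/mnm_lepP => l; rewrite mnm0E.
Qed.

Lemma kdeg_setU1 i I : i \notin I -> kdeg d (i |: I) = (d i + kdeg d I)%MM.
Proof. by move=> iI; rewrite /kdeg big_setU1. Qed.

Lemma kdeg_setU1_le i I nu : i \notin I -> (d i <= nu)%MM ->
  (kdeg d (i |: I) <= nu)%MM = (kdeg d I <= nu - d i)%MM.
Proof.
move=> iI /mnm_lepP le; rewrite kdeg_setU1 //.
by apply/mnm_lepP/mnm_lepP => h l; move: (h l) (le l); rewrite mnmDE mnmBE; lia.
Qed.

Lemma subm_kdeg_setU1 i I nu : i \notin I ->
  (nu - kdeg d (i |: I))%MM = (nu - d i - kdeg d I)%MM.
Proof. by move=> iI; rewrite kdeg_setU1 // submDA. Qed.

Definition below j I := I \subset [set i : 'I_k | (i < j)%N].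

Lemma below_setU1 j i I : below j (i |: I) = (i < j)%N && below j I.
Proof. by rewrite /below subUset sub1set inE. Qed.

Lemma below_notin (j : 'I_k) I : below j I -> j \notin I.
Proof. by move=> /subsetP bI; apply/negP => /bI; rewrite inE ltnn. Qed.

Lemma belowS (j : 'I_k) I : j \notin I -> below j.+1 I = below j I.
Proof.
move=> jI; apply/subsetP/subsetP => h i iI; have := h i iI; rewrite !inE; last exact: leqW.
rewrite ltnS leq_eqVlt => /predU1P[e | //].
by move: jI; rewrite -(val_inj e) iI.
Qed.

(** The Koszul complex of the first [j] forms is kept as a subcomplex of the full one, so that all
    stages share the type [ext]. *)
Definition supported j phi := forall I, ~~ below j I -> phi I = 0.

Lemma supported_kdiff j phi : supported j phi -> supported j (kdiff f phi).
Proof.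
move=> sphi J nb; rewrite kdiffE big1 // => i _.
by rewrite (sphi (i |: J)) ?scaler0 // below_setU1 negb_and nb orbT.
Qed.

(* For [I] below [j], [e_(j |: I)] is [e_I] wedge [e_j]; [slice] extracts the coefficient
   of [e_j] and [unslice] is the right multiplication by [e_j]. *)
Section Slice.
Variable j : 'I_k.

Definition slice phi : ext := [ffun J : {set 'I_k} => if below j J then phi (j |: J) else 0].
Definition unslice phi : ext := [ffun I : {set 'I_k} => if j \in I then phi (I :\ j) else 0].

Lemma supported_slice phi : supported j (slice phi).
Proof. by move=> J nb; rewrite ffunE (negPf nb). Qed.

Lemma supported_unslice phi : supported j phi -> supported j.+1 (unslice phi).
Proof.
move=> sphi I nb; rewrite ffunE; case: ifP => // jI; apply: sphi.
by apply: contra nb => b; rewrite -(setD1K jI) below_setU1 ltnSn belowS // !inE eqxx.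
Qed.

Lemma unsliceK phi : supported j phi -> slice (unslice phi) = phi.
Proof.
move=> sphi; apply/ffunP => J; rewrite !ffunE; case: ifP => b; last by rewrite sphi ?b.
by rewrite setU11 setU1K // below_notin.
Qed.

(** A contributing [i] is smaller than [j], so [ksign i] does not see [j]. *)
Lemma kdiff_slice phi J : supported j.+1 phi -> below j J ->
  kdiff f phi (j |: J) = kdiff f (slice phi) J.
Proof.
move=> sphi bJ; have jJ := below_notin bJ; rewrite !kdiffE.
rewrite [RHS](bigD1 j) //= ffunE below_setU1 ltnn /= !scaler0 add0r.
rewrite [LHS](eq_bigl (fun i => (i \notin J) && (i != j))); last first.
  by move=> i; rewrite !inE negb_or andbC.
apply: eq_bigr => i /andP[iJ ij]; rewrite ffunE below_setU1 bJ andbT setUCA.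
case: ifP => lt; last first.
  rewrite (sphi (j |: _)) ?scaler0 // below_setU1 below_setU1 ltnSn /=.
  rewrite negb_and -leqNgt ltn_neqAle leqNgt lt eq_sym.
  by rewrite (ij : val i != val j).
rewrite (_ : ksign i (j |: _) = ksign i (i |: J)) //.
apply: eq_card => l; rewrite !inE.
by case: (ltnP l i) => li; rewrite ?andbF // !andbT (_ : l == j = false) //;
  apply/eqP => le; move: li; rewrite le ltnNge ltnW.
Qed.

Lemma slice_comp nu p phi : (d j <= nu)%MM ->
  phi \in kcomp M d nu p.+1 -> slice phi \in kcomp M d (nu - d j)%MM p.
Proof.
move=> le /kcompP phiP; apply/kcompP => J; rewrite ffunE.
case: (boolP (below j J)) => [/below_notin jJ | _]; last first.
  by case: ifP => // _; apply: gcomp0.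
have := phiP (j |: J); rewrite cardsU1 jJ eqSS kdeg_setU1_le //.
by rewrite subm_kdeg_setU1.
Qed.

Lemma unslice_comp nu p phi : (d j <= nu)%MM ->
  phi \in kcomp M d (nu - d j)%MM p -> unslice phi \in kcomp M d nu p.+1.
Proof.
move=> le /kcompP phiP; apply/kcompP => I; rewrite ffunE.
case: (boolP (j \in I)) => [jI | _]; last first.
  by case: ifP => // _; apply: gcomp0.
have jI' : j \notin I :\ j by rewrite !inE eqxx.
rewrite -(setD1K jI) setU1K // cardsU1 jI' eqSS kdeg_setU1_le //.
by rewrite subm_kdeg_setU1 //; apply: phiP.
Qed.

End Slice.

Definition exact_at j nu := forall p phi, phi \in kcomp M d nu p.+1 ->
  supported j phi -> kdiff f phi = 0 ->
  exists psi, [/\ psi \in kcomp M d nu p.+2, supported j psi & kdiff f psi = phi].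

Lemma kdiff_set0 phi : kdiff f phi set0 = \sum_i f i *: (phi [set i] : M).
Proof.
rewrite kdiffE; apply: eq_big => [i | i _]; first by rewrite inE.
rewrite setU0 (_ : ksign i [set i] = 0%N) ?expr0 ?scale1r //.
by apply: eq_card0 => l; rewrite !inE; case: eqVneq => [-> | //]; rewrite ltnn.
Qed.

(** Homogeneous coefficients of [m] are placed on the singletons. This serves both the inductive
    step of exactness and the kernel of the augmentation. *)
Lemma koszul_boundary0 j nu (m : M) : m \in gcomp M nu -> m \in forms_submod M f j ->
  exists psi, [/\ psi \in kcomp M d nu 1, supported j psi,
    kdiff f psi set0 = m & forall J, J != set0 -> kdiff f psi J = 0].
Proof.
move=> mM mF; have [c [cM me]] := forms_submod_hom grM degf mM mF.
pose psi : ext := [ffun I : {set 'I_k} => \sum_(i < k | (i < j)%N && (I == [set i])) c i].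
have psi1 i : psi [set i] = if (i < j)%N then c i else 0.
  rewrite ffunE; case: ifP => ij.
    rewrite (big_pred1 i) // => l; rewrite /= (inj_eq set1_inj) [RHS]eq_sym.
    by rewrite andb_idl // => /eqP<-.
  rewrite big_pred0 // => l; rewrite (inj_eq set1_inj).
  by case: eqVneq => [<- | _]; rewrite ?ij ?andbF.
have psi0 I : #|I| != 1%N -> psi I = 0.
  move=> cI; rewrite ffunE big_pred0 // => i; apply/negP => /andP[_ /eqP Ie].
  by move: cI; rewrite Ie cards1.
exists psi; split.
- apply/kcompP => I; have [/cards1P[i ->] | c1] := boolP (#|I| == 1%N); last first.
    by rewrite psi0 //= eqxx.
  rewrite /= psi1 /kdeg big_set1; case: (ltnP i j) => ij; first exact: cM.
  by case: ifP => // _; apply: gcomp0.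
- move=> I nb; have [/cards1P[i e] | c1] := boolP (#|I| == 1%N); last by rewrite psi0.
  by move: nb; rewrite e psi1 /below sub1set inE => /negPf->.
- rewrite kdiff_set0 me [RHS]big_mkcond; apply: eq_bigr => i _; rewrite psi1.
  by case: ifP => // _; rewrite scaler0.
move=> J J0; rewrite kdiffE big1 // => i iJ; rewrite psi0 ?scaler0 //.
by rewrite cardsU1 iJ eqSS cards_eq0.
Qed.

(** The coefficient [beta] of [e_j] in [phi] is a cycle for the first [j] forms, hence the boundary
    of some [gamma']. Subtracting the boundary of [gamma'] wedge [e_j] removes [e_j] from [phi], and
    exactness at [nu] for the first [j] forms applies. *)
Lemma exact_at_next (j : 'I_k) nu : (d j <= nu)%MM ->
  (forall m : M, m \in gcomp M (nu - d j)%MM -> f j *: m \in forms_submod M f j ->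
     m \in forms_submod M f j) ->
  exact_at j nu -> exact_at j (nu - d j)%MM -> exact_at j.+1 nu.
Proof.
move=> le reg ex ex' p phi phiC sphi dphi.
pose beta := slice j phi.
have betaC : beta \in kcomp M d (nu - d j)%MM p := slice_comp le phiC.
have sbeta : supported j beta := @supported_slice j phi.
have dbeta : kdiff f beta = 0.
  apply/ffunP => J; rewrite [RHS]ffunE; have [bJ | nb] := boolP (below j J).
    by rewrite -kdiff_slice // dphi ffunE.
  exact: (supported_kdiff sbeta).
have [gamma' [gC sgamma dgamma]] : exists gamma',
    [/\ gamma' \in kcomp M d (nu - d j)%MM p.+1, supported j gamma' & kdiff f gamma' = beta].
  (* When [beta] has degree 0, regularity replaces exactness: [dphi] at [set0] puts [f j] times
     [beta] in [(f_0, ..., f_{j-1})M]. *)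
  case: p phiC betaC => [|p] phiC betaC; last exact: ex'.
  have [|| psi [h1 h2 h3 h4]] := @koszul_boundary0 j (nu - d j)%MM (beta set0).
  - exact: kcomp_set0.
  - have b0 : beta set0 = phi [set j] by rewrite ffunE /below sub0set setU0.
    apply: reg; first exact: kcomp_set0.
    have := congr1 (fun psi : ext => psi set0) dphi; rewrite kdiff_set0 ffunE.
    rewrite (bigD1 j) //= -b0 => /eqP; rewrite addr_eq0 => /eqP->.
    apply/forms_submodP; exists (fun i => - phi [set i] : M).
    rewrite -sumrN [LHS]big_mkcond [RHS]big_mkcond; apply: eq_bigr => i _ /=.
    rewrite scalerN; case: (ltnP i j) => ij; first by rewrite ifT // -val_eqE /= neq_ltn ij.
    case: eqVneq => //= ij'; rewrite sphi ?scaler0 ?oppr0 //.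
    rewrite /below sub1set inE -leqNgt ltn_neqAle ij andbT.
    by rewrite eq_sym (ij' : val i != val j).
  exists psi; split=> //; apply/ffunP => J.
  have [-> // | J0] := eqVneq J set0; rewrite h4 //.
  by have /kcompP/(_ J) := betaC; rewrite cards_eq0 (negPf J0) => /eqP.
pose gamma := unslice j gamma'.
have gammaC : gamma \in kcomp M d nu p.+2 := unslice_comp le gC.
have sgamma1 : supported j.+1 gamma := supported_unslice sgamma.
have linB (x y : ext) : kdiff f (x - y) = kdiff f x - kdiff f y :=
  lin_subB (@kdiff_linear _ _ _ _ _ f) x y.
have linD (x y : ext) : kdiff f (x + y) = kdiff f x + kdiff f y :=
  lin_subD (@kdiff_linear _ _ _ _ _ f) x y.
have dj J : j \in J -> kdiff f gamma J = phi J.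
  move=> jJ; have [b | nb] := boolP (below j (J :\ j)).
    rewrite -(setD1K jJ) kdiff_slice // unsliceK // dgamma ffunE b //.
  have nb1 : ~~ below j.+1 J.
    by rewrite -(setD1K jJ) below_setU1 ltnSn belowS // !inE eqxx.
  by rewrite sphi // (supported_kdiff sgamma1).
have [|||psi [psiC spsi dpsi]] := ex p (phi - kdiff f gamma).
- have gC1 := kdiff_comp grM degf gammaC.
  by have := rpredD phiC (rpredZ (-1) gC1); rewrite scaleN1r.
- move=> J nb; rewrite ffunE [X in _ + X]ffunE.
  have [jJ | jJ] := boolP (j \in J); first by rewrite dj // subrr.
  rewrite sphi ?belowS // kdiffE big1 ?subrr // => i _; rewrite ffunE.
  case: ifP; last by rewrite !scaler0.
  rewrite !inE (negPf jJ) orbF => /eqP<-.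
  by rewrite setU1K // sgamma // !scaler0.
- by rewrite linB dphi kdiffK subr0.
exists (psi + gamma); split; first exact: rpredD.
  move=> I nb; rewrite ffunE sgamma1 // addr0 spsi //; apply: contra nb.
  by move/subset_trans; apply; apply/subsetP => i; rewrite !inE; apply: leqW.
by rewrite linD dpsi subrK.
Qed.

Lemma koszul_exact : filter_regular_seq M f ->
  eventually (fun nu => forall p (x : subm (kcomp M d nu p.+1)),
    koszul_diff grM degf x = 0 -> exists y : subm (kcomp M d nu p.+2), koszul_diff grM degf y = x).
Proof.
move=> regf; suff ev j : (j <= k)%N -> eventually (exact_at j).
  apply: eventually_mono (ev k (leqnn k)) => nu ex p x /(congr1 val) /= dx.
  have [|psi [psiC _ e]] := ex p (val x) (valP x) _ dx.
    by move=> I /negP[]; apply/subsetP => i _; rewrite inE.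
  by exists (exist _ psi psiC); apply: val_inj.
elim: j => [_ | j IH jk].
  (* With no form available, an element of positive degree is zero. *)
  exists 0%MM => nu _ p phi /kcompP phiC sphi _; have phi0 : phi = 0.
    apply/ffunP => I; rewrite ffunE; have [I0 | I0] := eqVneq I set0.
      by have := phiC I; rewrite I0 cards0 => /eqP.
    apply: sphi; apply: contra I0 => /subsetP bI; rewrite -subset0.
    by apply/subsetP => i /bI; rewrite inE.
  exists 0; split; [exact: rpred0 | by move=> I _; rewrite ffunE | ].
  by rewrite phi0; apply: (lin_sub0 (@kdiff_linear _ _ _ _ _ f)).
have evr := filter_regular_forms regf (Ordinal jk).
have evj := IH (ltnW jk).
(* Exactness for the first [j] forms is used both at [nu] and at [nu - d_j]. *)
have := eventually_and evj (eventually_shift (d (Ordinal jk)) (eventually_and evj evr)).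
apply: eventually_mono => nu [ex [le [ex' reg]]].
exact: (@exact_at_next (Ordinal jk) nu).
Qed.

End KoszulExact.

(** * Strands of the Koszul complex *)

(** The product of nonzero annihilators of the generators kills everything. *)
Lemma fin_gen_torsion (A : idomainType) (V : lmodType A) : fin_gen V ->
  (forall v : V, exists2 a : A, a != 0 & a *: v = 0) -> torsion V.
Proof.
move=> [t [g gV]] tor; pose a i := s2val (cid2 (tor (g i))).
have a0 i : a i != 0 := s2valP (cid2 (tor (g i))).
have ag i : a i *: g i = 0 := s2valP' (cid2 (tor (g i))).
exists (\prod_i a i); first by apply/prodf_neq0 => i _.
move=> v; have [c ->] := gV v; rewrite scaler_sumr big1 // => i _.
by rewrite (bigD1 i) //= scalerA -mulrA mulrC -scalerA ag scaler0.
Qed.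

Lemma fin_gen_image (A : comNzRingType) (V W : lmodType A) (g : V -> W) : linear g ->
  (forall w, exists v, g v = w) -> free_fin V -> fin_gen W.
Proof.
move=> gP gs [t [b bb]]; exists t, (g \o b) => w; have [v <-] := gs w.
exists (bcoord bb v); rewrite {1}(bcoord_sum bb v) (lin_sub_sum gP).
by apply: eq_bigr => i _; rewrite (lin_subZ gP).
Qed.

Section KoszulComponents.
Variables (A : idomainType) (q : nat) (n : 'I_q -> nat) (M : gmodule A n).
Hypothesis cfM : componentwise_free M.
Variables (k : nat) (f : 'I_k -> {mpoly A[nvars n]}) (d : 'I_k -> 'X_{1..q}).
Hypothesis degf : forall i, homogeneous (d i) (f i).
Let grM := componentwise_free_multigraded cfM.

(** The component is the direct sum, over the [I] of size [p] with [kdeg d I] at most [nu], of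
    components of [M], whose bases are concatenated. *)
Lemma koszul_free nu p : free_fin (subm (kcomp M d nu p)).
Proof.
pose valid (I : {set 'I_k}) := (#|I| == p) && (kdeg d I <= nu)%MM.
pose W (I : {set 'I_k}) (x : restr M) :=
  if valid I then x \in gcomp M (nu - kdeg d I)%MM else x == 0.
have [_ _ freeM] := cfM.
have bW I : exists t (e : 'I_t -> restr M), [/\ forall l, W I (e l),
    forall x, W I x -> exists c : 'I_t -> A, x = \sum_l c l *: e l &
    forall c : 'I_t -> A, \sum_l c l *: e l = 0 -> forall l, c l = 0].
  rewrite /W; case: (valid I); last first.
    exists 0%N, (fun _ => 0); split=> [l | x /eqP-> | c _ [] //]; first exact: eqxx.
    by exists (fun _ => 0); rewrite big_ord0.
  have [t [e eb]] := freeM (nu - kdeg d I)%MM.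
  have vS (c : 'I_t -> A) : \sum_l c l *: (val (e l) : restr M) = val (\sum_l c l *: e l).
    by rewrite raddf_sum.
  exists t, (fun l => val (e l)); split=> [l | x xW | c].
  - exact: valP (e l).
  - have [c [xe _]] := eb (exist _ x xW); exists c.
    by rewrite vS -xe.
  by rewrite vS => c0; apply: (is_basis_free eb); apply: val_inj.
pose t I := sval (cid (bW I)); have bW1 I := svalP (cid (bW I)).
pose e I := sval (cid (bW1 I)).
have eW I := svalP (cid (bW1 I)); rewrite -/(t _) -/(e _) in eW.
pose T := {I : {set 'I_k} & 'I_(t I)}.
pose b0 (u : T) : {ffun {set 'I_k} -> restr M} :=
  [ffun J => if J == tag u then e _ (tagged u) else 0].
have b0C u : b0 u \in kcomp M d nu p.
  apply/kcompP => J; rewrite ffunE; have [-> | _] := eqVneq J (tag u).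
    by have [/(_ (tagged u)) + _ _] := eW (tag u).
  by case: ifP => // _; apply: gcomp0.
pose b (u : T) : subm (kcomp M d nu p) := exist _ (b0 u) (b0C u).
have bE (c : T -> A) J :
    val (\sum_u c u *: b u) J = \sum_l c (Tagged (fun I => 'I_(t I)) l) *: e J l.
  rewrite raddf_sum sum_ffunE.
  transitivity (\sum_I \sum_(l < t I) c (Tagged (fun I => 'I_(t I)) l) *:
     (if J == I then e _ l else 0 : restr M)).
    rewrite sig_big_dep; apply: eq_bigr => -[I l] _.
    by rewrite /= !ffunE.
  rewrite (bigD1 J) //= [X in _ + X]big1 ?addr0 => [|I /negPf nI].
    by apply: eq_bigr => l _; rewrite eqxx.
  by rewrite big1 // => l _; rewrite eq_sym nI scaler0.
have bb : is_basis b.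
  apply: is_basisI => [x | c c0 [J l]].
    have xW J : exists c : 'I_(t J) -> A, val x J = \sum_l c l *: e J l.
      have [_ + _] := eW J; apply; have /kcompP := valP x; exact.
    exists (fun u => sval (cid (xW (tag u))) (tagged u)).
    apply: val_inj; apply/ffunP => J; rewrite bE /=.
    exact: svalP (cid (xW J)).
  have [_ _ /(_ (fun l => c (Tagged (fun I => 'I_(t I)) l)))] := eW J; apply.
  by rewrite -bE c0 ffunE.
exists #|{: T}|, (b \o enum_val).
exact: is_basis_reindex (@enum_val_bij _) bb.
Qed.

Local Notation N nu := (subm (gcomp (gquot (forms_submod M f k)) nu)).

Fact augmentation_comp nu (x : subm (kcomp M d nu 0)) :
  quotm_pi (forms_submod M f k) (val x set0) \in gcomp (gquot (forms_submod M f k)) nu.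
Proof. by apply/asboolP; exists (val x set0) => //; apply: kcomp_set0 (valP x). Qed.

(** This map identifies the component of the quotient with [H_0] of the strand. *)
Definition augmentation nu (x : subm (kcomp M d nu 0)) : N nu :=
  exist (fun y => y \in gcomp (gquot (forms_submod M f k)) nu) _ (augmentation_comp x).

Lemma augmentation_linear nu : linear (@augmentation nu).
Proof.
move=> a x y; apply: val_inj; rewrite /= !ffunE quotm_piD; congr (_ + _).
exact/esym/(quotm_piZ (forms_submod M f k) a%:MP).
Qed.

Lemma augmentation_surj nu (y : N nu) : exists x, augmentation x = y.
Proof.
have /asboolP[m mM ye] := valP y.
pose phi : {ffun {set 'I_k} -> restr M} := [ffun I => if I == set0 then m else 0].
have phiC : phi \in kcomp M d nu 0.
  apply/kcompP => I; rewrite ffunE cards_eq0; have [-> | _] /= := eqVneq I set0 => //.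
  rewrite /kdeg big_set0 subm0 ifT //.
  by apply/mnm_lepP => l; rewrite mnm0E.
by exists (exist _ phi phiC); apply: val_inj; rewrite /= ye ffunE eqxx.
Qed.

Lemma augmentation_eq0 nu (x : subm (kcomp M d nu 0)) :
  augmentation x = 0 <-> (val x set0 : M) \in forms_submod M f k.
Proof.
split=> [/(congr1 val) /= e | xF].
  by rewrite -[val x set0]subr0; apply/quotm_piP; rewrite e quotm_pi0.
by apply: val_inj; rewrite /= -(quotm_pi0 (forms_submod M f k)); apply/quotm_piP; rewrite subr0.
Qed.

Lemma augmentation_ker nu (x : subm (kcomp M d nu 0)) :
  augmentation x = 0 <-> exists y, x = koszul_diff grM degf y.
Proof.
rewrite augmentation_eq0; split=> [xF | [y ->]].
  have [psi [psiC _ p0 pJ]] := koszul_boundary0 grM degf (kcomp_set0 (valP x)) xF.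
  exists (exist _ psi psiC); apply: val_inj; apply/ffunP => J /=.
  have [-> // | J0] := eqVneq J set0; rewrite pJ //.
  by have /kcompP/(_ J) := valP x; rewrite cards_eq0 (negPf J0) => /eqP.
apply/forms_submodP; exists (fun i => val y [set i]); rewrite /= kdiff_set0.
by apply: eq_bigl => i; rewrite ltn_ord.
Qed.

End KoszulComponents.

Theorem proposition2p8
  (A : idomainType) (noethA : noetherian A) (ufdA : ufd A)
  (q : nat) (q_ge1 : (1 <= q)%N)
  (n : 'I_q -> nat) (n_ge1 : forall p, (1 <= n p)%N)
  (M : gmodule A n) (cfM : componentwise_free M)
  (k : nat) (rdimM : has_rdim M (k%:Z - 1))
  (f : 'I_k -> {mpoly A[nvars n]}) (regf : filter_regular_seq M f)
  (d : 'I_k -> 'X_{1..q}) (degf : forall i, homogeneous (d i) (f i)) :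
  let K nu := koszul (componentwise_free_multigraded cfM) degf nu in
  let N nu := subm (gcomp (gquot (forms_submod M f k)) nu) in
  eventually (fun nu => generically_exact (K nu)) /\
  eventually (fun nu =>
    [/\ fin_gen (N nu), torsion (N nu),
        exists delta, cayley_det (K nu) delta,
        exists c, content ufdA (N nu) c &
        forall delta c, cayley_det (K nu) delta -> content ufdA (N nu) c ->
          exists2 u : A, u \is a GRing.unit & delta = tofrac (u * c)]).
Proof.
move=> K N; set grM := componentwise_free_multigraded cfM.
(* All the claims at [nu] follow from exactness in positive degrees and torsion of [H_0]. *)
pose good nu := (forall i (z : K nu i.+1), cdiff (K nu) i z = 0 ->
    exists y, cdiff (K nu) i.+1 y = z) /\
  (forall x : K nu 0, exists2 a : A, a != 0 & exists y, a *: x = cdiff (K nu) 0 y).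
have ev : eventually good.
  apply: eventually_mono (eventually_and (koszul_exact grM degf regf)
    (forms_torsion grM degf regf rdimM)) => nu [ex tor]; split; first exact: ex.
  move=> x; have [s s0 sF] := tor _ (kcomp_set0 (valP x)); exists s => //.
  by apply/(augmentation_ker cfM degf)/augmentation_eq0; rewrite /= ffunE.
split; apply: eventually_mono ev => nu [ex tor].
  exact: generically_exact_torsion.
have lin := @augmentation_linear A q n M k f d nu.
have surj := @augmentation_surj A q n M k f d nu.
have ker : forall x : K nu 0, augmentation f x = 0 <-> exists y, x = cdiff (K nu) 0 y.
  exact: augmentation_ker.
have fgN : fin_gen (N nu) := fin_gen_image lin surj (koszul_free cfM d nu 0).
have detK : exists delta, cayley_det (K nu) delta.
  by apply: cayley_det_exists => // i; apply: koszul_free.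
split=> //.
- apply: fin_gen_torsion => // v; have [x <-] := surj v; have [a a0 [y e]] := tor x.
  exists a => //; rewrite -(lin_subZ lin); apply/ker; by exists y.
- exact: (content_exists ufdA ex lin surj ker).
exact: (cayley_det_content ex lin surj ker detK).
Qed.
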